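(* Let $L/K$ be a finite Galois extension of local fields with group $G$ and set $d=[L:K]$. Let $\alpha$ be an element of $L_K^\times$ such that $w_{L/K}(\alpha)=-1/d$, and let $s\in G$. If $\beta\in L_K^\times$ satisfies $$\sigma(\beta)/\beta=s(\alpha)/\alpha,$$ then $$\eta_{L/K}(s)=N_{L/K}(\beta)\mod N_{L/K}L^\times .$$
   Context: A local field is a complete discretely valued nonarchimedean field with finite residue field (of characteristic $0$ or $p$). $K$ is a local field whose residue field has $q$ elements; $v$ is its normalized valuation ($v(\pi)=1$ for a uniformizer $\pi$), extended to $K^{nr}$. $K^{nr}$ is a fixed completion of the maximal unramified extension of $K$, and $\sigma$ is the unique automorphism of $K^{nr}$ inducing the $q$th power map on the residue field and having fixed field $K$. For a finite extension $L/K$ put $L_K=K^{nr}\otimes_K L$; $\sigma$ also denotes $\sigma\otimes\mathrm{id}_L$ on $L_K$. $N_{L/K}:L_K^\times\to(K^{nr})^\times$ is the norm of the finite free $K^{nr}$-algebra $L_K$ (extending the field norm $L^\times\to K^\times$), and $w_{L/K}:L_K^\times\to\mathbb{Q}$ is $w_{L/K}(x)=[L:K]^{-1}v(N_{L/K}(x))$. If $L/K$ is Galois with group $G$, then $G$ acts on $L_K$ through the factor $L$, commuting with $\sigma$. The fundamental class $u_{L/K}\in H^2(G,L^\times)\simeq\mathrm{Br}(L/K)$ is the class of invariant $1/d$. Here a normalized 2-cocycle $(a_{s,t})$ corresponds to the crossed product algebra $\bigoplus_{s\in G}L\,u_s$ with $u_su_t=a_{s,t}u_{st}$, $u_s\ell=s(\ell)u_s$,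 and the invariant isomorphism $\mathrm{Br}(K)\simeq\mathbb{Q}/\mathbb{Z}$ is in Serre's normalization: if $M/K$ is unramified of degree $n$ with arithmetic Frobenius $\varphi$ and $\pi$ is a uniformizer of $K$, the algebra $\bigoplus_{0\le i<n}Mu^i$ with $u^n=\pi$, $ux=\varphi(x)u$ has invariant $1/n$. $\eta_{L/K}:G^{ab}\to K^\times/N_{L/K}(L^\times)$ is the homomorphism induced by the cup product $\cup\,u_{L/K}:\hat H^{-2}(G,\mathbb{Z})\to\hat H^0(G,L^\times)$ and the standard identifications $\hat H^{-2}(G,\mathbb{Z})\simeq G^{ab}$, $\hat H^0(G,L^\times)=K^\times/N_{L/K}L^\times$, with sign conventions as in Serre's Corps locaux, i.e. such that for a 2-cocycle $(a_{s,t})$ representing $u_{L/K}$ the element $\bar s\cup u_{L/K}$ is the class of $\prod_{t\in G}a_{t,s}$. One writes $\eta_{L/K}(s)$ for the image of the class of $s\in G$. *)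

(* Defs.v *)
From HB Require Import structures.
From mathcomp Require Import all_boot all_order all_algebra all_fingroup.
From mathcomp Require Import all_solvable all_field.
From mathcomp Require Import boolp classical_sets.

Set Implicit Arguments.
Unset Strict Implicit.
Unset Printing Implicit Defensive.

Import Order.TTheory GRing.Theory Num.Theory.

Local Open Scope ring_scope.
Local Open Scope classical_set_scope.

(* A valuation is a function to [int]; its value at 0, which should be +oo,
   is a junk value that no definition below looks at. *)
Definition val_ge (F : fieldType) (v : F -> int) (n : int) (x : F) : Prop :=
  x = 0 \/ n <= v x.

Record normalized_valuation (F : fieldType) (v : F -> int) : Prop := {
  valM : forall x y, x != 0 -> y != 0 -> v (x * y) = v x + v y;
  valD : forall x y n, val_ge v n x -> val_ge v n y -> val_ge v n (x + y);
  val_unif : exists2 x, x != 0 & v x = 1 }.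

Definition val_extends (F E : fieldType) (f : F -> E)
    (v : F -> int) (w : E -> int) : Prop :=
  forall x, x != 0 -> w (f x) = v x.

Definition val_cauchy (F : fieldType) (v : F -> int) (u : nat -> F) : Prop :=
  forall n : int, exists N : nat,
    forall i j : nat, (N <= i)%N -> (N <= j)%N -> val_ge v n (u i - u j).

Definition val_cvg (F : fieldType) (v : F -> int) (u : nat -> F) (l : F) : Prop :=
  forall n : int, exists N : nat,
    forall i : nat, (N <= i)%N -> val_ge v n (u i - l).

Definition val_complete (F : fieldType) (v : F -> int) : Prop :=
  forall u, val_cauchy v u -> exists l, val_cvg v u l.

(* [r] is a system of representatives of the ring of integers modulo its
   maximal ideal, that is, a bijection from 'I_q to the residue field. *)
Definition residue_card (F : fieldType) (v : F -> int) (q : nat) : Prop :=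
  exists r : 'I_q -> F,
    (forall i, val_ge v 0 (r i)) /\
    (forall x, val_ge v 0 x -> exists! i, val_ge v 1 (x - r i)).

Record local_field (K : fieldType) (v : K -> int) (q : nat) : Prop := {
  local_valuation : normalized_valuation v;
  local_complete : val_complete v;
  local_residue : residue_card v q }.

Definition residue_power (F : fieldType) (v : F -> int) (q : nat)
    (f : F -> F) : Prop :=
  forall x, val_ge v 0 x -> val_ge v 1 (f x - x ^+ q).

(* For the finite extension M/K, [w] extends [v] and is still normalized, so
   the ramification index is 1; the residue extension is separable because the
   residue field of K is finite. *)
Definition unramified (K : fieldType) (v : K -> int)
    (M : fieldExtType K) (w : M -> int) : Prop :=
  normalized_valuation w /\ val_extends (fun x : K => x%:A : M) v w.

Definition embedding_over (K : fieldType) (M : fieldExtType K) (E : fieldType)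
    (j : K -> E) (f : M -> E) : Prop :=
  forall x : K, f x%:A = j x.

(* Kun is the union of its finite unramified subextensions, and every finite
   unramified extension of K embeds in it. *)
Record max_unramified (K : fieldType) (v : K -> int)
    (Kun : fieldType) (j : {rmorphism K -> Kun}) (vun : Kun -> int) : Prop := {
  mxu_valuation : normalized_valuation vun;
  mxu_extends : val_extends j v vun;
  mxu_union : forall x : Kun,
    exists (M : fieldExtType K) (w : M -> int) (f : {rmorphism M -> Kun}),
      [/\ unramified v w, embedding_over j f & exists y, f y = x];
  mxu_maximal : forall (M : fieldExtType K) (w : M -> int), unramified v w ->
    exists f : {rmorphism M -> Kun}, embedding_over j f }.

Record completion (F : fieldType) (v : F -> int)
    (E : fieldType) (i : {rmorphism F -> E}) (w : E -> int) : Prop := {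
  cpl_valuation : normalized_valuation w;
  cpl_extends : val_extends i v w;
  cpl_complete : val_complete w;
  cpl_dense : forall (y : E) (n : int), exists x : F, val_ge w n (y - i x) }.

Definition completed_max_unramified (K : fieldType) (v : K -> int)
    (Knr : fieldType) (iota : {rmorphism K -> Knr}) (vnr : Knr -> int) : Prop :=
  exists (Kun : fieldType) (j : {rmorphism K -> Kun}) (vun : Kun -> int)
         (i : {rmorphism Kun -> Knr}),
    [/\ max_unramified v j vun, completion vun i vnr
      & forall x, iota x = i (j x)].

Record frobenius (K Knr : fieldType) (q : nat) (iota : {rmorphism K -> Knr})
    (vnr : Knr -> int) (sigma : {rmorphism Knr -> Knr}) : Prop := {
  frob_bij : bijective sigma;
  frob_residue : residue_power vnr q sigma;
  frob_fixed : forall x, sigma x = x <-> exists y, x = iota y }.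

Definition alg_norm (F : fieldType) (A : falgType F) (x : A) : F :=
  \det (\matrix_(i, j) coord (vbasis {:A}) j ((vbasis {:A})`_i * x)).

(* An element of E (x)_F L is stored as the row of its E-coordinates in the
   E-basis 1 (x) e_i, where (e_i) is the F-basis [vbasis fullv] of L; the
   product is the bilinear extension of (c (x) a) (d (x) b) = cd (x) ab.
   [iota] is a phantom parameter: the ring structure depends on it. *)
Definition base_change (F E : fieldType) (iota : {rmorphism F -> E})
    (L : fieldExtType F) : Type := 'rV[E]_(\dim {:L}).

Arguments base_change {F E} iota L.

Section BaseChange.

Variables (F E : fieldType) (iota : {rmorphism F -> E}) (L : fieldExtType F).

Local Notation e := (vbasis (fullv : {vspace L})).
Local Notation n := (\dim (fullv : {vspace L})).

Local Notation LE := (base_change iota L).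

HB.instance Definition _ := Vector.copy LE 'rV[E]_n.

Definition tensor (c : E) (a : L) : LE :=
  \row_i (c * iota (coord e i a)).

Definition bc_mul (x y : LE) : LE :=
  \sum_(i < n) \sum_(j < n) tensor (x 0 i * y 0 j) (e`_i * e`_j).

Fact tensorDl c d a : tensor (c + d) a = tensor c a + tensor d a.
Proof. by apply/rowP => i; rewrite !mxE mulrDl. Qed.

Fact tensorDr c a b : tensor c (a + b) = tensor c a + tensor c b.
Proof. by apply/rowP => i; rewrite !mxE linearD rmorphD mulrDr. Qed.

Fact tensorZ c d a : tensor (c * d) a = c *: tensor d a.
Proof. by apply/rowP => i; rewrite !mxE mulrA. Qed.

Fact tensor_scale c k a : tensor c (k *: a) = tensor (c * iota k) a.
Proof. by apply/rowP => i; rewrite !mxE linearZ rmorphM mulrA. Qed.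

Fact tensor0l a : tensor 0 a = 0.
Proof. by apply/rowP => i; rewrite !mxE mul0r. Qed.

Fact tensor0r c : tensor c 0 = 0.
Proof. by apply/rowP => i; rewrite !mxE linear0 rmorph0 mulr0. Qed.

Fact tensor_suml I r (P : pred I) (c : I -> E) a :
  tensor (\sum_(i <- r | P i) c i) a = \sum_(i <- r | P i) tensor (c i) a.
Proof.
apply: (big_morph (fun c => tensor c a)) => [x y|]; first exact: tensorDl.
exact: tensor0l.
Qed.

Fact tensor_sumr I r (P : pred I) c (a : I -> L) :
  tensor c (\sum_(i <- r | P i) a i) = \sum_(i <- r | P i) tensor c (a i).
Proof.
apply: (big_morph (tensor c)) => [x y|]; first exact: tensorDr.
exact: tensor0r.
Qed.

Fact base_change_basis (x : LE) : x = \sum_(i < n) tensor (x 0 i) e`_i.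
Proof.
apply/rowP => k; rewrite summxE (bigD1 k) //= big1 => [|i neq_ik].
  by rewrite mxE coord_free ?(basis_free (vbasisP _)) // eqxx rmorph1 mulr1 addr0.
rewrite mxE coord_free ?(basis_free (vbasisP _)) //.
by rewrite (negPf neq_ik) rmorph0 mulr0.
Qed.

Fact bc_mulDl : left_distributive bc_mul +%R.
Proof.
move=> x y z; rewrite /bc_mul -big_split; apply: eq_bigr => i _ /=.
rewrite -big_split; apply: eq_bigr => j _ /=.
by rewrite mxE mulrDl tensorDl.
Qed.

Fact bc_mulC : commutative bc_mul.
Proof.
move=> x y; rewrite /bc_mul exchange_big; apply: eq_bigr => j _ /=.
by apply: eq_bigr => i _; rewrite mulrC [X in tensor _ X]mulrC.
Qed.

Fact bc_mulDr : right_distributive bc_mul +%R.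
Proof. by move=> x y z; rewrite bc_mulC bc_mulDl !(bc_mulC x). Qed.

Fact bc_mul_tensor c d a b :
  bc_mul (tensor c a) (tensor d b) = tensor (c * d) (a * b).
Proof.
rewrite {2}(coord_vbasis (memvf a)) {2}(coord_vbasis (memvf b)).
rewrite big_distrlr /= tensor_sumr; apply: eq_bigr => i _.
rewrite tensor_sumr; apply: eq_bigr => j _.
by rewrite !mxE -scalerAl -scalerAr !tensor_scale mulrACA mulrA.
Qed.

Fact bc_mul0l x : bc_mul 0 x = 0.
Proof.
by apply: (addrI (bc_mul 0 x)); rewrite -bc_mulDl !addr0.
Qed.

Fact bc_ind (P : LE -> Prop) :
  P 0 -> (forall x y, P x -> P y -> P (x + y)) ->
  (forall c a, P (tensor c a)) -> forall x, P x.
Proof. by move=> P0 PD PT x; rewrite (base_change_basis x); elim/big_ind: _. Qed.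

Fact bc_mulA : associative bc_mul.
Proof.
have mul0r' x : bc_mul x 0 = 0 by rewrite bc_mulC bc_mul0l.
elim/bc_ind => [|x x' IHx IHx'|c a] y z; first by rewrite !bc_mul0l.
  by rewrite !bc_mulDl IHx IHx'.
elim/bc_ind: y => [|y y' IHy IHy'|d b]; first by rewrite !(bc_mul0l, mul0r').
  by rewrite !(bc_mulDl, bc_mulDr) IHy IHy'.
elim/bc_ind: z => [|z z' IHz IHz'|f g]; first by rewrite !mul0r'.
  by rewrite !bc_mulDr IHz IHz'.
by rewrite !bc_mul_tensor !mulrA.
Qed.

Fact bc_mul1l : left_id (tensor 1 1) bc_mul.
Proof.
elim/bc_ind => [|x y IHx IHy|c a]; first by rewrite bc_mulC bc_mul0l.
  by rewrite bc_mulDr IHx IHy.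
by rewrite bc_mul_tensor !mul1r.
Qed.

Fact bc_oner_neq0 : tensor 1 1 != 0.
Proof.
apply/eqP => /rowP eq0; case/eqP: (oner_neq0 L).
rewrite (coord_vbasis (memvf 1)) big1 // => i _.
have := eq0 i; rewrite !mxE mul1r => /eqP; rewrite fmorph_eq0 => /eqP->.
by rewrite scale0r.
Qed.

HB.instance Definition _ := GRing.Zmodule_isComNzRing.Build LE
  bc_mulA bc_mulC bc_mul1l bc_mulDl bc_oner_neq0.

Fact bc_scaleAl (k : E) (x y : LE) : k *: (x * y) = k *: x * y.
Proof.
have scaleT (c d : E) a : c *: tensor d a = tensor (c * d) a by rewrite tensorZ.
elim/bc_ind: x => [|x x' IHx IHx'|c a]; first by rewrite scaler0 !mul0r scaler0.
  by rewrite scalerDr !mulrDl scalerDr IHx IHx'.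
elim/bc_ind: y => [|y y' IHy IHy'|d b]; first by rewrite !mulr0 scaler0.
  by rewrite !mulrDr scalerDr IHy IHy'.
by rewrite scaleT ![_ * _ : LE]bc_mul_tensor scaleT mulrA.
Qed.

HB.instance Definition _ :=
  GRing.Lmodule_isLalgebra.Build E LE bc_scaleAl.
HB.instance Definition _ := GRing.Lalgebra_isComAlgebra.Build E LE.
HB.instance Definition _ := Algebra_isFalgebra.Build E LE.

Lemma tensorM c d a b : tensor c a * tensor d b = tensor (c * d) (a * b).
Proof. exact: bc_mul_tensor. Qed.

(* f (x) id and id (x) g; [f] must be a ring morphism over F,
   [g] must be F-linear. *)
Definition bc_left (f : E -> E) (x : LE) : LE :=
  \sum_(i < n) tensor (f (x 0 i)) e`_i.

Definition bc_right (g : L -> L) (x : LE) : LE :=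
  \sum_(i < n) tensor (x 0 i) (g e`_i).

Lemma bc_left_tensor (f : {rmorphism E -> E}) c a :
  (forall k, f (iota k) = iota k) -> bc_left f (tensor c a) = tensor (f c) a.
Proof.
move=> fK; rewrite {2}(coord_vbasis (memvf a)) tensor_sumr.
apply: eq_bigr => i _.
by rewrite mxE rmorphM fK tensor_scale.
Qed.

Lemma bc_right_tensor (g : {linear L -> L}) c a :
  bc_right g (tensor c a) = tensor c (g a).
Proof.
rewrite {2}(coord_vbasis (memvf a)) linear_sum tensor_sumr.
apply: eq_bigr => i _.
by rewrite mxE linearZ tensor_scale.
Qed.

End BaseChange.

Arguments tensor {F E} iota {L} c a.
Arguments bc_left {F E iota L} f x.
Arguments bc_right {F E iota L} g x.

(* 'M_m(A) and 'M_k(B) are isomorphic F-algebras for some m, k > 0. *)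
Definition brauer_equiv (F : fieldType) (A B : falgType F) : Prop :=
  exists (m k : nat) (f : {rmorphism 'M[A]_m.+1 -> 'M[B]_k.+1}),
    bijective f /\ forall c : F, f (c%:A%:M) = c%:A%:M.

(* C is the direct sum of the M u^i for 0 <= i < n, with u^n = b and
   u x = phi(x) u, where n = [M : K]. *)
Definition cyclic_algebra (K : fieldType) (M : fieldExtType K)
    (phi : M -> M) (b : K) (C : falgType K) : Prop :=
  exists (i : {lrmorphism M -> C}) (u : C),
    [/\ u ^+ \dim {:M} = b%:A,
        forall x, u * i x = i (phi x) * u
      & forall c, exists! x : {ffun 'I_(\dim {:M}) -> M},
          c = \sum_(k < \dim {:M}) i (x k) * u ^+ k].

(* The invariant isomorphism Br(K) -> Q/Z, as a relation between algebras and
   rationals modulo Z. Every class is that of a cyclic algebra (M/K, phi, pi^k)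
   with M/K unramified of degree n and arithmetic Frobenius phi; this class is
   k times that of (M/K, phi, pi), whose invariant is 1/n. *)
Definition has_invariant (K : fieldType) (v : K -> int) (q : nat)
    (A : falgType K) (r : rat) : Prop :=
  exists (M : fieldExtType K) (w : M -> int) (phi : {lrmorphism M -> M})
         (p : K) (k : nat) (C : falgType K),
    [/\ unramified v w /\ residue_power w q phi,
        p != 0 /\ v p = 1,
        cyclic_algebra phi (p ^+ k) C,
        brauer_equiv A C
      & r - k%:R / (\dim {:M})%:R \is a Num.int].

(* All elements of the type [gal_of {:L}] fix K, so for L/K Galois this type is
    the whole of Gal(L/K). In it (x * y)%g is "x, then y"; [gcomp s t] is the
    product "t, then s" by which Gal(L/K) acts on L on the left. *)

Section FundamentalClass.

Variables (K : fieldType) (v : K -> int) (q : nat) (L : splittingFieldType K).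

Local Notation G := (gal_of {:L}).

Definition gcomp (s t : G) : G := (t * s)%g.

Lemma gcompE s t x : gcomp s t x = s (t x).
Proof. by rewrite /gcomp galM ?memvf. Qed.

Definition cocycle2 (a : G -> G -> L) : Prop :=
  (forall s t, a s t != 0) /\
  (forall s t r : G, s (a t r) * a s (gcomp t r) = a s t * a (gcomp s t) r).

Definition normalized_cochain2 (a : G -> G -> L) : Prop :=
  forall s, a 1%g s = 1 /\ a s 1%g = 1.

Definition cohomologous2 (a a' : G -> G -> L) : Prop :=
  exists c : G -> L, (forall s, c s != 0) /\
    forall s t : G, a s t = a' s t * (c s * s (c t) / c (gcomp s t)).

Definition crossed_product (a : G -> G -> L) (B : falgType K) : Prop :=
  exists (i : {lrmorphism L -> B}) (u : G -> B),
    [/\ forall s t : G, u s * u t = i (a s t) * u (gcomp s t),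
        forall (s : G) (x : L), u s * i x = i (s x) * u s
      & forall b, exists! x : {ffun G -> L}, b = \sum_(s : G) i (x s) * u s].

(* The 2-cocycle [a] represents u_{L/K}. *)
Definition fundamental_cocycle (a : G -> G -> L) : Prop :=
  cocycle2 a /\
  exists (a' : G -> G -> L) (B : falgType K),
    [/\ cocycle2 a' /\ normalized_cochain2 a', cohomologous2 a a',
        crossed_product a' B
      & has_invariant v q B (\dim {:L})%:R^-1].

(* The class of [y] in K^* modulo the norms from L^*. *)
Definition norm_class (y : K) : set K :=
  [set z | exists2 l : L, l != 0 & z = y * alg_norm l].

(* The class of \prod_t a_{t,s} in K^* modulo the norms from L^*; this is
   the image of s under the cup product with the class of [a]. *)
Definition eta_class (a : G -> G -> L) (s : G) : set K :=
  [set z | exists2 l : L, l != 0 & z%:A = (\prod_t a t s) * (alg_norm l)%:A].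

End FundamentalClass.

(* w_{L/K}(x) = v(N(x)) / [L:K]. *)
Definition w_ext (K Knr : fieldType) (iota : {rmorphism K -> Knr})
    (vnr : Knr -> int) (L : fieldExtType K) (x : base_change iota L) : rat :=
  (vnr (alg_norm x))%:~R / (\dim {:L})%:R.

(* Main.v *)
Require Import Defs.
From HB Require Import structures.
From mathcomp Require Import all_boot all_order all_algebra all_fingroup.
From mathcomp Require Import all_solvable all_field.
From mathcomp Require Import boolp classical_sets.
From mathcomp Require Import zify ring.

(** The idea is to write the fundamental class as an explicit coboundary over
    [L_K]. Suppose that there are units [gamma] and [beta_t] of [L_K] such that
    [a_(s,t) = beta_s s(beta_t) / beta_(st)], [sigma(beta_t)/beta_t = t(gamma)/gamma]
    and [v(N gamma) = -1]. Then [prod_t a_(t,s)] is the product of the conjugates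
    [t(beta_s)], the other factors cancelling, that is [N(beta_s)]: this is the
    assertion for [alpha = gamma] and [beta = beta_s]. For another [alpha], the norm
    of [alpha/gamma] has valuation [0], so that [alpha/gamma = sigma(delta)/delta]
    by Lang's theorem ([lang_base_change]). Then [beta] and [beta_s s(delta)/delta]
    solve the same equation, hence differ by an element of [L], and their norms
    differ by a norm from [L] ([twisted_solutions], [twisted_norm]).

    The elements [gamma] and [beta_t] come from an isocrystal. The crossed product
    [B] of the class is Brauer equivalent to a cyclic algebra [(M/K, phi, p^k)],
    which acts on itself and commutes with right multiplication by [u^-1]. This
    yields an action of [B] on [Knr^d] commuting with a [sigma]-semilinear operator
    whose determinant has valuation [-1] modulo [d] ([invariant_isocrystal]). As a
    module over [L_K], the space [Knr^d] is free of rank one ([cyclic_vector]); on a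
    generator, the semilinear operator and the basis elements [u_t] of [B] act as
    multiplication by elements [gamma] and [beta_t], up to a power of a uniformizer
    of [K] which corrects the valuation ([isocrystal_cocycle]).

    As to Lang's theorem, the equation [sigma y = x y] is linear, and each of its
    nonzero solutions is a unit because [L_K] has no [sigma]-stable ideal
    ([twisted_fixed_unit]). For [x] close to [1] it is solved by successive
    approximation, [sigma^n - 1] being surjective on [Knr] ([frob_sub_surj],
    [lang_close1]). Hence [x] may be supposed fixed by some [sigma^n]. Its norm for
    the group generated by [sigma] is then an element of [L] whose norm to [K] is a
    unit; by compactness of the lattices of [L] ([cluster_point]) some power of it is
    close to [1] ([unit_power_close]), and Hilbert 90 applies once this power has
    been written as [sigma^r(delta)/delta] for a suitable [r].

    The surjectivity of [sigma^n - 1] and Hilbert 90 both need elements of [Knr] with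
    prescribed period under [sigma]. They are roots of lifts of irreducible
    polynomials over the residue field: such a root generates over [K] an extension
    on which the Gauss norm is a valuation, so an unramified one
    ([gauss_extension], [exists_zeta]). *)

Set Implicit Arguments.
Unset Strict Implicit.
Unset Printing Implicit Defensive.

Import Order.TTheory GRing.Theory Num.Theory.

Local Open Scope ring_scope.

(** * Valuations *)

Section Valuation.

Variables (F : fieldType) (v : F -> int).
Hypothesis hv : normalized_valuation v.

Lemma val_ge0 n : val_ge v n 0. Proof. by left. Qed.

Lemma val_geE n x : x != 0 -> val_ge v n x <-> n <= v x.
Proof. by move=> x0; split=> [[x1|//]|]; [rewrite x1 eqxx in x0 | right]. Qed.

Lemma val_ge_le m n x : m <= n -> val_ge v n x -> val_ge v m x.
Proof. by move=> mn [->|h]; [left | right; apply: le_trans h]. Qed.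

Lemma valM_ x y : x != 0 -> y != 0 -> v (x * y) = v x + v y.
Proof. exact: (Defs.valM hv). Qed.

Lemma val1 : v 1 = 0.
Proof.
have : v (1 * 1) = v 1 + v 1 by rewrite valM_ ?oner_neq0.
by rewrite mulr1; lia.
Qed.

Lemma valV x : x != 0 -> v x^-1 = - v x.
Proof.
move=> x0; have := valM_ x0 (_ : x^-1 != 0); rewrite invr_eq0 divff // val1.
by move=> /(_ x0); lia.
Qed.

Lemma valX x n : x != 0 -> v (x ^+ n) = v x * n%:Z.
Proof.
move=> x0; elim: n => [|n IH]; first by rewrite expr0 val1; lia.
by rewrite exprS valM_ ?expf_neq0 // IH; lia.
Qed.

Lemma valXz x (n : int) : x != 0 -> v (x ^ n) = v x * n.
Proof.
move=> x0; case: n => n; first by rewrite -valX.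
by rewrite [x ^ _]/= valV ?expf_neq0 // valX //; lia.
Qed.

Lemma valN x : v (- x) = v x.
Proof.
have vN1 : v (-1) = 0.
  have := valM_ (_ : -1 != 0 :> F) (_ : -1 != 0 :> F).
  by rewrite oppr_eq0 oner_eq0 mulrNN mulr1 val1; lia.
have [->|x0] := eqVneq x 0; first by rewrite oppr0.
by rewrite -mulN1r valM_ // ?oppr_eq0 ?oner_eq0 // vN1 add0r.
Qed.

Lemma val_geD n x y : val_ge v n x -> val_ge v n y -> val_ge v n (x + y).
Proof. exact: (Defs.valD hv). Qed.

Lemma val_geN n x : val_ge v n x -> val_ge v n (- x).
Proof. by case=> [->|h]; [left; rewrite oppr0 | right; rewrite valN]. Qed.

Lemma val_geB n x y : val_ge v n x -> val_ge v n y -> val_ge v n (x - y).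
Proof. by move=> hx /val_geN; apply: val_geD. Qed.

Lemma val_ge_trans n x y z :
  val_ge v n (x - y) -> val_ge v n (y - z) -> val_ge v n (x - z).
Proof. by move=> h1 h2; rewrite -(subrK y x) -addrA; apply: val_geD. Qed.

Lemma val_geM m n x y : val_ge v m x -> val_ge v n y -> val_ge v (m + n) (x * y).
Proof.
case=> [->|hx]; first by left; rewrite mul0r.
case=> [->|hy]; first by left; rewrite mulr0.
have [->|x0] := eqVneq x 0; first by left; rewrite mul0r.
have [->|y0] := eqVneq y 0; first by left; rewrite mulr0.
by right; rewrite valM_ //; apply: lerD.
Qed.

Lemma val_geMl n x y : val_ge v 0 x -> val_ge v n y -> val_ge v n (x * y).
Proof. by move=> hx hy; rewrite -[n]add0r; apply: val_geM. Qed.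

Lemma val_geMr n x y : val_ge v n x -> val_ge v 0 y -> val_ge v n (x * y).
Proof. by move=> hx hy; rewrite mulrC; apply: val_geMl. Qed.

Lemma val_ge1 : val_ge v 0 1.
Proof. by right; rewrite val1. Qed.

Lemma val_geX x n : val_ge v 0 x -> val_ge v 0 (x ^+ n).
Proof.
by move=> hx; elim: n => [|n IH]; rewrite ?expr0 ?exprS;
  [apply: val_ge1 | apply: val_geMl].
Qed.

Lemma val_ge_sum n I (r : seq I) (P : pred I) (f : I -> F) :
  (forall i, P i -> val_ge v n (f i)) -> val_ge v n (\sum_(i <- r | P i) f i).
Proof.
move=> h; elim/big_ind: _ => //; first exact: val_ge0.
exact: val_geD.
Qed.

Lemma val_ge_prod I (r : seq I) (P : pred I) (f : I -> F) :
  (forall i, P i -> val_ge v 0 (f i)) -> val_ge v 0 (\prod_(i <- r | P i) f i).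
Proof.
move=> h; elim/big_ind: _ => //; first exact: val_ge1.
by move=> x y; apply: val_geMl.
Qed.

Lemma val_ge_natr n : val_ge v 0 n%:R.
Proof.
elim: n => [|n IH]; first exact: val_ge0.
by rewrite -addn1 natrD; apply: val_geD => //; apply: val_ge1.
Qed.

Lemma val_ge_forall_eq0 x : (forall n : nat, val_ge v n%:Z x) -> x = 0.
Proof.
move=> h; apply: contrapT => /eqP x0.
by have := h `|v x|.+1%N; rewrite val_geE //; lia.
Qed.

(** The ultrametric inequality is an equality as soon as one of the two terms
    dominates. *)
Lemma val_eq_close x y n : x != 0 -> v x < n -> val_ge v n (y - x) ->
  y != 0 /\ v y = v x.
Proof.
move=> x0 xn yx; have y0 : y != 0.
  apply/eqP => y0; move: yx; rewrite y0 sub0r => /val_geN; rewrite opprK.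
  by rewrite val_geE //; lia.
split=> //; apply/eqP; rewrite eq_le; apply/andP; split.
  case: (lerP (v y) (v x)) => // xy.
  have : val_ge v (v x + 1) (y - (y - x)).
    apply: val_geB; first by apply/val_geE => //; lia.
    by apply: val_ge_le yx; lia.
  by rewrite subKr val_geE //; lia.
have : val_ge v (v x) ((y - x) + x).
  apply: val_geD; last by right.
  by apply: val_ge_le yx; lia.
by rewrite subrK val_geE.
Qed.

Lemma val_unitP x : val_ge v 0 x -> ~ val_ge v 1 x -> x != 0 /\ v x = 0.
Proof.
move=> h0 h1; have x0 : x != 0 by apply/eqP => x0; apply: h1; left.
split=> //; move: h0; rewrite val_geE // => h0.
by move: h1; rewrite val_geE //; lia.
Qed.

Lemma val_geV x : x != 0 -> v x = 0 -> val_ge v 0 x^-1.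
Proof. by move=> x0 h; right; rewrite valV // h oppr0. Qed.

Lemma val_geZ p n m x : p != 0 -> v p = 1 ->
  val_ge v (n + m) (p ^ m * x) <-> val_ge v n x.
Proof.
move=> p0 vp; have pm0 k : p ^ k != 0 by rewrite expfz_neq0.
have vpm k : v (p ^ k) = k by rewrite valXz // vp mul1r.
split=> h; last first.
  by rewrite addrC; apply: val_geM => //; right; rewrite vpm.
have -> : x = p ^ (- m) * (p ^ m * x) by rewrite mulrA -expfzDr // addNr mul1r.
rewrite (_ : n = - m + (n + m)); last by lia.
by apply: val_geM => //; right; rewrite vpm.
Qed.

Lemma val_prodE I (r : seq I) (f : I -> F) : (forall i, f i != 0) ->
  \prod_(i <- r) f i != 0 /\ v (\prod_(i <- r) f i) = \sum_(i <- r) v (f i).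
Proof.
move=> h; elim: r => [|i r [n0 IH]].
  by rewrite !big_nil oner_neq0 val1.
by rewrite !big_cons mulf_neq0 // valM_ // IH.
Qed.

Lemma val_ge_subX k n x y : val_ge v 0 x -> val_ge v 0 y ->
  val_ge v k (x - y) -> val_ge v k (x ^+ n - y ^+ n).
Proof.
move=> hx hy h; rewrite subrXX; apply: val_geMr => //.
by apply: val_ge_sum => i _; apply: val_geMl; apply: val_geX.
Qed.

(** The quotient of [x^n - y^n] by [x - y] is congruent to [n x^(n-1)] modulo the
    maximal ideal. *)
Lemma val_ge_subX_small k n x y : 1 <= k -> val_ge v 0 x -> val_ge v 0 y ->
  val_ge v 1 (n%:R : F) -> val_ge v k (x - y) ->
  val_ge v (k + 1) (x ^+ n - y ^+ n).
Proof.
move=> k1 hx hy hn h; rewrite subrXX; apply: val_geM => //.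
pose s := \sum_(i < n) (x ^+ (n.-1 - i) * y ^+ i - x ^+ (n.-1 - i) * x ^+ i).
rewrite (_ : \sum_(i < n) _ = s + n%:R * x ^+ n.-1); last first.
  rewrite mulr_natl -[X in _ *+ X]card_ord -sumr_const -big_split /=.
  apply: eq_bigr => i _; rewrite -!exprD subnK ?subrK //.
  by have := ltn_ord i; lia.
apply: val_geD; last by apply: val_geMr => //; apply: val_geX.
apply: val_ge_sum => i _; rewrite -mulrBr; apply: val_geMl; first exact: val_geX.
apply: (val_ge_le k1); apply: val_ge_subX => //.
by rewrite -opprB; apply: val_geN.
Qed.

(** The error bound at stage [n] is that of the first omitted term, which lets
    the sum of a series inherit equations satisfied by its partial sums. *)
Lemma series_cvg (d : nat -> F) (b : int) : val_complete v ->
  (forall i, val_ge v (b + i%:Z) (d i)) ->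
  exists2 l, val_cvg v (fun n => \sum_(i < n) d i) l
           & forall n, val_ge v (b + n%:Z) (l - \sum_(i < n) d i).
Proof.
move=> cv hd.
have tail m n : (m <= n)%N ->
    val_ge v (b + m%:Z) (\sum_(i < n) d i - \sum_(i < m) d i).
  move=> mn; rewrite -!(big_mkord xpredT) (big_cat_nat _ mn) //= addrAC subrr add0r.
  rewrite big_nat; apply: val_ge_sum => i /andP[mi _].
  by apply: val_ge_le (hd i); lia.
have tail' k i j : (k <= i)%N -> (k <= j)%N ->
    val_ge v (b + k%:Z) (\sum_(i < i) d i - \sum_(i < j) d i).
  move=> ki kj; apply: (@val_ge_trans _ _ (\sum_(i < k) d i)); first exact: tail.
  by rewrite -opprB; apply: val_geN; apply: tail.
have [l hl] : exists l, val_cvg v (fun n => \sum_(i < n) d i) l.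
  apply: cv => n; exists `|n - b|%N => i j hi hj.
  by apply: (@val_ge_le _ (b + `|n - b|%N%:Z)); [lia | apply: tail'].
exists l => // n; rewrite -opprB; apply: val_geN.
have [N h] := hl (b + n%:Z).
apply: (@val_ge_trans _ _ (\sum_(i < maxn n N) d i)).
  by apply: tail' => //; rewrite leq_maxl.
by apply: h; rewrite leq_maxr.
Qed.

End Valuation.

(** * Valuation rings and residue fields *)

Section ValuationRing.

Variables (F : fieldType) (v : F -> int).

Definition vint (hv : normalized_valuation v) : {pred F} :=
  fun x => `[< val_ge v 0 x >].

Hypothesis hv : normalized_valuation v.

Lemma vintP x : reflect (val_ge v 0 x) (x \in vint hv).
Proof. exact: asboolP. Qed.

Fact vint_subring : subring_closed (vint hv).
Proof.
split=> [|x y /vintP hx /vintP hy|x y /vintP hx /vintP hy]; apply/vintP.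
- exact: val_ge1.
- exact: val_geB.
- exact: val_geMl.
Qed.

HB.instance Definition _ := GRing.isSubringClosed.Build F (vint hv) vint_subring.

Record valring := ValRing { vr_val : F; vr_valP : vr_val \in vint hv }.

HB.instance Definition _ := [isSub for vr_val].
HB.instance Definition _ := [Choice of valring by <:].
HB.instance Definition _ := [SubChoice_isSubComNzRing of valring by <:].

Lemma vr_val_ge (x : valring) : val_ge v 0 (val x).
Proof. exact/vintP/(valP x). Qed.

Definition mkvr x (hx : val_ge v 0 x) : valring := ValRing (introT (vintP x) hx).

Section Residue.

Variables (q : nat) (r : 'I_q -> F).
Hypothesis hr0 : forall i, val_ge v 0 (r i).
Hypothesis hr1 : forall x, val_ge v 0 x -> exists! i, val_ge v 1 (x - r i).

Let lft (i : 'I_q) : valring := mkvr (hr0 i).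

Let res_ex (x : valring) : exists i, val_ge v 1 (val x - r i).
Proof. by have [i [hi _]] := hr1 (vr_val_ge x); exists i. Qed.

Let res (x : valring) : 'I_q := sval (cid (res_ex x)).

Let resP x : val_ge v 1 (val x - r (res x)).
Proof. exact: (svalP (cid (res_ex x))). Qed.

Let res_eq x y : val_ge v 1 (val x - val y) <-> res x = res y.
Proof.
split=> [h|e]; last first.
  apply: (val_ge_trans hv (resP x)); rewrite e -opprB; apply: val_geN => //.
have [i [_ hi]] := hr1 (vr_val_ge x).
rewrite -(hi _ (resP x)); apply: hi; apply: (val_ge_trans hv h); exact: resP.
Qed.

Let lftK i : res (lft i) = i.
Proof.
have [j [_ hj]] := hr1 (hr0 i).
rewrite -(hj _ (resP (lft i))); apply: hj; rewrite subrr; exact: val_ge0.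
Qed.

Let T : Type := 'I_q.
HB.instance Definition _ := Finite.on T.

Let add (a b : T) : T := res (lft a + lft b).
Let mul (a b : T) : T := res (lft a * lft b).

Let resD x y : res (x + y) = add (res x) (res y).
Proof.
apply/res_eq; rewrite !raddfD /= addrACA; apply: val_geD => //.
Qed.

Let resM x y : res (x * y) = mul (res x) (res y).
Proof.
apply/res_eq; rewrite !rmorphM /=.
apply: (@val_ge_trans _ _ hv _ _ (val x * val (lft (res y)))).
  rewrite -mulrBr; apply: val_geMl => //; exact: vr_val_ge.
rewrite -mulrBl; apply: val_geMr => //; exact: vr_val_ge.
Qed.

Let addA : associative add.
Proof. by move=> a b c; rewrite -(lftK a) -(lftK b) -(lftK c) -!resD addrA. Qed.
Let addC : commutative add.
Proof. by move=> a b; rewrite -(lftK a) -(lftK b) -!resD addrC. Qed.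
Let add0 : left_id (res 0) add.
Proof. by move=> a; rewrite -(lftK a) -!resD add0r. Qed.
Let addN : left_inverse (res 0) (fun a => res (- lft a)) add.
Proof. by move=> a; rewrite -{2}(lftK a) -!resD addNr. Qed.

HB.instance Definition _ := GRing.isZmodule.Build T addA addC add0 addN.

Let mulA : associative mul.
Proof. by move=> a b c; rewrite -(lftK a) -(lftK b) -(lftK c) -!resM mulrA. Qed.
Let mulC : commutative mul.
Proof. by move=> a b; rewrite -(lftK a) -(lftK b) -!resM mulrC. Qed.
Let mul1 : left_id (res 1) mul.
Proof. by move=> a; rewrite -(lftK a) -!resM mul1r. Qed.
Let mulD : left_distributive mul add.
Proof.
by move=> a b c; rewrite -(lftK a) -(lftK b) -(lftK c) -!(resM, resD) mulrDl.
Qed.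
Let one_neq0 : res 1 != res 0.
Proof.
by apply/eqP => /res_eq /=; rewrite subr0 val_geE ?oner_neq0 // val1.
Qed.

HB.instance Definition _ :=
  GRing.Zmodule_isComNzRing.Build T mulA mulC mul1 mulD one_neq0.

Let inv_ex (a : T) : exists b : T, if a == 0 then b = 0 else b * a = 1.
Proof.
case: (eqVneq a 0) => [_|a0]; first by exists 0.
have /val_unitP[|x0 vx] : ~ val_ge v 1 (val (lft a)) => //.
    move=> h; case/eqP: a0; rewrite -(lftK a); apply/res_eq.
    by rewrite [X in _ - X]raddf0 subr0.
  exact: vr_val_ge.
exists (res (mkvr (val_geV hv x0 vx))).
transitivity (res (mkvr (val_geV hv x0 vx) * lft a)).
  by rewrite resM lftK.
by congr res; apply: val_inj; rewrite rmorphM /= mulVf.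
Qed.

Let inv (a : T) : T := sval (cid (inv_ex a)).

Let mulV a : a != 0 -> inv a * a = 1.
Proof. by rewrite /inv; case: (cid _) => b /=; case: eqP. Qed.

Let inv0 : inv 0 = 0.
Proof. by rewrite /inv; case: (cid _) => b /=; rewrite eqxx. Qed.

HB.instance Definition _ := GRing.ComNzRing_isField.Build T mulV inv0.

Let red (x : valring) : T := res x.

Let red_add : {morph red : x y / x + y}. Proof. exact: resD. Qed.
Let red_zmod : zmod_morphism red.
Proof.
have redN x : red (- x) = - red x.
  by apply/eqP; rewrite -addr_eq0 -red_add addNr.
by move=> x y; rewrite red_add redN.
Qed.
Let red_mul : monoid_morphism red. Proof. by split=> // x y; apply: resM. Qed.

HB.instance Definition _ := GRing.isZmodMorphism.Build valring T red red_zmod.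
HB.instance Definition _ := GRing.isMonoidMorphism.Build valring T red red_mul.

Let red_q : q%:R = 0 :> T.
Proof.
pose f (i : T) := i + 1.
have fI : injective f by apply: addIr.
have := eqxx (\sum_(i : T) i).
rewrite {1}(reindex_inj fI) /= /f big_split /= sumr_const card_ord.
by rewrite -subr_eq0 addrAC subrr add0r => /eqP.
Qed.

Lemma residue_field_ex : exists (k : fieldType) (red : {rmorphism valring -> k}),
  [/\ forall a, exists x, red x = a,
      forall x, red x = 0 <-> val_ge v 1 (val x)
    & q%:R = 0 :> k].
Proof.
exists T, red; split; [|move=> x|exact: red_q].
  by move=> a; exists (lft a); apply: lftK.
change (res x = res 0 <-> val_ge v 1 (val x)).
by rewrite -res_eq [X in _ - X]raddf0 subr0.
Qed.

End Residue.

(** The residue field is carried by ['I_q], a class being represented by the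
    index of its representative. Translation by [1] permutes its elements without
    changing their sum, hence [q = 0] in it. *)
Lemma residue_field q : residue_card v q ->
  exists (k : fieldType) (red : {rmorphism valring -> k}),
  [/\ forall a, exists x, red x = a,
      forall x, red x = 0 <-> val_ge v 1 (val x)
    & q%:R = 0 :> k].
Proof. by case=> r [h0 h1]; apply: residue_field_ex h0 h1. Qed.

End ValuationRing.

(** * Unramified extensions with a prescribed residual polynomial *)

Section GaussExtension.

Variables (K : fieldType) (v : K -> int).
Hypothesis hv : normalized_valuation v.
Variables (k : fieldType) (red : {rmorphism valring hv -> k}).
Hypothesis red0P : forall x, red x = 0 <-> val_ge v 1 (val x).
Variable p : K.
Hypotheses (p0 : p != 0) (vp : v p = 1).

Local Notation O := (valring hv).
Local Notation "U '^v'" := (map_poly (val : O -> K) U) (at level 2).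
Local Notation "U '^r'" := (map_poly red U) (at level 2).

Let pz n : p ^ n != 0. Proof. by rewrite expfz_neq0. Qed.
Let vpz n : v (p ^ n) = n. Proof. by rewrite valXz // vp mul1r. Qed.

Lemma size_mapv (U : {poly O}) : size U^v = size U.
Proof. by rewrite size_map_inj_poly ?rmorph0 //; apply: val_inj. Qed.

(** Dividing a polynomial by a coefficient of least valuation makes it
    integral with nonzero reduction; this is the Gauss norm. *)
Lemma primitive_part (A : {poly K}) : A != 0 ->
  exists (m : int) (U : {poly O}), A = p ^ m *: U^v /\ U^r != 0.
Proof.
move=> A0; have sA : (0 < size A)%N by rewrite size_poly_gt0.
pose i0 : 'I_(size A) := Ordinal (ltac:(by rewrite ltn_predL) : ((size A).-1 < size A)%N).
have Ai0 : A`_i0 != 0 by rewrite -lead_coefE lead_coef_eq0.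
case: (@Order.TotalTheory.arg_minP _ int _ i0 (fun i => A`_i != 0) (fun i => v A`_i) Ai0).
move=> i1 Ai1 hmin; pose m := v A`_i1.
have hc i : val_ge v 0 (p ^ (- m) * A`_i).
  rewrite -[0](addrN m); apply/val_geZ => //.
  have [->|Ai] := eqVneq A`_i 0; first exact: val_ge0.
  apply/val_geE => //; have [h|h] := ltnP i (size A); first exact: (hmin (Ordinal h)).
  by rewrite nth_default ?eqxx in Ai.
pose U := \poly_(i < size A) mkvr hv (hc i).
exists m, U; split.
  apply/polyP => i; rewrite coefZ coef_map coef_poly; case: ltnP => h /=.
    by rewrite mulrA -expfzDr // addrN mul1r.
  by rewrite mulr0 nth_default.
apply/eqP => /polyP /(_ i1); rewrite coef0 coef_map coef_poly ltn_ord /=.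
move=> /red0P /=; rewrite val_geE ?mulf_neq0 // (valM_ hv) // vpz.
by rewrite addNr.
Qed.

Lemma red_scale (m : int) (U U' : {poly O}) : 0 < m -> U^v = p ^ m *: U'^v -> U^r = 0.
Proof.
move=> m0 e; apply/polyP => i; rewrite coef0 coef_map; apply/red0P.
have -> : val U`_i = p ^ m * val U'`_i.
  by have /polyP /(_ i) := e; rewrite coefZ !coef_map.
apply: val_geMr; [exact: hv| |exact: vr_val_ge].
by right; rewrite vpz; lia.
Qed.

Lemma primitive_unique m m' (U U' : {poly O}) :
  U^r != 0 -> U'^r != 0 -> p ^ m *: U^v = p ^ m' *: U'^v -> m = m'.
Proof.
wlog lt : m m' U U' / m < m'.
  move=> h hU hU' e; have [l|l|//] := ltgtP m m'; first exact: h e.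
  by symmetry; apply: h hU' hU (esym e).
move=> hU _ e; case/eqP: hU; apply: (@red_scale (m' - m) U U'); first by lia.
by rewrite addrC expfzDr // -scalerA -e scalerA -expfzDr // addNr scale1r.
Qed.

Lemma primitive_ge0 m (U U' : {poly O}) : U^r != 0 -> p ^ m *: U^v = U'^v -> 0 <= m.
Proof.
move=> hU e; case: (lerP 0 m) => // m0; case/eqP: hU.
apply: (@red_scale (- m) U U'); first by lia.
by rewrite -e scalerA -expfzDr // addNr scale1r.
Qed.

Lemma size_red (U : {poly O}) : (size U^r <= size U)%N.
Proof. exact: size_poly. Qed.

Variable P : {poly O}.
Hypotheses (Pmon : P \is monic) (Pirr : irreducible_poly P^r).

Lemma size_redP : size P^r = size P.
Proof.
by rewrite size_map_poly_id0 // (monicP Pmon) rmorph1 oner_neq0.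
Qed.

(** Gauss' lemma: a factorization over [K] can be normalized to one over the
    valuation ring, which reduces to a factorization of the same degrees. *)
Lemma lift_irreducible : irreducible_poly P^v.
Proof.
have P0 : P^v != 0 by rewrite monic_neq0 ?monic_map.
split=> [|A sA /dvdpP[B eB]].
  by rewrite size_mapv -size_redP; case: Pirr.
have A0 : A != 0 by apply: contraNneq P0 => A0; rewrite eB A0 mulr0.
have B0 : B != 0 by apply: contraNneq P0 => B0; rewrite eB B0 mul0r.
have [m [U [eU hU]]] := primitive_part A0.
have [n [V [eV hV]]] := primitive_part B0.
have eP : p ^ 0 *: P^v = p ^ (n + m) *: (V * U)^v.
  by rewrite expr0z scale1r eB eU eV -scalerAl -scalerAr scalerA -expfzDr // rmorphM.
have hVU : (V * U)^r != 0 by rewrite rmorphM mulf_neq0.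
have nm : 0 = n + m.
  apply: (primitive_unique _ hVU eP); rewrite -size_poly_eq0 size_redP.
  by rewrite -size_mapv size_poly_eq0.
have {eP} eP : P = V * U.
  apply: (map_inj_poly (f := (val : O -> K))); [exact: val_inj|by rewrite rmorph0|].
  by move: eP; rewrite -nm expr0z !scale1r.
have ePr : P^r = V^r * U^r by rewrite eP rmorphM.
have szA : size A = size U by rewrite eU size_scale // size_mapv.
have szB : size B = size V by rewrite eV size_scale // size_mapv.
have sz1 : size P = (size B + size A).-1 by rewrite -size_mapv eB size_mul.
have sz2 : size P = (size V^r + size U^r).-1 by rewrite -size_redP ePr size_mul.
have A1 : (0 < size A)%N by rewrite size_poly_gt0.
have B1 : (0 < size B)%N by rewrite size_poly_gt0.
have eU' : size U^r = size A.
  by have := size_red U; have := size_red V; rewrite -szA -szB; lia.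
rewrite -dvdp_size_eqp; last by rewrite eB dvdp_mull.
rewrite size_mapv -size_redP -eU' dvdp_size_eqp; last by rewrite ePr dvdp_mull.
by apply: Pirr.2; rewrite ?eU' // ePr dvdp_mull.
Qed.

Section Root.

Variables (M : fieldExtType K) (z : M).
Hypothesis Pz : root (map_poly (in_alg M) P^v) z.
Hypothesis zgen : <<1; z>>%VS = fullv.

Let evK (A : {poly K}) : M := (map_poly (in_alg M) A).[z].
Let ev (U : {poly O}) : M := evK U^v.

Let evKZ c A : evK (c *: A) = c%:A * evK A.
Proof. by rewrite /evK linearZ hornerZ. Qed.

Let evKD A B : evK (A + B) = evK A + evK B.
Proof. by rewrite /evK rmorphD hornerD. Qed.

Let evKM A B : evK (A * B) = evK A * evK B.
Proof. by rewrite /evK rmorphM hornerM. Qed.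

Let evK0 (A : {poly K}) : (size A < size P)%N -> evK A = 0 -> A = 0.
Proof.
move=> sA eA; apply: contrapT => /eqP A0.
have : coprimep P^v A.
  rewrite irreducible_poly_coprime; last exact: lift_irreducible.
  by apply/negP => /(dvdp_leq A0); rewrite size_mapv leqNgt sA.
case/Bezout_eq1_coprimepP => -[a b] /= e.
have : evK (a * P^v + b * A) = 1 by rewrite e /evK rmorph1 hornerC.
rewrite evKD !evKM eA mulr0 addr0 [evK P^v](rootP Pz) mulr0.
by move/eqP; rewrite eq_sym oner_eq0.
Qed.

Let evK_surj x : exists2 A : {poly K}, (size A < size P)%N & x = evK A.
Proof.
have P0 : P^v != 0 by rewrite monic_neq0 ?monic_map.
have : x \in <<1; z>>%VS by rewrite zgen memvf.
case/Fadjoin_polyP => B /polyOver1P [A ->] ->.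
exists (A %% P^v); first by rewrite -size_mapv ltn_modp.
rewrite -[in LHS]/(evK A) {1}(divp_eq A P^v) evKD evKM.
by rewrite [evK P^v](rootP Pz) mulr0 add0r.
Qed.

Let evK_inj (A B : {poly K}) : (size A < size P)%N -> (size B < size P)%N -> evK A = evK B -> A = B.
Proof.
move=> sA sB e; apply/eqP; rewrite -subr_eq0; apply/eqP; apply: evK0.
  apply: leq_ltn_trans (size_polyD _ _) _.
  by rewrite size_polyN gtn_max sA.
by rewrite -scaleN1r evKD evKZ e scaleN1r mulN1r addrN.
Qed.

Let rep x n (U : {poly O}) :=
  [/\ (size U < size P)%N, U^r != 0 & x = (p ^ n)%:A * ev U].

Let rep_ex x : x != 0 -> exists n U, rep x n U.
Proof.
move=> x0; have [A sA eA] := evK_surj x.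
have A0 : A != 0.
  by apply: contraNneq x0 => A0; rewrite eA A0 /evK rmorph0 horner0.
have [m [U [eU hU]]] := primitive_part A0.
exists m, U; split=> //; last by rewrite eA eU evKZ.
by move: sA; rewrite eU size_scale // size_mapv.
Qed.

Let w x : int := xget 0 [set n | exists U, rep x n U]%classic.

Let rep_inj x n n' U U' : rep x n U -> rep x n' U' -> n = n'.
Proof.
case=> sU hU eU [sU' hU' eU']; apply: (primitive_unique hU hU').
by apply: evK_inj; rewrite ?size_scale ?size_mapv // !evKZ -eU.
Qed.

Let wP x n U : rep x n U -> w x = n.
Proof.
move=> h; rewrite /w; case: xgetP => [m _ [U' h']|/(_ n)[]]; last by exists U.
exact: rep_inj h' h.
Qed.

Let w_ge x n : val_ge w n x <->
  exists2 U : {poly O}, (size U < size P)%N & x = (p ^ n)%:A * ev U.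
Proof.
have Pgt0 : (0 < size P)%N.
  by rewrite size_poly_gt0 monic_neq0.
have [->|x0] := eqVneq x 0.
  split=> _; last by left.
  by exists 0; rewrite ?size_poly0 // /ev /evK !rmorph0 horner0 mulr0.
have [m [V hV]] := rep_ex x0; have wx := wP hV; case: (hV) => sV rV eV.
rewrite val_geE // wx; split=> [nm|[U sU eU]].
  have hp : val_ge v 0 (p ^ (m - n)) by right; rewrite vpz; lia.
  exists (mkvr hv hp *: V); first exact: leq_ltn_trans (size_scale_leq _ _) sV.
  rewrite eV (_ : ev (_ *: V) = (p ^ (m - n))%:A * ev V).
    by rewrite mulrA -!in_algE -rmorphM -expfzDr // addrC subrK.
  by rewrite /ev -evKZ map_polyZ.
have U0 : U^v != 0.
  by apply: contraNneq x0 => U0; rewrite eU /ev U0 /evK rmorph0 horner0 mulr0.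
have [l [V' [eV' hV']]] := primitive_part U0.
have h' : rep x (n + l) V'.
  split=> //; first by move: sU; rewrite -size_mapv eV' size_scale // size_mapv.
  by rewrite eU /ev eV' evKZ mulrA -!in_algE -rmorphM -expfzDr.
have l0 : 0 <= l by apply: (@primitive_ge0 l V' U).
by rewrite -wx (wP h'); lia.
Qed.

Let w_mul x y : x != 0 -> y != 0 -> w (x * y) = w x + w y.
Proof.
move=> x0 y0; have [m [U hU]] := rep_ex x0; have [n [V hV]] := rep_ex y0.
rewrite (wP hU) (wP hV); case: hU hV => sU rU eU [sV rV eV].
have [Q [R [eQR sR]]] : exists Q R, U * V = Q * P + R /\ (size R < size P)%N.
  exists (Pdiv.Ring.rdivp (U * V) P), (Pdiv.Ring.rmodp (U * V) P).
  split; first exact: Pdiv.RingMonic.rdivp_eq.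
  by apply: Pdiv.Ring.ltn_rmodpN0; apply: monic_neq0.
apply: (@wP _ _ R); split=> //.
  apply/negP => /eqP R0.
  have e : U^r * V^r = Q^r * P^r.
    by have := congr1 (map_poly red) eQR; rewrite rmorphD !rmorphM /= R0 addr0.
  have : P^r %| U^r * V^r by rewrite e dvdp_mull.
  have cop (W : {poly O}) : (size W < size P)%N -> W^r != 0 -> coprimep P^r W^r.
    move=> sW W0; rewrite irreducible_poly_coprime //.
    apply/negP => /(dvdp_leq W0); rewrite size_redP => h.
    by have := leq_trans h (size_red W); rewrite leqNgt sW.
  rewrite Gauss_dvdpr ?cop // => /(dvdp_leq rV); rewrite size_redP => h.
  by have := leq_trans h (size_red V); rewrite leqNgt sV.
rewrite eU eV mulrACA -!in_algE -rmorphM -expfzDr //; congr (_ * _).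
rewrite /ev -evKM -rmorphM eQR rmorphD evKD rmorphM evKM.
by rewrite [evK P^v](rootP Pz) mulr0 add0r.
Qed.

Let Pgt1 : (1 < size P)%N.
Proof. by rewrite -size_redP; case: Pirr. Qed.

Let w_ext : val_extends (fun c : K => c%:A : M) v w.
Proof.
move=> c c0; have hu : val_ge v 0 (p ^ (- v c) * c).
  by right; rewrite (valM_ hv) // vpz addNr.
apply: (@wP _ _ (mkvr hv hu)%:P); split.
- by apply: leq_ltn_trans Pgt1; apply: size_polyC_leq1.
- rewrite map_polyC polyC_eq0; apply/eqP => /red0P /=.
  by rewrite val_geE ?mulf_neq0 // (valM_ hv) // vpz addNr.
rewrite /ev /evK !map_polyC hornerC /= -!in_algE -rmorphM mulrA.
by rewrite -expfzDr // addrN mul1r.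
Qed.

(** The Gauss norm of the representative of degree less than that of [P] is
    multiplicative: since the reduction of [P] is irreducible, it does not divide
    the product of two nonzero reductions of smaller degree, so the remainder of
    a product of primitive polynomials is primitive. *)
Lemma gauss_extension : exists w : M -> int, unramified v w.
Proof.
exists w; split; last exact: w_ext; split.
- exact: w_mul.
- move=> x y n /w_ge [U sU ->] /w_ge [V sV ->]; apply/w_ge.
  exists (U + V); last by rewrite /ev rmorphD evKD mulrDr.
  by apply: leq_ltn_trans (size_polyD _ _) _; rewrite gtn_max sU.
- exists p%:A; last by rewrite w_ext.
  by rewrite -in_algE fmorph_eq0.
Qed.

End Root.

Lemma unramified_root : exists (M : fieldExtType K) (w : M -> int) (z : M),
  unramified v w /\ root (map_poly (in_alg M) P^v) z.
Proof.
have [M _ [z Pz zg]] := irredp_FAdjoin lift_irreducible.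
by have [w hw] := gauss_extension Pz zg; exists M, w, z.
Qed.

End GaussExtension.

(** * Generators of the residual extensions *)

Lemma irreducible_factor (k : fieldType) (A : {poly k}) : (1 < size A)%N ->
  exists2 P, irreducible_poly P /\ P \is monic & P %| A.
Proof.
move=> sA; pose good n := `[< exists P : {poly k}, [/\ size P = n.+2 & P %| A] >].
have exg : exists n, good n.
  by exists (size A).-2; apply/asboolP; exists A; split=> //; lia.
have [n /asboolP[P [sP PA]] hmin] := ex_minnP exg.
have P0 : P != 0 by rewrite -size_poly_gt0 sP.
have l0 : lead_coef P != 0 by rewrite lead_coef_eq0.
have l0' : (lead_coef P)^-1 != 0 by rewrite invr_eq0.
exists ((lead_coef P)^-1 *: P); last by rewrite dvdpZl.
split; last by rewrite monicE lead_coefZ mulVf.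
split=> [|B sB]; first by rewrite size_scale // sP.
rewrite dvdpZr // => BP; rewrite -dvdp_size_eqp ?dvdpZr // size_scale //.
have B0 : B != 0 by apply: contraTneq BP => ->; rewrite dvd0p.
have h2 : (0 < size B)%N by rewrite size_poly_gt0.
have h1 := dvdp_leq P0 BP; rewrite sP in h1.
have sB2 : size B = (size B).-2.+2 by case: (size B) sB h2 => [|[|]].
have : good (size B).-2.
  by apply/asboolP; exists B; split; last exact: dvdp_trans PA.
by move/hmin => h; rewrite sP eqn_leq h1 sB2 !ltnS.
Qed.

Lemma size_XnsubX (R : nzRingType) n : (1 < n)%N -> size ('X^n - 'X : {poly R}) = n.+1.
Proof. by move=> n1; rewrite size_polyDl size_polyXn // size_polyN size_polyX. Qed.

(** The polynomial [X^(q^N) - X] is separable and of larger degree than the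
    product of the [X^(q^i) - X] for [0 < i < N]: some irreducible factor of it
    divides none of those. Its roots have exact period [N] under the [q]th
    power map. *)
Lemma frobenius_factor (k : fieldType) (q N : nat) :
  (1 < q)%N -> q%:R = 0 :> k -> (0 < N)%N ->
  exists P : {poly k}, [/\ irreducible_poly P, P \is monic, P %| 'X^(q ^ N) - 'X
    & forall i, (0 < i < N)%N -> coprimep P ('X^(q ^ i) - 'X)].
Proof.
move=> q1 q0; case: N => // n _.
pose G m : {poly k} := \prod_(j < m) ('X^(q ^ j.+1) - 'X).
have q1' j : (1 < q ^ j.+1)%N by rewrite -[1%N](exp1n j.+1) ltn_exp2r.
have sG m : (size (G m) <= q ^ m.+1)%N.
  elim: m => [|m IH]; first by rewrite /G big_ord0 size_poly1 expn1; lia.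
  rewrite /G big_ord_recr /=; apply: leq_trans (size_polyMleq _ _) _.
  rewrite size_XnsubX //; move: IH; rewrite /G => IH.
  rewrite addnS /=; apply: (@leq_trans (q ^ m.+1 + q ^ m.+1)); first by rewrite leq_add2r.
  by rewrite addnn -mul2n (expnS q m.+1) leq_mul2r q1 orbT.
pose D : {poly k} := 'X^(q ^ n.+1) - 'X.
have sD : size D = (q ^ n.+1).+1 by rewrite size_XnsubX.
have D0 : D != 0 by rewrite -size_poly_gt0 sD.
have Dsep : separable_poly D.
  rewrite separable_poly.unlock /D derivB derivXn derivX -mulr_natr natrX exprS.
  rewrite -[q%:R]polyC_natr q0 mul0r mulr0 sub0r.
  by apply/Bezout_eq1_coprimepP; exists (0, -1); rewrite mul0r add0r mulN1r opprK.
have [E eD] := dvdpP _ _ (dvdp_gcdl D (G n)).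
have g0 : gcdp D (G n) != 0 by rewrite gcdp_eq0 (negPf D0).
have G0 : G n != 0.
  by apply/prodf_neq0 => j _; rewrite -size_poly_gt0 size_XnsubX.
have E0 : E != 0 by apply: contraNneq D0 => E0; rewrite eD E0 mul0r.
have sE : (1 < size E)%N.
  have := size_mul E0 g0; rewrite -eD sD.
  have := dvdp_leq G0 (dvdp_gcdr D (G n)); have := sG n.
  move: (size E) (size (gcdp D (G n))) (size (G n)) (q ^ n.+1)%N => *; lia.
have [P [Pirr Pmon] PE] := irreducible_factor sE.
have PD : P %| D by rewrite eD dvdp_mulr.
exists P; split=> // i /andP[i0 iN].
rewrite irreducible_poly_coprime //; apply/negP => PX.
have hcop : coprimep E (gcdp D (G n)).
  by move: Dsep; rewrite {1}eD separable_mul => /and3P[].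
have PG : P %| G n.
  rewrite /G; have iN' : (i.-1 < n)%N by lia.
  rewrite (bigD1 (Ordinal iN')) //= prednK //; exact: dvdp_mulr.
have : coprimep P E.
  rewrite coprimep_sym; apply: coprimep_dvdl hcop; by rewrite dvdp_gcd PD.
by rewrite irreducible_poly_coprime // PE.
Qed.

Lemma integral_root (E : fieldType) (v : E -> int) (P : {poly E}) x :
  normalized_valuation v -> P \is monic -> (forall i, val_ge v 0 P`_i) ->
  root P x -> val_ge v 0 x.
Proof.
move=> hv Pmon hP rx; have [->|x0] := eqVneq x 0; first exact: val_ge0.
apply/val_geE => //; case: (lerP 0 (v x)) => // vx.
have : val_ge v (v x * (size P).-1%:Z + 1) (x ^+ (size P).-1).
  have := rootP rx; rewrite (horner_coef_wide _ (leqSpred _)) big_ord_recr /=.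
  rewrite -lead_coefE (monicP Pmon) mul1r addrC => /eqP.
  rewrite addr_eq0 => /eqP ->; apply: val_geN => //; apply: val_ge_sum => // i _.
  apply: val_geMl => //; right; rewrite valX //.
  by have := ltn_ord i; nia.
by rewrite val_geE ?expf_neq0 // valX //; lia.
Qed.

Section Zeta.

Variables (K : fieldType) (v : K -> int) (q : nat).
Hypothesis hK : local_field v q.
Let hv := local_valuation hK.

Lemma residue_card_gt1 : (1 < q)%N.
Proof.
have [r [h0 h1]] := local_residue hK.
have [i [hi _]] := h1 _ (val_ge0 v 0); have [j [hj _]] := h1 _ (val_ge1 hv).
case: q r h0 h1 i hi j hj => [|[|//]] r h0 h1 i hi j hj; first by case: i hi.
have eij : i = j by rewrite (ord1 i) (ord1 j).
have : val_ge v 1 (1 - 0 : K).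
  by apply: (val_ge_trans hv hj); rewrite -eij -opprB; apply: val_geN.
by rewrite subr0 val_geE ?oner_neq0 // val1.
Qed.

Lemma val_ge_q : val_ge v 1 (q%:R : K).
Proof.
have [k [red [_ red0 q0]]] := residue_field hv (local_residue hK).
have /red0 : red q%:R = 0 by rewrite rmorph_nat.
have -> // : val (q%:R : valring hv) = q%:R; exact: rmorph_nat.
Qed.

Variables (E : fieldType) (ve : E -> int) (iota : {rmorphism K -> E}).
Hypotheses (hve : normalized_valuation ve) (hext : val_extends iota v ve).

Lemma ext_val_ge n x : val_ge v n x -> val_ge ve n (iota x).
Proof.
have [->|x0] := eqVneq x 0; first by rewrite rmorph0 => _; left.
by rewrite val_geE // => h; right; rewrite hext.
Qed.

Hypothesis unr_embed : forall (M : fieldExtType K) (w : M -> int), unramified v w ->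
  exists f : {rmorphism M -> E}, embedding_over iota f.

(** The element is a root of a lift of the polynomial of [frobenius_factor]:
    divisibility and coprimality over the residue field of [K] become congruences
    for this root. *)
Lemma exists_zeta N : (0 < N)%N -> exists z : E,
  [/\ (exists (M : fieldExtType K) (w : M -> int) (f : {rmorphism M -> E}) y,
        [/\ unramified v w, embedding_over iota f & z = f y]),
      val_ge ve 0 z, val_ge ve 1 (z ^+ (q ^ N) - z)
    & forall i, (0 < i < N)%N -> ~ val_ge ve 1 (z ^+ (q ^ i) - z)].
Proof.
move=> N0; have [k [red [redS red0 q0]]] := residue_field hv (local_residue hK).
have [Pb [Pirr Pmon PD Pcop]] := frobenius_factor residue_card_gt1 q0 N0.
pose lft a := sval (cid (redS a)).
have lftK a : red (lft a) = a by rewrite /lft; case: (cid _).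
pose plift (A : {poly k}) : {poly valring hv} := \poly_(i < size A) lft A`_i.
have pliftK A : map_poly red (plift A) = A.
  apply/polyP => i; rewrite coef_map coef_poly; case: ltnP => h /=; first exact: lftK.
  by rewrite rmorph0 nth_default.
pose n := (size Pb).-1.
have sPb : size Pb = n.+1 by rewrite prednK // size_poly_gt0 monic_neq0.
pose Q := \poly_(i < n) lft Pb`_i.
pose P : {poly valring hv} := 'X^n + Q.
have sQ : (size Q < n.+1)%N by rewrite ltnS; exact: size_poly.
have PmonO : P \is monic.
  by rewrite monicE lead_coefDl ?size_polyXn // lead_coefXn.
have redP : map_poly red P = Pb.
  rewrite rmorphD /= map_polyXn; apply/polyP => i.
  rewrite coefD coefXn coef_map coef_poly.
  have [h|h|h] /= := ltngtP i n; first by rewrite add0r lftK.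
    by rewrite (raddf0 red) addr0 nth_default // sPb.
  by rewrite (raddf0 red) addr0 h -(monicP Pmon) lead_coefE.
have [p p0 vp] := val_unif hv.
rewrite -redP in Pirr.
have [M [w [z0 [hM rz0]]]] := unramified_root red0 p0 vp PmonO Pirr.
have [f hf] := unr_embed hM.
pose z := f z0.
pose jv := iota \o (val : valring hv -> K).
pose ev (U : {poly valring hv}) : E := (map_poly jv U).[z].
have evM U V : ev (U * V) = ev U * ev V by rewrite /ev rmorphM hornerM.
have evB U V : ev (U - V) = ev U - ev V by rewrite /ev rmorphB hornerD hornerN.
have jv_ge n' (a : valring hv) : val_ge v n' (val a) -> val_ge ve n' (jv a).
  exact: ext_val_ge.
have ez : root (map_poly jv P) z.
  apply/rootP; have /(congr1 f) := rootP rz0; rewrite rmorph0 -horner_map => <-.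
  rewrite -!map_poly_comp; congr (_.[_]); apply: eq_map_poly => a /=.
  by rewrite hf.
have iz : val_ge ve 0 z.
  apply: integral_root ez => //; first exact: monic_map.
  by move=> i; rewrite coef_map; apply: jv_ge; apply: vr_val_ge.
have ev_int U : val_ge ve 0 (ev U).
  rewrite /ev horner_coef; apply: val_ge_sum => // i _; apply: val_geMl => //.
    by rewrite coef_map; apply: jv_ge; apply: vr_val_ge.
  exact: val_geX.
have ev_small U : map_poly red U = 0 -> val_ge ve 1 (ev U).
  move=> hU; rewrite /ev horner_coef; apply: val_ge_sum => // i _.
  apply: val_geMr => //; last exact: val_geX.
  rewrite coef_map; apply: jv_ge; apply/red0.
  by have /polyP/(_ i) := hU; rewrite coef_map coef0.
have evP : ev P = 0 by apply/rootP.
have evX m : ev ('X^(q ^ m) - 'X) = z ^+ (q ^ m) - z.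
  by rewrite evB /ev map_polyXn map_polyX hornerXn hornerX.
exists z; split=> //; first by exists M, w, f, z0.
  case/dvdpP: PD => A eA; rewrite -evX.
  have : val_ge ve 1 (ev (('X^(q ^ N) - 'X) - plift A * P)).
    apply: ev_small; rewrite rmorphB rmorphM /= redP pliftK rmorphB /= map_polyXn.
    by rewrite map_polyX eA subrr.
  by rewrite evB evM evP mulr0 subr0.
move=> i /Pcop /Bezout_eq1_coprimepP [[A B] /= eAB]; rewrite -evX => h.
have : val_ge ve 1 (ev (1 - plift B * ('X^(q ^ i) - 'X) - plift A * P)).
  apply: ev_small; rewrite !rmorphB !rmorphM rmorph1 /= redP !pliftK.
  by rewrite rmorphB /= map_polyXn map_polyX -eAB; ring.
rewrite !evB !evM evP mulr0 subr0 => h'.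
have : val_ge ve 1 (ev 1).
  rewrite -(subrK (ev (plift B) * ev ('X^(q ^ i) - 'X)) (ev 1)).
  by apply: val_geD => //; apply: val_geMl.
by rewrite /ev rmorph1 hornerC val_geE ?oner_neq0 // val1.
Qed.

End Zeta.

(** * The norm of a finite-dimensional algebra *)

Lemma det_similar (R : comNzRingType) m n (P : 'M[R]_(m, n)) (Q : 'M[R]_(n, m)) M N :
  P *m Q = 1%:M -> Q *m P = 1%:M -> M *m P = P *m N -> \det M = \det N.
Proof.
move=> PQ QP; have e : m = n.
  by apply/eqP; rewrite eqn_leq (mulmx1_min PQ) (mulmx1_min QP).
subst n => MP; have dPQ : \det P * \det Q = 1 by rewrite -det_mulmx PQ det1.
rewrite -[LHS]mulr1 -dPQ mulrA -det_mulmx MP det_mulmx.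
by rewrite [\det P * _]mulrC -mulrA dPQ mulr1.
Qed.

Section AlgNorm.

Variables (F : fieldType) (A : falgType F).
Local Notation e := (vbasis {:A}).
Local Notation d := (\dim {:A}).

Definition mulR_mx (x : A) : 'M[F]_d := \matrix_(i, j) coord e j (e`_i * x).

Lemma mulR_mxP x (i : 'I_d) : e`_i * x = \sum_j mulR_mx x i j *: e`_j.
Proof.
rewrite {1}(coord_vbasis (memvf (e`_i * x))).
by apply: eq_bigr => j _; rewrite mxE.
Qed.

Lemma vbasis_indep (c c' : 'I_d -> F) :
  \sum_i c i *: e`_i = \sum_i c' i *: e`_i -> c =1 c'.
Proof.
move=> h i; have fr := basis_free (vbasisP {:A}).
by rewrite -(coord_sum_free c i fr) h coord_sum_free.
Qed.

Lemma mulR_mxM x y : mulR_mx (x * y) = mulR_mx x *m mulR_mx y.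
Proof.
apply/matrixP => i; apply: vbasis_indep; rewrite -mulR_mxP mulrA mulR_mxP.
rewrite mulr_suml.
transitivity (\sum_j \sum_k (mulR_mx x i j * mulR_mx y j k) *: e`_k).
  apply: eq_bigr => j _; rewrite -scalerAl mulR_mxP scaler_sumr.
  by apply: eq_bigr => k _; rewrite scalerA.
rewrite exchange_big; apply: eq_bigr => k _ /=.
by rewrite -scaler_suml mxE.
Qed.

Lemma mulR_mx1 : mulR_mx 1 = 1%:M.
Proof.
apply/matrixP => i; apply: vbasis_indep; rewrite -mulR_mxP mulr1.
rewrite (bigD1 i) //= mxE eqxx scale1r big1 ?addr0 // => j ji.
by rewrite mxE eq_sym (negPf ji) scale0r.
Qed.

Lemma alg_normM (x y : A) : alg_norm (x * y) = alg_norm x * alg_norm y.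
Proof. by rewrite /alg_norm -!/(mulR_mx _) mulR_mxM det_mulmx. Qed.

Lemma alg_norm1 : alg_norm (1 : A) = 1.
Proof. by rewrite /alg_norm -/(mulR_mx _) mulR_mx1 det1. Qed.

Lemma alg_normX (x : A) n : alg_norm (x ^+ n) = alg_norm x ^+ n.
Proof. by elim: n => [|n IH]; rewrite ?alg_norm1 // !exprS alg_normM IH. Qed.

Lemma alg_norm_prod I (r : seq I) (f : I -> A) :
  alg_norm (\prod_(i <- r) f i) = \prod_(i <- r) alg_norm (f i).
Proof.
elim: r => [|i r IH]; first by rewrite !big_nil alg_norm1.
by rewrite !big_cons alg_normM IH.
Qed.

Lemma alg_norm_unit (x : A) : x \is a GRing.unit -> alg_norm x != 0.
Proof.
move=> ux; apply/eqP => x0; have := alg_normM x x^-1.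
by rewrite divrr // alg_norm1 x0 mul0r; apply/eqP; exact: oner_neq0.
Qed.

Lemma alg_normV (x : A) : x \is a GRing.unit -> alg_norm x^-1 = (alg_norm x)^-1.
Proof.
move=> ux; apply: (mulfI (alg_norm_unit ux)).
by rewrite -alg_normM divrr // alg_norm1 divff // alg_norm_unit.
Qed.

(** The norm is defined by means of a chosen basis, whereas the base change of
    [L] is best computed with in the basis [1 (x) e_i]. *)
Lemma alg_normE n (b : 'I_n -> A) (M : 'M[F]_n) x :
  (forall c, \sum_i c i *: b i = 0 -> c =1 (fun _ => 0)) ->
  (forall a, exists c, a = \sum_i c i *: b i) ->
  (forall i, b i * x = \sum_j M i j *: b j) -> alg_norm x = \det M.
Proof.
move=> bfree bgen hM.
pose P := \matrix_(i < n, j < d) coord e j (b i).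
have bP i : b i = \sum_j P i j *: e`_j.
  rewrite {1}(coord_vbasis (memvf (b i))).
  by apply: eq_bigr => j _; rewrite mxE.
have [q qP] := choice (fun i : 'I_d => bgen e`_i).
pose Q := \matrix_(i < d, j < n) q i j.
have eQ (i : 'I_d) : e`_i = \sum_j Q i j *: b j.
  by rewrite {1}qP; apply: eq_bigr => j _; rewrite mxE.
have bindep (c c' : 'I_n -> F) : \sum_i c i *: b i = \sum_i c' i *: b i -> c =1 c'.
  move=> h i; apply/eqP; rewrite -subr_eq0; apply/eqP.
  apply: (bfree (fun i => c i - c' i)).
  under eq_bigr do rewrite scalerBl.
  by rewrite sumrB h subrr.
have comb (V : lmodType F) m l (X : 'M[F]_(m, l)) (f : 'I_l -> V) k
    (Y : 'M[F]_(l, k)) (g : 'I_k -> V) (h : 'I_m -> V) :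
    (forall i, h i = \sum_j X i j *: f j) -> (forall j, f j = \sum_k Y j k *: g k) ->
    forall i, h i = \sum_k (X *m Y) i k *: g k.
  move=> hX hY i; rewrite hX.
  transitivity (\sum_j \sum_k (X i j * Y j k) *: g k).
    apply: eq_bigr => j _; rewrite hY scaler_sumr.
    by apply: eq_bigr => k' _; rewrite scalerA.
  by rewrite exchange_big; apply: eq_bigr => k' _; rewrite -scaler_suml mxE.
have sum1 (V : lmodType F) m (f : 'I_m -> V) i :
    f i = \sum_j (1%:M : 'M[F]_m) i j *: f j.
  rewrite (bigD1 i) //= mxE eqxx scale1r big1 ?addr0 // => j ji.
  by rewrite mxE eq_sym (negPf ji) scale0r.
have PQ : P *m Q = 1%:M.
  by apply/matrixP => i; apply: bindep; rewrite -(comb _ _ _ _ _ _ _ _ _ bP eQ) -sum1.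
have QP : Q *m P = 1%:M.
  apply/matrixP => i; apply: vbasis_indep.
  by rewrite -(comb _ _ _ _ _ _ _ _ _ eQ bP) -(sum1 _ _ (fun i : 'I_d => e`_i)).
have MP : M *m P = P *m mulR_mx x.
  apply/matrixP => i; apply: vbasis_indep.
  rewrite -(comb _ _ _ _ _ _ _ _ _ hM bP).
  rewrite -(comb _ _ _ _ (fun j => e`_j * x) _ _ _ (fun i => b i * x)) //.
    move=> j; rewrite {1}bP mulr_suml; apply: eq_bigr => k _.
    by rewrite -scalerAl.
  by move=> j; apply: mulR_mxP.
by symmetry; exact: (det_similar PQ QP MP).
Qed.

Lemma alg_norm_scalar (c : F) : alg_norm (c%:A : A) = c ^+ d.
Proof.
rewrite -(det_scalar d c).
apply: (alg_normE (b := fun i : 'I_d => e`_i)) => [c' h|a|i].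
- by apply: vbasis_indep; rewrite h big1 // => i _; rewrite scale0r.
- by exists (fun i => coord e i a); apply: coord_vbasis; apply: memvf.
rewrite -scalerAr mulr1 (bigD1 i) //= mxE eqxx mulr1n big1 ?addr0 // => j ji.
by rewrite mxE eq_sym (negPf ji) mulr0n scale0r.
Qed.

End AlgNorm.

(** * Compactness of lattices over a local field *)

Definition row_ge (F : fieldType) (v : F -> int) (n : int) d (x : 'rV[F]_d) : Prop :=
  forall i, val_ge v n (x 0 i).

Section RowGe.

Variables (F : fieldType) (v : F -> int).
Hypothesis hv : normalized_valuation v.
Variable d : nat.
Implicit Types x y : 'rV[F]_d.

Lemma row_ge0 n : row_ge v n (0 : 'rV[F]_d).
Proof. by move=> i; rewrite mxE; apply: val_ge0. Qed.

Lemma row_ge_le m n x : m <= n -> row_ge v n x -> row_ge v m x.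
Proof. by move=> mn h i; apply: val_ge_le mn (h i). Qed.

Lemma row_geD n x y : row_ge v n x -> row_ge v n y -> row_ge v n (x + y).
Proof. by move=> hx hy i; rewrite mxE; apply: val_geD. Qed.

Lemma row_geN n x : row_ge v n x -> row_ge v n (- x).
Proof. by move=> hx i; rewrite mxE; apply: val_geN. Qed.

Lemma row_geZ m n c x : val_ge v m c -> row_ge v n x -> row_ge v (m + n) (c *: x).
Proof. by move=> hc hx i; rewrite mxE; apply: val_geM. Qed.

Lemma row_ge_sum n I (r : seq I) (P : pred I) (f : I -> 'rV[F]_d) :
  (forall i, P i -> row_ge v n (f i)) -> row_ge v n (\sum_(i <- r | P i) f i).
Proof. by move=> h i; rewrite summxE; apply: val_ge_sum => // j /h. Qed.

Lemma row_ge_forall_eq0 x : (forall n : nat, row_ge v n%:Z x) -> x = 0.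
Proof.
move=> h; apply/rowP => i; rewrite mxE; apply: (@val_ge_forall_eq0 _ v).
by move=> n; apply: h.
Qed.

Lemma row_ge_exists x : exists n : nat, row_ge v (- n%:Z) x.
Proof.
exists (\sum_i `|v (x 0%R i)|)%N => i; right.
by rewrite (bigD1 i) //=; lia.
Qed.

Variable p : F.
Hypotheses (p0 : p != 0) (vp : v p = 1).

Lemma row_geZp n m x : row_ge v (n + m) (p ^ m *: x) <-> row_ge v n x.
Proof. by split=> h i; have := h i; rewrite mxE val_geZ. Qed.

(** A vector divisible by every power of the uniformizer vanishes, so that the
    largest such power can be factored out of a nonzero vector. *)
Lemma primitive_row x : x != 0 ->
  exists m, exists2 y, x = p ^ m *: y & row_ge v 0 y /\ ~ row_ge v 1 y.
Proof.
move=> x0; have [n0 h0] := row_ge_exists x.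
pose good n := `[< ~ row_ge v (n%:Z + 1 - n0%:Z) x >].
have exg : exists n, good n.
  apply: contrapT => hn; case/eqP: x0; apply: row_ge_forall_eq0 => n.
  apply: contrapT => h; apply: hn; exists (n + n0)%N; apply/asboolP => h'.
  by apply: h; apply: row_ge_le h'; lia.
have [n /asboolP hn nmin] := ex_minnP exg.
have pz k : p ^ k != 0 by rewrite expfz_neq0.
have ex : x = p ^ (n%:Z - n0%:Z) *: (p ^ (n0%:Z - n%:Z) *: x).
  by rewrite scalerA -expfzDr // (_ : _ + _ = 0) ?scale1r //; lia.
exists (n%:Z - n0%:Z), (p ^ (n0%:Z - n%:Z) *: x) => //; split.
  apply/(row_geZp _ (n%:Z - n0%:Z)); rewrite -ex add0r.
  case: n nmin {hn ex} => [|n] nmin; first by apply: row_ge_le h0; lia.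
  apply: contrapT => h; have : good n.
    by apply/asboolP => h'; apply: h; apply: row_ge_le h'; lia.
  by move/nmin; rewrite ltnn.
move/(row_geZp _ (n%:Z - n0%:Z)); rewrite -ex => h; apply: hn.
by apply: row_ge_le h; lia.
Qed.

End RowGe.

Section Compact.

Variables (K : fieldType) (v : K -> int) (q : nat).
Hypothesis hK : local_field v q.
Let hv := local_valuation hK.

(** Bolzano-Weierstrass: the classes modulo each power of the maximal ideal are
    finite in number, so the digits of a cluster point can be chosen one at a
    time, keeping infinitely many terms of the sequence. *)
Lemma cluster_point d (y : nat -> 'rV[K]_d) : (forall j, row_ge v 0 (y j)) ->
  exists x, forall n B : nat, exists2 j, (B <= j)%N & row_ge v n%:Z (y j - x).
Proof.
move=> hy; have [r [hr0 hr1]] := local_residue hK; have [p p0 vp] := val_unif hv.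
pose near n x := forall B, exists2 j, (B <= j)%N & row_ge v n%:Z (y j - x).
pose dig n (c : {ffun 'I_d -> 'I_q}) : 'rV[K]_d := \row_i (p ^ n%:Z * r (c i)).
have step (nx : nat * 'rV[K]_d) : exists c,
    near nx.1 nx.2 -> near nx.1.+1 (nx.2 + dig nx.1 c).
  case: nx => n x /=; apply: contrapT => /forallNP hn.
  have hB c : exists B, forall j, (B <= j)%N ->
      ~ row_ge v n.+1%:Z (y j - (x + dig n c)).
    have := hn c; apply: contra_notP => /forallNP h _ B.
    apply: contrapT => hB; apply: (h B) => j Bj hj; apply: hB; exists j => //.
  have [Bf hBf] := choice hB.
  have hx : near n x.
    apply: contrapT => hx; apply: (hn [ffun=> (sval (cid (hr1 _ (val_ge0 v 0))))]).
    by move=> /hx.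
  have [j Bj hj] := hx (\max_c Bf c).
  pose z i := p ^ (- n%:Z) * (y j - x) 0 i.
  have hz i : val_ge v 0 (z i).
    by rewrite -[0](addrN n%:Z); apply/val_geZ => //; apply: hj.
  have [c hc] := choice (fun i => hr1 _ (hz i)).
  apply: (hBf [ffun i => c i] j); first by apply: leq_trans Bj; exact: leq_bigmax.
  move=> i; rewrite opprD addrA !mxE ffunE; have [h _] := hc i.
  have -> : y j 0 i - x 0 i - p ^ n%:Z * r (c i) = p ^ n%:Z * (z i - r (c i)).
    rewrite mulrBr /z mulrA -expfzDr // addrN mul1r.
    by rewrite [in RHS]mxE [(- x) 0 i]mxE.
  by rewrite -addn1 PoszD addrC; apply/val_geZ.
have [S hS] := choice step.
pose xs := fix xs n := if n is m.+1 then xs m + dig m (S (m, xs m)) else 0 : 'rV[K]_d.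
have hxs n : near n (xs n).
  elim: n => [|n IH]; first by move=> B; exists B; rewrite ?subr0.
  exact: (hS (n, xs n)).
have xsE n i : xs n 0 i = \sum_(m < n) p ^ m%:Z * r (S (nat_of_ord m, xs m) i).
  elim: n => [|n IH]; first by rewrite big_ord0 mxE.
  by rewrite big_ord_recr /= -IH !mxE.
have hd i m : val_ge v (0 + m%:Z) (p ^ m%:Z * r (S (m, xs m) i)).
  by apply/val_geZ.
have lim i := series_cvg hv (local_complete hK) (hd i).
have lim' i : exists l, forall n : nat, val_ge v n%:Z (l - xs n 0 i).
  by have [l _ hl] := lim i; exists l => n; rewrite xsE -[n%:Z]add0r.
have [l hl] := choice lim'.
exists (\row_i l i) => n B; have [j Bj hj] := hxs n B.
exists j => // i; have := hj i; rewrite !mxE => h.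
by apply: (val_ge_trans hv h); rewrite -opprB; apply: val_geN.
Qed.

Section Coordinates.

Variable M : fieldExtType K.
Local Notation e := (vbasis {:M}).
Local Notation d := (\dim {:M}).

Definition coords (x : M) : 'rV[K]_d := \row_i coord e i x.
Definition of_coords (x : 'rV[K]_d) : M := \sum_i x 0 i *: e`_i.

Lemma coordsK x : of_coords (coords x) = x.
Proof.
rewrite [RHS](coord_vbasis (memvf x)); apply: eq_bigr => i _.
by rewrite mxE.
Qed.

Lemma of_coordsK x : coords (of_coords x) = x.
Proof.
by apply/rowP => i; rewrite mxE coord_sum_free // (basis_free (vbasisP _)).
Qed.

Lemma coordsD x y : coords (x + y) = coords x + coords y.
Proof. by apply/rowP => i; rewrite !mxE linearD. Qed.
Lemma coordsB x y : coords (x - y) = coords x - coords y.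
Proof. by apply/rowP => i; rewrite !mxE linearB. Qed.
Lemma coordsZ c x : coords (c *: x) = c *: coords x.
Proof. by apply/rowP => i; rewrite !mxE linearZ. Qed.
Lemma of_coords_eq0 x : of_coords x = 0 -> x = 0.
Proof. by move=> h; rewrite -(of_coordsK x) h; apply/rowP => i; rewrite !mxE linear0. Qed.

(** The constant bounds the denominators of the structure constants. *)
Lemma coordsM_bound : exists c : nat, forall m n x y,
  row_ge v m (coords x) -> row_ge v n (coords y) ->
  row_ge v (m + n - c%:Z) (coords (x * y)).
Proof.
pose f (ij : 'I_d * 'I_d) := sval (cid (row_ge_exists v (coords (e`_ij.1 * e`_ij.2)))).
exists (\sum_ij f ij)%N => m n x y hx hy.
rewrite -[x in x * y]coordsK -[y in _ * y]coordsK /of_coords big_distrlr /=.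
have -> : coords (\sum_i \sum_j coords x 0 i *: e`_i * (coords y 0 j *: e`_j)) =
    \sum_i \sum_j (coords x 0 i * coords y 0 j) *: coords (e`_i * e`_j).
  rewrite (big_morph coords coordsD (_ : coords 0 = 0)); last first.
    by apply/rowP => i; rewrite !mxE linear0.
  apply: eq_bigr => i _; rewrite (big_morph coords coordsD (_ : coords 0 = 0)); last first.
    by apply/rowP => k; rewrite !mxE linear0.
  by apply: eq_bigr => j _; rewrite -scalerAl -scalerAr scalerA coordsZ.
apply: row_ge_sum => // i _; apply: row_ge_sum => // j _.
apply: (@row_ge_le _ _ _ _ (m + n + - (f (i, j))%:Z)).
  by rewrite (bigD1 (i, j)) //=; lia.
apply: row_geZ => //; first exact: val_geM.
by rewrite /f; case: cid.
Qed.

Section ExtendedValuation.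

Variable w : M -> int.
Hypotheses (hw : normalized_valuation w) (wv : val_extends (fun x : K => x%:A : M) v w).

Lemma wZ c x : c != 0 -> x != 0 -> w (c *: x) = v c + w x.
Proof.
by move=> c0 x0; rewrite -mulr_algl (valM_ hw) ?wv // -in_algE fmorph_eq0.
Qed.

Lemma row_ge_val : exists c : nat, forall n x,
  row_ge v n (coords x) -> val_ge w (n - c%:Z) x.
Proof.
exists (\sum_(i < d) `|w e`_i|)%N => n x hx.
rewrite -(coordsK x); apply: val_ge_sum => // i _.
have [->|c0] := eqVneq (coords x 0 i) 0; first by rewrite scale0r; left.
have [->|e0] := eqVneq (e`_i) 0; first by rewrite scaler0; left.
have := hx i; rewrite val_geE // => h; right.
by rewrite wZ // (bigD1 i) //=; lia.
Qed.

(** Primitive vectors on which [w] is unbounded would have a primitive, hence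
    nonzero, cluster point of infinite valuation. *)
Lemma val_row_ge : exists B : nat, forall n x,
  val_ge w n x -> row_ge v (n - B%:Z) (coords x).
Proof.
have [p p0 vp] := val_unif hv; have pz k : p ^ k != 0 by rewrite expfz_neq0.
apply: contrapT => /forallNP hB.
have bad B : exists z : 'rV[K]_d,
    [/\ row_ge v 0 z, ~ row_ge v 1 z & B%:Z < w (of_coords z)].
  have /existsNP [n /existsNP [x /not_implyP [hx hnx]]] := hB B.
  have x0 : x != 0.
    apply: contra_notN hnx => /eqP -> i.
    by rewrite mxE linear0; apply: val_ge0.
  have c0 : coords x != 0.
    by apply: contraNneq x0 => h; rewrite -(coordsK x) h /of_coords big1 // => i _; rewrite mxE scale0r.
  have [m [z ez [z0 z1]]] := primitive_row hv p0 vp c0; exists z; split=> //.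
  have zn : of_coords z != 0 by apply: contra_notN z1 => /eqP/of_coords_eq0 ->; apply: row_ge0.
  have ex : x = p ^ m *: of_coords z.
    rewrite -(coordsK x) ez /of_coords scaler_sumr; apply: eq_bigr => i _.
    by rewrite mxE scalerA.
  move: hx; rewrite val_geE // ex wZ // valXz // vp mul1r => hx.
  case: (ltrP m (n - B%:Z)) => h; first by lia.
  case: hnx; rewrite ez; apply: (@row_ge_le _ _ _ _ (0 + m)); first by lia.
  exact/row_geZp.
have [z hz] := choice bad.
have [X hX] := @cluster_point d z (fun j => let: And3 h _ _ := hz j in h).
have X1 : ~ row_ge v 1 X.
  move=> h; have [j _ hj] := hX 1%N 0%N; have [_ h1 _] := hz j; apply: h1.
  by rewrite -(subrK X (z j)); apply: row_geD.
have Xn : of_coords X != 0.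
  by apply: contra_notN X1 => /eqP/of_coords_eq0 ->; apply: row_ge0.
have [c hc] := row_ge_val; pose m0 := `|w (of_coords X)|%N.
have [j mj hj] := hX (m0 + c).+1%N m0.
have : val_ge w (m0%:Z + 1) (of_coords (z j) - of_coords X).
  apply: (@val_ge_le _ _ _ ((m0 + c).+1%:Z - c%:Z)); first by lia.
  by apply: hc; rewrite coordsB !of_coordsK.
case/(val_eq_close hw Xn); first by lia.
by move=> _; have [_ _ h] := hz j; lia.
Qed.

End ExtendedValuation.

(** Both valuations lie at bounded distance from the lattice norm, hence from
    each other, and comparing them on all powers of [x] removes the bound. *)
Lemma ext_valuation_unique (w1 w2 : M -> int) : unramified v w1 ->
  normalized_valuation w2 -> val_extends (fun x : K => x%:A : M) v w2 ->
  forall x, x != 0 -> w1 x = w2 x.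
Proof.
case=> hw1 e1 hw2 e2.
have bound u1 u2 (h1 : normalized_valuation u1) (f1 : val_extends (fun x : K => x%:A : M) v u1)
   (h2 : normalized_valuation u2) (f2 : val_extends (fun x : K => x%:A : M) v u2) x :
     x != 0 -> u1 x <= u2 x.
  move=> x0; have [B hB] := val_row_ge h1 f1; have [c hc] := row_ge_val h2 f2.
  have hX k : u1 x * k%:Z - B%:Z - c%:Z <= u2 x * k%:Z.
    have : val_ge u1 (u1 x * k%:Z) (x ^+ k) by right; rewrite valX.
    by move/hB/hc; rewrite val_geE ?expf_neq0 // (valX h2).
  by have := hX (B + c).+1; nia.
by move=> x x0; apply/eqP; rewrite eq_le !bound.
Qed.

End Coordinates.

Lemma det_congr (n : nat) (A B : 'M[K]_n) : (forall i j, val_ge v 0 (B i j)) ->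
  (forall i j, val_ge v 1 (A i j - B i j)) -> val_ge v 1 (\det A - \det B).
Proof.
move=> hB hAB; have hA i j : val_ge v 0 (A i j).
  rewrite -(subrK (B i j) (A i j)); apply: val_geD => //.
  by apply: val_ge_le (hAB i j).
rewrite /determinant -sumrB; apply: val_ge_sum => // s _; rewrite -mulrBr.
apply: val_geMl => //.
  by apply: val_geX => //; apply: val_geN => //; apply: val_ge1.
suff [] : [/\ val_ge v 1 (\prod_i A i (s i) - \prod_i B i (s i)),
   val_ge v 0 (\prod_i A i (s i)) & val_ge v 0 (\prod_i B i (s i))] by [].
elim/big_rec2: _ => [|i b a _ [h ha hb]].
  by rewrite subrr; split; [apply: val_ge0| |]; apply: val_ge1.
split; [|exact: val_geMl|exact: val_geMl].
rewrite (_ : A i (s i) * a - _ = (A i (s i) - B i (s i)) * a + B i (s i) * (a - b));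
  last by ring.
by apply: val_geD; [|apply: val_geMr|apply: val_geMl].
Qed.

End Compact.

(** * Elements of norm of valuation zero *)

Section UnitNorm.

Variables (K : fieldType) (v : K -> int) (q : nat).
Hypothesis hK : local_field v q.
Let hv := local_valuation hK.
Variable L : fieldExtType K.
Local Notation e := (vbasis {:L}).
Local Notation d := (\dim {:L}).

Let norm_neq0 (x : L) : x != 0 -> alg_norm x != 0.
Proof. by move=> x0; apply: alg_norm_unit; rewrite unitfE. Qed.

Let normV_M (x y : L) : x != 0 -> y != 0 -> v (alg_norm (x * y)) = v (alg_norm x) + v (alg_norm y).
Proof. by move=> x0 y0; rewrite alg_normM (valM_ hv) ?norm_neq0. Qed.

Lemma norm_close1 : exists T : nat, forall t : L, row_ge v T%:Z (coords t) ->
  1 + t != 0 /\ v (alg_norm (1 + t)) = 0.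
Proof.
have [c hc] := coordsM_bound hK L.
exists c.+1 => t ht.
have hdet : val_ge v 1 (alg_norm (1 + t) - 1).
  change (val_ge v 1 (\det (mulR_mx (1 + t)) - 1)); rewrite -(det1 K d).
  apply: (det_congr hK) => i j.
    by rewrite mxE; case: eqP => _; [apply: val_ge1|apply: val_ge0].
  have -> : mulR_mx (1 + t) i j - 1%:M i j = coord e j (e`_i * t).
    rewrite -(mulR_mx1 L) !mxE mulrDr mulr1 linearD /=; ring.
  have ei : row_ge v 0 (coords (e`_i : L)).
    move=> k; rewrite mxE coord_free ?(basis_free (vbasisP _)) //.
    by case: eqP => _; [apply: val_ge1|apply: val_ge0].
  have := hc _ _ _ _ ei ht j; rewrite mxE; apply: val_ge_le; lia.
have [|n0 vn] := val_eq_close hv (oner_neq0 K) _ hdet; first by rewrite val1.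
split; last by rewrite vn val1.
apply: contraNneq n0 => ->; rewrite -[0](scale0r (1 : L)) alg_norm_scalar.
by rewrite expr0n -[d == 0%N]negbK -lt0n adim_gt0.
Qed.

Let d_gt0 : (0 < d)%N. Proof. exact: adim_gt0. Qed.

Lemma val_normZ c (x : L) : c != 0 -> x != 0 ->
  v (alg_norm (c *: x)) = v c * d%:Z + v (alg_norm x).
Proof.
move=> c0 x0; have cA : c%:A != 0 :> L by rewrite -in_algE fmorph_eq0.
by rewrite -mulr_algl normV_M // alg_norm_scalar valX.
Qed.

(** If the powers of [u] were unbounded, their primitive parts would have norms
    of arbitrarily large valuation, and so a nonzero cluster point of norm [0]. *)
Lemma powers_bounded (u : L) : u != 0 -> v (alg_norm u) = 0 ->
  exists B : nat, forall j, row_ge v (- B%:Z) (coords (u ^+ j)).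
Proof.
move=> u0 vu; have [p p0 vp] := val_unif hv.
have vuj j : v (alg_norm (u ^+ j)) = 0.
  by rewrite alg_normX valX ?norm_neq0 // vu mul0r.
apply: contrapT => /forallNP hB.
have bad B : exists z : 'rV[K]_d, [/\ row_ge v 0 z, ~ row_ge v 1 z &
    B%:Z < v (alg_norm (of_coords z))].
  have /existsNP [j hj] := hB B.
  have uj0 : u ^+ j != 0 by rewrite expf_neq0.
  have c0 : coords (u ^+ j) != 0.
    apply: contraNneq uj0 => h; rewrite -(coordsK (u ^+ j)) h /of_coords big1 // => i _.
    by rewrite mxE scale0r.
  have [m [z ez [z0 z1]]] := primitive_row hv p0 vp c0; exists z; split=> //.
  have zn : of_coords z != 0.
    by apply: contra_notN z1 => /eqP/of_coords_eq0 ->; apply: row_ge0.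
  have ex : u ^+ j = p ^ m *: of_coords z.
    rewrite -(coordsK (u ^+ j)) ez /of_coords scaler_sumr; apply: eq_bigr => i _.
    by rewrite mxE scalerA.
  have := vuj j; rewrite ex val_normZ ?expfz_neq0 // valXz // vp mul1r.
  case: (ltrP m (- B%:Z)) => h; first by move: d_gt0 h; case: d => // d' _; nia.
  case: hj; rewrite ez; apply: (@row_ge_le _ _ _ _ (0 + m)); first by lia.
  exact/row_geZp.
have [z hz] := choice bad.
have [X hX] := cluster_point hK (fun j => let: And3 h _ _ := hz j in h).
have X1 : ~ row_ge v 1 X.
  move=> h; have [j _ hj] := hX 1%N 0%N; have [_ h1 _] := hz j; apply: h1.
  by rewrite -(subrK X (z j)); apply: row_geD.
have Xn : of_coords X != 0.
  by apply: contra_notN X1 => /eqP/of_coords_eq0 ->; apply: row_ge0.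
set x := of_coords X in Xn.
have [T hT] := norm_close1; have [c hc] := coordsM_bound hK L.
have [b hb] := row_ge_exists v (coords x^-1); pose m0 := `|v (alg_norm x)|%N.
have [j mj hj] := hX (T + c + b)%N m0.
pose t := x^-1 * (of_coords (z j) - x).
have ht : row_ge v T%:Z (coords t).
  have hzx : row_ge v (T + c + b)%N%:Z (coords (of_coords (z j) - x)).
    by rewrite coordsB !of_coordsK.
  by apply: row_ge_le (hc _ _ _ _ hb hzx); lia.
have [t1 vt] := hT t ht.
have ez : of_coords (z j) = x * (1 + t).
  by rewrite mulrDr mulr1 /t mulVKf // addrC subrK.
by have [_ _] := hz j; rewrite ez normV_M // vt; lia.
Qed.

(** By compactness two powers of [u] are close, hence some power is close to
    [1]. *)
Lemma unit_power_close (u : L) : u != 0 -> v (alg_norm u) = 0 ->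
  forall n : nat, exists2 m, (0 < m)%N & row_ge v n%:Z (coords (u ^+ m - 1)).
Proof.
move=> u0 vu n; have [p p0 vp] := val_unif hv.
have u0' : u^-1 != 0 by rewrite invr_eq0.
have vu' : v (alg_norm u^-1) = 0.
  by rewrite alg_normV ?unitfE // valV ?norm_neq0 // vu oppr0.
have [B hB] := powers_bounded u0 vu; have [B' hB'] := powers_bounded u0' vu'.
have [c hc] := coordsM_bound hK L.
pose y j := p ^ B%:Z *: coords (u ^+ j).
have hy j : row_ge v 0 (y j).
  by rewrite -[0](addNr B%:Z); apply/row_geZp.
have [X hX] := cluster_point hK hy.
pose N := (n + c + B' + B)%N.
have [j _ hj] := hX N 0%N; have [k jk hk] := hX N j.+1.
have hjk : row_ge v (n + c + B')%N%:Z (coords (u ^+ k - u ^+ j)).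
  apply/(row_geZp hv p0 vp _ B%:Z); rewrite coordsB scalerBr -/(y k) -/(y j).
  rewrite -[_ - _](subrKA X) (_ : _ + _ = N%:Z); last by rewrite /N; lia.
  by apply: row_geD => //; rewrite -opprB; apply: row_geN.
exists (k - j)%N; first by lia.
have -> : u ^+ (k - j) - 1 = u^-1 ^+ j * (u ^+ k - u ^+ j).
  rewrite mulrBr exprVn mulVf ?expf_neq0 // -{2}(subnKC (ltnW jk)) exprD.
  by rewrite mulKf ?expf_neq0.
by apply: row_ge_le (hc _ _ _ _ (hB' j) hjk); lia.
Qed.

End UnitNorm.

(** * The completed maximal unramified extension *)

Definition unramified_elt (K E : fieldType) (v : K -> int) (iota : K -> E) (x : E) : Prop :=
  exists (M : fieldExtType K) (w : M -> int) (f : {rmorphism M -> E}) y,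
    [/\ unramified v w, embedding_over iota f & x = f y].

(** The completed maximal unramified extension enters only through these
    properties; the intermediate field [Kun] survives as the dense set of
    [unramified_elt]. *)
Record unr_complete (K E : fieldType) (v : K -> int) (iota : {rmorphism K -> E})
    (ve : E -> int) : Prop := {
  uc_val : normalized_valuation ve;
  uc_ext : val_extends iota v ve;
  uc_complete : val_complete ve;
  uc_dense : forall y (n : int), exists2 x, unramified_elt v iota x & val_ge ve n (y - x);
  uc_embed : forall (M : fieldExtType K) (w : M -> int), unramified v w ->
    exists f : {rmorphism M -> E}, embedding_over iota f }.

Lemma unr_completeP (K E : fieldType) (v : K -> int) (iota : {rmorphism K -> E})
    (ve : E -> int) : completed_max_unramified v iota ve -> unr_complete v iota ve.
Proof.
case=> [Kun [j [vun [i [hmx hcp hij]]]]]; split.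
- exact: cpl_valuation hcp.
- move=> x x0; rewrite hij (cpl_extends hcp) ?fmorph_eq0 //.
  exact: (mxu_extends hmx).
- exact: cpl_complete hcp.
- move=> y n; have [x hx] := cpl_dense hcp y n; exists (i x) => //.
  have [M [w [f [hM hf [z ez]]]]] := mxu_union hmx x.
  by exists M, w, (i \o f), z; split=> [//|c|] /=; rewrite ?hf ?hij // ez.
- move=> M w hM; have [f hf] := mxu_maximal hmx hM.
  by exists (i \o f) => c /=; rewrite hf hij.
Qed.

Section FrobIter.
Variables (E : fieldType) (s : {rmorphism E -> E}).

(** A name for [iter n s] to which the structure of a ring morphism is attached. *)
Definition rm_iter (n : nat) : E -> E := iter n s.

Fact rm_iter_zmod n : zmod_morphism (rm_iter n).
Proof.
move=> x y; rewrite /rm_iter; elim: n => // n IH.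
by rewrite !iterS IH rmorphB.
Qed.
Fact rm_iter_monoid n : monoid_morphism (rm_iter n).
Proof.
rewrite /rm_iter; split; first by elim: n => // n IH; rewrite iterS IH rmorph1.
by elim: n => // n IH x y; rewrite !iterS IH rmorphM.
Qed.
HB.instance Definition _ n := GRing.isZmodMorphism.Build E E (rm_iter n) (rm_iter_zmod n).
HB.instance Definition _ n := GRing.isMonoidMorphism.Build E E (rm_iter n) (rm_iter_monoid n).

Lemma rm_iterS n x : rm_iter n.+1 x = s (rm_iter n x). Proof. by []. Qed.
Lemma rm_iterD m n x : rm_iter (m + n) x = rm_iter m (rm_iter n x). Proof. exact: iterD. Qed.
Lemma rm_iter_per n x : rm_iter n x = x -> forall m, rm_iter (m * n) x = x.
Proof. by move=> h; elim=> // m IH; rewrite mulSn rm_iterD IH. Qed.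
End FrobIter.

Section Frobenius.

Variables (K : fieldType) (v : K -> int) (q : nat).
Hypothesis hK : local_field v q.
Let hv := local_valuation hK.
Variables (E : fieldType) (iota : {rmorphism K -> E}) (ve : E -> int).
Hypothesis hE : unr_complete v iota ve.
Variable sigma : {rmorphism E -> E}.
Hypothesis hsigma : frobenius q iota ve sigma.
Let hve := uc_val hE.

Local Notation sig := (rm_iter sigma).

Lemma frob_iota x : sigma (iota x) = iota x.
Proof. by apply/(frob_fixed hsigma); exists x. Qed.

Lemma frob_iter_iota n x : sig n (iota x) = iota x.
Proof. by elim: n => // n IH; rewrite rm_iterS IH frob_iota. Qed.

Lemma exists_unif : exists2 p, p != 0 & v p = 1.
Proof. exact: val_unif hv. Qed.

Lemma unif_iota p : p != 0 -> v p = 1 -> iota p != 0 /\ ve (iota p) = 1.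
Proof. by move=> p0 vp; rewrite fmorph_eq0 (uc_ext hE). Qed.

(** Units stay units because [sigma] reduces to the [q]th power map, and the
    uniformizers of [K] are fixed. *)
Lemma frob_val x : x != 0 -> ve (sigma x) = ve x.
Proof.
have [p p0 vp] := exists_unif; have [ip0 vip] := unif_iota p0 vp.
have pz n : iota p ^ n != 0 by rewrite expfz_neq0.
have vpz n : ve (iota p ^ n) = n by rewrite valXz // vip mul1r.
have unit_case y : y != 0 -> ve y = 0 -> ve (sigma y) = 0.
  move=> y0 vy; have iy : val_ge ve 0 y by right; rewrite vy.
  have h := frob_residue hsigma iy.
  have vyq : ve (y ^+ q) = 0 by rewrite valX // vy mul0r.
  have [|_ ->] := val_eq_close hve (expf_neq0 q y0) _ h; first by rewrite vyq.
  exact: vyq.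
move=> x0; have := unit_case (iota p ^ (- ve x) * x).
rewrite mulf_neq0 // (valM_ hve) // vpz addNr rmorphM fmorphXz /= frob_iota.
by rewrite (valM_ hve) ?fmorph_eq0 // vpz => /(_ isT erefl); lia.
Qed.

Lemma frob_val_ge n x : val_ge ve n x -> val_ge ve n (sigma x).
Proof.
have [->|x0] := eqVneq x 0; first by rewrite rmorph0.
by rewrite !val_geE ?fmorph_eq0 // frob_val.
Qed.

Lemma frob_iter_val_ge m n x : val_ge ve n x -> val_ge ve n (sig m x).
Proof. by move=> h; elim: m => // m IH; apply: frob_val_ge. Qed.

Lemma frob_iter_power m x : val_ge ve 0 x -> val_ge ve 1 (sig m x - x ^+ (q ^ m)).
Proof.
move=> hx; elim: m => [|m IH]; first by rewrite expn0 expr1 subrr; apply: val_ge0.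
rewrite rm_iterS; apply: (@val_ge_trans _ _ hve _ _ ((sig m x) ^+ q)).
  by apply: (frob_residue hsigma); apply: frob_iter_val_ge.
rewrite expnSr exprM; apply: val_ge_subX => //; last exact: val_geX.
exact: frob_iter_val_ge.
Qed.

Lemma ve_q : val_ge ve 1 (q%:R : E).
Proof.
by have := ext_val_ge (uc_ext hE) (val_ge_q hK); rewrite rmorph_nat.
Qed.

(** The conjugates of an algebraic element are finite in number, and [sigma]
    permutes them. *)
Lemma unramified_elt_period x : unramified_elt v iota x ->
  exists2 n, (0 < n)%N & sig n x = x.
Proof.
case=> M [w [f [y [_ hf ->]]]]; have := minPolyOver 1 y.
case/polyOver1P => P eP; pose Q := map_poly iota P.
have Q0 : Q != 0.
  by rewrite map_poly_eq0 -(map_poly_eq0 (in_alg M)) -eP monic_neq0 ?monic_minPoly.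
have rQ n : root Q (sig n (f y)).
  apply/rootP; rewrite /Q (_ : map_poly iota P = map_poly (sig n) (map_poly iota P)).
    rewrite horner_map (_ : map_poly iota P = map_poly f (minPoly 1 y)).
      by rewrite horner_map (rootP (root_minPoly 1 y)) !rmorph0.
    by rewrite eP -map_poly_comp; apply: eq_map_poly => c /=; rewrite hf.
  by rewrite -map_poly_comp; apply: eq_map_poly => c /=; rewrite frob_iter_iota.
apply: contrapT => hper.
have inj : injective (fun n => sig n (f y)).
  suff h i j : (i < j)%N -> sig i (f y) != sig j (f y).
    move=> i j e; have [l|l|//] := ltngtP i j.
      by have := h _ _ l; rewrite e eqxx.
    by have := h _ _ l; rewrite e eqxx.
  move=> ij; apply: contra_notN hper => /eqP e; exists (j - i)%N; first by rewrite subn_gt0.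
  by apply: (fmorph_inj (sig i)); rewrite /= -rm_iterD subnKC // ltnW.
suff : (size (mkseq (fun n => sig n (f y)) (size Q)) < size Q)%N.
  by rewrite size_mkseq ltnn.
apply: max_poly_roots => //; first by apply/allP => _ /mapP[n _ ->].
by apply/mkseq_uniqP => i j _ _; apply: inj.
Qed.

End Frobenius.

(** * Surjectivity of [sigma^n - 1] *)

Section AdditiveLang.

Variables (K : fieldType) (v : K -> int) (q : nat).
Hypothesis hK : local_field v q.
Let hv := local_valuation hK.
Variables (E : fieldType) (iota : {rmorphism K -> E}) (ve : E -> int).
Hypothesis hE : unr_complete v iota ve.
Variable sigma : {rmorphism E -> E}.
Hypothesis hsigma : frobenius q iota ve sigma.
Let hve := uc_val hE.

Local Notation sig := (rm_iter sigma).

Let sig_ge m n x : val_ge ve n x -> val_ge ve n (sig m x).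
Proof. exact: (frob_iter_val_ge hK hE hsigma). Qed.

(** Lagrange interpolation at the [N] conjugates of an element of exact period
    [N] modulo the maximal ideal shows that not all the power sums of these
    conjugates vanish. *)
Lemma trace_unit (n N : nat) : (0 < n)%N -> (0 < N)%N -> exists t,
  [/\ val_ge ve 0 t, val_ge ve 1 (sig (N * n) t - t)
    & ~ val_ge ve 1 (\sum_(j < N) sig (j * n) t)].
Proof.
move=> n0 N0; have Nn0 : (0 < N * n)%N by rewrite muln_gt0 N0.
have [z [_ iz zN zi]] := exists_zeta hK hve (uc_ext hE) (uc_embed hE) Nn0.
pose zj j := sig (j * n) z.
have izj j : val_ge ve 0 (zj j) by apply: sig_ge.
have zj_neq j : (0 < j < N)%N -> ~ val_ge ve 1 (zj 0%N - zj j).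
  move=> /andP[j0 jN] h; apply: (zi (j * n)%N).
    by rewrite muln_gt0 j0 n0 ltn_pmul2r.
  have h2 := frob_iter_power hK hE hsigma (j * n) iz.
  rewrite -opprB; apply: val_geN => //; apply: (val_ge_trans hve _ h2).
  by move: h; rewrite /zj mul0n.
pose h := \prod_(j < N | (0 < j)%N) ('X - (zj j)%:P).
have hint (k : nat) : val_ge ve 0 h`_k.
  rewrite /h; elim/big_ind: _ k => [k|A B hA hB k|j _ k].
  - by rewrite coef1; case: eqP => _; [apply: val_ge1|apply: val_ge0].
  - by rewrite coefM; apply: val_ge_sum => // i _; apply: val_geMl.
  rewrite coefB coefX coefC; apply: val_geB => //.
    by case: eqP => _; [apply: val_ge1|apply: val_ge0].
  by case: eqP => _ //; apply: val_ge0.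
have hsum : \sum_(j < N) h.[zj j] = \prod_(j < N | (0 < j)%N) (zj 0%N - zj j).
  rewrite (bigD1 (Ordinal N0)) //= big1 => [|j j0].
    by rewrite addr0 /h horner_prod; apply: eq_bigr => j _; rewrite hornerXsubC.
  have j0' : (0 < j)%N by rewrite lt0n; apply: contra j0 => /eqP j0; apply/eqP/val_inj.
  by rewrite /h horner_prod (bigD1 j) //= hornerXsubC subrr mul0r.
have hunit : ~ val_ge ve 1 (\sum_(j < N) h.[zj j]).
  rewrite hsum -big_filter; have : all (fun j : 'I_N => (0 < j)%N) [seq i : 'I_N <- index_enum 'I_N | (0 < i)%N].
    exact: filter_all.
  elim: [seq _ <- _ | _] => [_|j s IH /= /andP[j0 /IH hs]].
    by rewrite big_nil val_geE ?oner_neq0 // val1.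
  rewrite big_cons; have jN : (0 < j < N)%N by rewrite j0 ltn_ord.
  have ij : val_ge ve 0 (zj 0%N - zj j) by apply: val_geB.
  have isp : val_ge ve 0 (\prod_(j <- s) (zj 0%N - zj j)).
    by apply: val_ge_prod => // i _; apply: val_geB.
  have [a0 va] := val_unitP ij (zj_neq _ jN); have [b0 vb] := val_unitP isp hs.
  by rewrite val_geE ?mulf_neq0 // (valM_ hve) // va vb.
have [k hk] : exists k : nat, ~ val_ge ve 1 (\sum_(j < N) zj j ^+ k).
  apply: contrapT => /forallNP hk; apply: hunit.
  under eq_bigr do rewrite horner_coef.
  rewrite exchange_big /=; apply: val_ge_sum => // k _; rewrite -mulr_sumr.
  by apply: val_geMl => //; have := hk k => /contrapT.
exists (z ^+ k); split.
- exact: val_geX.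
- rewrite rmorphXn; apply: val_ge_subX => //; first exact: sig_ge.
  by apply: (val_ge_trans hve _ zN); apply: (frob_iter_power hK hE hsigma).
by under eq_bigr do rewrite rmorphXn.
Qed.

(** Additive Hilbert 90 for the cyclic group generated by [sig n]: the element
    [c] may be replaced by one of finite period [m], and its trace over [q m]
    steps is [q] times its trace over [m] steps, hence vanishes modulo the maximal
    ideal. *)
Lemma frob_sub_surj_mod n c : (0 < n)%N -> val_ge ve 0 c ->
  exists2 z, val_ge ve 0 z & val_ge ve 1 (sig n z - z - c).
Proof.
move=> n0 ic; have [c0 hc0 cc0] := uc_dense hE c 1.
have ic0 : val_ge ve 0 c0.
  rewrite -(subKr c c0); apply: val_geB => //; exact: val_ge_le cc0.
have [m m0 pm] := unramified_elt_period hsigma hc0.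
have q0 : (0 < q)%N by apply: ltn_trans (residue_card_gt1 hK).
pose N := (q * m)%N; have N0 : (0 < N)%N by rewrite muln_gt0 q0.
have [th [ith thN thu]] := trace_unit n0 N0.
pose tr := \sum_(j < N) sig (j * n) th; pose t := sig n tr.
have itr : val_ge ve 0 tr by apply: val_ge_sum => // j _; apply: sig_ge.
have it : val_ge ve 0 t by apply: sig_ge.
have [tr0 vtr] := val_unitP itr thu.
have sigval k x : x != 0 -> ve (sig k x) = ve x.
  by move=> x0; elim: k => // k IH; rewrite rm_iterS (frob_val hK hE hsigma) ?fmorph_eq0.
have t0 : t != 0 by rewrite fmorph_eq0.
have vt : ve t = 0 by rewrite sigval.
have tt : val_ge ve 1 (sig n t - t).
  rewrite /t -rmorphB; apply: sig_ge; rewrite /tr rmorph_sum -sumrB.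
  under eq_bigr => j _ do rewrite /= -rm_iterD -mulSn.
  rewrite -(big_mkord xpredT (fun j => sig (j.+1 * n) th - sig (j * n) th)).
  by rewrite telescope_sumr // mul0n.
pose S j := \sum_(i < j) sig (i * n) c0.
have iS j : val_ge ve 0 (S j) by apply: val_ge_sum => // i _; apply: sig_ge.
have SS j : sig n (S j) = S j.+1 - c0.
  rewrite /S big_ord_recl /= addrAC subrr add0r rmorph_sum.
  by apply: eq_bigr => i _; rewrite /= -rm_iterD -mulSn.
pose g j := S j * sig (j * n) th.
have gg j : sig n (g j) = g j.+1 - c0 * sig (j.+1 * n) th.
  by rewrite rmorphM /= SS -rm_iterD -mulSn mulrBl.
(* the usual primitive of c0 t, for an element th whose trace tr is a unit *)
pose y := - \sum_(j < N) g j.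
have iy : val_ge ve 0 y.
  by apply: val_geN => //; apply: val_ge_sum => // j _; apply: val_geMl => //; apply: sig_ge.
have ey : sig n y - y = c0 * t - g N.
  rewrite /y rmorphN rmorph_sum /=; under eq_bigr do rewrite gg.
  have -> : t = \sum_(j < N) sig (j.+1 * n) th.
    by rewrite /t rmorph_sum; apply: eq_bigr => j _; rewrite /= -rm_iterD -mulSn.
  have tel := telescope_sumr g (leq0n N).
  have g0 : g 0%N = 0 by rewrite /g /S big_ord0 mul0r.
  rewrite g0 subr0 big_mkord sumrB in tel.
  by rewrite sumrB -mulr_sumr -tel; ring.
have gN : val_ge ve 1 (g N).
  apply: val_geMr => //; last exact: sig_ge.
  have -> : S N = q%:R * S m.
    rewrite /N; elim: q => [|k IH]; first by rewrite mul0n /S big_ord0 mul0r.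
    rewrite mulSn /S big_split_ord /= -addn1 natrD mulrDl mul1r addrC -IH.
    congr (_ + _); apply: eq_bigr => i _ /=.
    rewrite addnC mulnDl rm_iterD [(m * n)%N]mulnC (rm_iter_per pm) //.
  exact: (val_geMr hve (ve_q hK hE) (iS m)).
have st0 : sig n t != 0 by rewrite fmorph_eq0.
have vst : ve (sig n t) = 0 by rewrite sigval.
exists (y / t); first by apply: val_geMl => //; apply: val_geV.
apply: (@val_ge_trans _ _ hve _ _ c0); last by rewrite -opprB; apply: val_geN.
rewrite fmorph_div /=.
have -> : sig n y / sig n t - y / t - c0 =
    (sig n t - t) * (- (c0 + y / t) / sig n t) - g N / sig n t.
  have -> : sig n y = y + (c0 * t - g N) by rewrite -ey addrC subrK.
  by field; rewrite t0 st0.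
apply: val_geB => //; apply: val_geMr => //; last exact: val_geV.
apply: val_geMl => //; last exact: val_geV.
apply: val_geN => //; apply: val_geD => //; apply: val_geMl => //.
exact: val_geV.
Qed.

(** Successive approximation. *)
Lemma frob_sub_surj n c k : (0 < n)%N -> val_ge ve k c ->
  exists2 z, val_ge ve k z & sig n z - z = c.
Proof.
move=> n0 hc; have [p p0 vp] := exists_unif hK.
have [ip0 vip] := unif_iota hE p0 vp.
have step (kc : int * E) : exists z, val_ge ve kc.1 kc.2 ->
    val_ge ve kc.1 z /\ val_ge ve (kc.1 + 1) (sig n z - z - kc.2).
  case: kc => l x /=; have [hx|hx] := pselect (val_ge ve l x); last by exists 0.
  have : val_ge ve 0 (iota p ^ (- l) * x) by rewrite -[0](addrN l); apply/val_geZ.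
  move=> /(frob_sub_surj_mod n0) [z hz hz1]; exists (iota p ^ l * z) => _.
  have ex : x = iota p ^ l * (iota p ^ (- l) * x).
    by rewrite mulrA -expfzDr // addrN mul1r.
  split; first by rewrite -[l in val_ge _ l]add0r; apply/val_geZ.
  rewrite [X in _ - X]ex rmorphM fmorphXz /= (frob_iter_iota hsigma) -!mulrBr.
  by rewrite addrC; apply/val_geZ.
have [S hS] := choice step.
pose cs := fix cs i := if i is j.+1 then
   cs j - (sig n (S (k + j%:Z, cs j)) - S (k + j%:Z, cs j)) else c.
pose zs i := S (k + i%:Z, cs i).
have hcs i : val_ge ve (k + i%:Z) (cs i).
  elim: i => [|i IH]; first by rewrite addr0.
  have [_ h] := hS (k + i%:Z, cs i) IH.
  rewrite -addn1 PoszD addrA /= addn1 /= -opprB; apply: val_geN => //.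
have hzs i : val_ge ve (k + i%:Z) (zs i) by have [] := hS (k + i%:Z, cs i) (hcs i).
have [z _ hz] := series_cvg hve (uc_complete hE) hzs.
exists z; first by have := hz 0%N; rewrite big_ord0 !subr0.
apply/eqP; rewrite -subr_eq0; apply/eqP; apply: (@val_ge_forall_eq0 _ ve) => i.
pose m := (i + `|k|)%N; pose r := z - \sum_(j < m) zs j.
have partial l : sig n (\sum_(j < l) zs j) - \sum_(j < l) zs j = c - cs l.
  elim: l => [|l IH]; first by rewrite !big_ord0 rmorph0 !subrr.
  by rewrite !big_ord_recr rmorphD /= opprD addrACA IH /zs; ring.
have ez : z = \sum_(j < m) zs j + r by rewrite /r addrC subrK.
have -> : sig n z - z - c = sig n r - r - cs m.
  rewrite {1 2}ez rmorphD /= opprD addrACA partial; ring.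
have hle : i%:Z <= k + m%:Z by rewrite /m; lia.
have hr : val_ge ve i%:Z r by apply: val_ge_le hle (hz m).
apply: val_geB => //; last exact: val_ge_le hle (hcs m).
by apply: val_geB => //; apply: sig_ge.
Qed.

End AdditiveLang.

(** * The algebra [L_K] and its two actions *)

Section BaseChangeActions.

Variables (F E : fieldType) (iota : {rmorphism F -> E}) (L : fieldExtType F).
Local Notation LE := (base_change iota L).
Local Notation e := (vbasis (fullv : {vspace L})).
Local Notation d := (\dim (fullv : {vspace L})).
Local Notation T c a := (tensor iota c a : LE).

Lemma bc_eqP (x y : LE) : (forall i, x 0 i = y 0 i) -> x = y.
Proof. by move=> h; apply/rowP. Qed.

Lemma bc_addE (x y : LE) i : (x + y) 0 i = x 0 i + y 0 i.
Proof. by rewrite mxE. Qed.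
Lemma bc_oppE (x : LE) i : (- x) 0 i = - x 0 i.
Proof. by rewrite mxE. Qed.
Lemma bc_scaleE c (x : LE) i : (c *: x) 0 i = c * x 0 i.
Proof. by rewrite mxE. Qed.
Lemma bc_zeroE i : (0 : LE) 0 i = 0.
Proof. by rewrite mxE. Qed.
Lemma tensorE c a i : (T c a) 0 i = c * iota (coord e i a).
Proof. by rewrite mxE. Qed.

Lemma tensor11 : T 1 1 = 1. Proof. by []. Qed.

Lemma scale_tensor c c' a : c *: T c' a = T (c * c') a.
Proof. by rewrite tensorZ. Qed.

Lemma tensor_split c a : T c a = c *: T 1 a.
Proof. by rewrite scale_tensor mulr1. Qed.

Lemma tensor_scalar c : T c 1 = c%:A.
Proof. by rewrite tensor_split tensor11. Qed.

Lemma tensor_iota k : T 1 k%:A = (iota k)%:A.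
Proof. by rewrite tensor_scale mul1r tensor_scalar. Qed.

Lemma bc_basis (x : LE) : x = \sum_i x 0 i *: T 1 e`_i.
Proof.
rewrite {1}(base_change_basis x); apply: eq_bigr => i _; exact: tensor_split.
Qed.

Lemma bc_left_row (f : E -> E) (x : LE) i : (bc_left f x) 0 i = f (x 0 i).
Proof.
pose y : LE := \row_j f (x 0 j); suff -> : bc_left f x = y by rewrite mxE.
by rewrite (base_change_basis y); apply: eq_bigr => j _; rewrite mxE.
Qed.

Section Left.
Variable f : {rmorphism E -> E}.
Hypothesis fK : forall k, f (iota k) = iota k.

Lemma bc_leftD (x y : LE) : bc_left f (x + y) = bc_left f x + bc_left f y.
Proof. by apply: bc_eqP => i; rewrite !(bc_left_row, bc_addE) rmorphD. Qed.

Lemma bc_left0 : bc_left f (0 : LE) = 0.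
Proof. by apply: bc_eqP => i; rewrite !(bc_left_row, bc_zeroE) rmorph0. Qed.

Lemma bc_leftZ c (x : LE) : bc_left f (c *: x) = f c *: bc_left f x.
Proof. by apply: bc_eqP => i; rewrite !(bc_left_row, bc_scaleE) rmorphM. Qed.

Lemma bc_leftM (x y : LE) : bc_left f (x * y) = bc_left f x * bc_left f y.
Proof.
elim/(@bc_ind _ _ iota L): x => [|x x' hx hx'|c a].
- by rewrite mul0r bc_left0 mul0r.
- by rewrite mulrDl !bc_leftD mulrDl hx hx'.
elim/(@bc_ind _ _ iota L): y => [|y y' hy hy'|c' b].
- by rewrite mulr0 bc_left0 mulr0.
- by rewrite mulrDr !bc_leftD mulrDr hy hy'.
by rewrite tensorM !bc_left_tensor // tensorM rmorphM.
Qed.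

Lemma bc_left1 : bc_left f (1 : LE) = 1.
Proof. by rewrite -tensor11 bc_left_tensor // rmorph1. Qed.

Lemma bc_left_sum I (r : seq I) (P : pred I) (g : I -> LE) :
  bc_left f (\sum_(i <- r | P i) g i) = \sum_(i <- r | P i) bc_left f (g i).
Proof. exact: (big_morph _ bc_leftD bc_left0). Qed.

Lemma bc_left_prod I (r : seq I) (P : pred I) (g : I -> LE) :
  bc_left f (\prod_(i <- r | P i) g i) = \prod_(i <- r | P i) bc_left f (g i).
Proof. exact: (big_morph _ bc_leftM bc_left1). Qed.

Lemma bc_left_unit (x : LE) : x \is a GRing.unit -> bc_left f x \is a GRing.unit.
Proof.
move=> ux; apply/unitrP; exists (bc_left f x^-1).
by rewrite -!bc_leftM mulVr ?mulrV // bc_left1.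
Qed.

Lemma bc_leftV (x : LE) : x \is a GRing.unit -> bc_left f x^-1 = (bc_left f x)^-1.
Proof.
move=> ux; apply: (mulrI (bc_left_unit ux)).
by rewrite -bc_leftM !mulrV ?bc_left1 ?bc_left_unit.
Qed.

Lemma alg_norm_basis (x : LE) : alg_norm x =
  \det (\matrix_(i < d, j < d) ((T 1 e`_i) * x) 0 j).
Proof.
apply: (@alg_normE _ _ _ (fun i : 'I_d => T 1 e`_i)).
- move=> c h i; have := congr1 (fun z : LE => z 0 i) h.
  rewrite bc_zeroE /= => <-; have -> : \sum_i c i *: T 1 e`_i = (\row_i c i : LE).
    by rewrite [RHS]bc_basis; apply: eq_bigr => j _; rewrite mxE.
  by rewrite mxE.
- by move=> a; exists (fun i => a 0 i); apply: bc_basis.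
by move=> i; rewrite {1}[_ * x]bc_basis; apply: eq_bigr => j _; rewrite mxE.
Qed.

(** As [f] fixes the basis [1 (x) e_i], applying it to the matrix of
    multiplication by [x] gives the matrix of multiplication by its image. *)
Lemma alg_norm_left (x : LE) : alg_norm (bc_left f x) = f (alg_norm x).
Proof.
rewrite !alg_norm_basis -det_map_mx; congr (\det _); apply/matrixP => i j.
rewrite !mxE -(bc_left_row f) bc_leftM bc_left_tensor // rmorph1; done.
Qed.

End Left.

Lemma alg_norm_tensor a : alg_norm (T 1 a) = iota (alg_norm a).
Proof.
rewrite alg_norm_basis -det_map_mx; congr (\det _); apply/matrixP => i j.
by rewrite !mxE tensorM !mulr1 tensorE mul1r.
Qed.

Section Right.
Variable g : {lrmorphism L -> L}.

Lemma bc_rightD (x y : LE) : bc_right g (x + y) = bc_right g x + bc_right g y.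
Proof.
rewrite /bc_right -big_split; apply: eq_bigr => i _ /=.
by rewrite bc_addE tensorDl.
Qed.

Lemma bc_right0 : bc_right g (0 : LE) = 0.
Proof. by rewrite /bc_right big1 // => i _; rewrite bc_zeroE tensor0l. Qed.

Lemma bc_rightZ c (x : LE) : bc_right g (c *: x) = c *: bc_right g x.
Proof.
rewrite /bc_right scaler_sumr; apply: eq_bigr => i _ /=.
by rewrite bc_scaleE scale_tensor.
Qed.

Lemma bc_rightM (x y : LE) : bc_right g (x * y) = bc_right g x * bc_right g y.
Proof.
elim/(@bc_ind _ _ iota L): x => [|x x' hx hx'|c a].
- by rewrite mul0r bc_right0 mul0r.
- by rewrite mulrDl !bc_rightD mulrDl hx hx'.
elim/(@bc_ind _ _ iota L): y => [|y y' hy hy'|c' b].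
- by rewrite mulr0 bc_right0 mulr0.
- by rewrite mulrDr !bc_rightD mulrDr hy hy'.
by rewrite tensorM !bc_right_tensor // tensorM rmorphM.
Qed.

Lemma bc_right1 : bc_right g (1 : LE) = 1.
Proof. by rewrite -tensor11 bc_right_tensor // rmorph1. Qed.

Lemma bc_left_right (f : {rmorphism E -> E}) (x : LE) :
  (forall k, f (iota k) = iota k) ->
  bc_left f (bc_right g x) = bc_right g (bc_left f x).
Proof.
move=> fK; elim/(@bc_ind _ _ iota L): x => [|x x' hx hx'|c a].
- by rewrite bc_right0 bc_left0 bc_right0.
- by rewrite !(bc_rightD, bc_leftD) hx hx'.
by rewrite bc_right_tensor !bc_left_tensor // bc_right_tensor.
Qed.

End Right.

(** Multiplication by [x] is an injective, hence bijective, linear map. *)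
Lemma regular_unit (x : LE) : (forall z, z * x = 0 -> z = 0) -> x \is a GRing.unit.
Proof.
move=> h; pose M := \matrix_(i < d, j < d) ((T 1 e`_i) * x) 0 j.
have Mx (c : 'rV[E]_d) : c *m M = ((c : LE) * x : LE).
  apply/rowP => j; rewrite mxE [c in RHS]bc_basis mulr_suml summxE.
  by apply: eq_bigr => i _; rewrite -scalerAl bc_scaleE mxE.
have Mu : M \in unitmx.
  rewrite -row_free_unit -kermx_eq0; apply/rowV0P => c /sub_kermxP.
  by rewrite Mx => /h.
apply/unitrP; exists (((1 : LE) : 'rV[E]_d) *m invmx M : LE).
suff h1 : (((1 : LE) : 'rV[E]_d) *m invmx M : LE) * x = 1 by rewrite h1 mulrC h1.
by rewrite -Mx mulmxKV.
Qed.

End BaseChangeActions.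

(** * Descent and Lang's theorem for [L_K] *)

Section LangBaseChange.

Variables (K : fieldType) (v : K -> int) (q : nat).
Hypothesis hK : local_field v q.
Let hv := local_valuation hK.
Variables (E : fieldType) (iota : {rmorphism K -> E}) (ve : E -> int).
Hypothesis hE : unr_complete v iota ve.
Variable sigma : {rmorphism E -> E}.
Hypothesis hsigma : frobenius q iota ve sigma.
Let hve := uc_val hE.
Variable L : fieldExtType K.

Local Notation LE := (base_change iota L).
Local Notation e := (vbasis (fullv : {vspace L})).
Local Notation d := (\dim (fullv : {vspace L})).
Local Notation T c a := (tensor iota c a : LE).
Local Notation sig := (rm_iter sigma).
Local Notation bsig n := (bc_left (rm_iter sigma n) : LE -> LE).

Let sK := frob_iota hsigma.
Let sigK n := frob_iter_iota hsigma n.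
Let sig_ge m n x : val_ge ve n x -> val_ge ve n (sig m x).
Proof. exact: (frob_iter_val_ge hK hE hsigma). Qed.

Lemma bsigS n (x : LE) : bsig n.+1 x = bc_left sigma (bsig n x).
Proof. by apply: bc_eqP => i; rewrite !bc_left_row. Qed.

Lemma bsig0 (x : LE) : bsig 0 x = x.
Proof. by apply: bc_eqP => i; rewrite !bc_left_row. Qed.

Lemma bsigD m n (x : LE) : bsig (m + n) x = bsig m (bsig n x).
Proof. by apply: bc_eqP => i; rewrite !bc_left_row rm_iterD. Qed.

Lemma bsig_fixed (x : LE) : bc_left sigma x = x -> exists l, x = T 1 l.
Proof.
move=> hx; have h i : exists k, x 0 i = iota k.
  by apply/(frob_fixed hsigma); rewrite -[in RHS]hx bc_left_row.
have [k hk] := choice h; exists (\sum_i k i *: e`_i).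
apply: bc_eqP => i; rewrite tensorE mul1r hk coord_sum_free //.
exact: basis_free (vbasisP _).
Qed.

(** Descent along [sigma]: a vector of minimal support in a stable subspace,
    normalized to have a coordinate equal to [1], is fixed by [sigma]. *)
Lemma stable_subspace_rational (P : LE -> Prop) (x : LE) :
  (forall x y, P x -> P y -> P (x - y)) -> (forall c x, P x -> P (c *: x)) ->
  (forall x, P x -> P (bc_left sigma x)) -> P x -> x != 0 ->
  exists2 l, l != 0 & P (T 1 l).
Proof.
move=> PB PZ Ps; have [n] := ubnP #|[set i | x 0 i != 0]|.
elim: n x => // n IH x; rewrite ltnS => xn Px x0.
have [i0 xi0] : exists i, x 0 i != 0.
  apply: contrapT => /forallNP h; case/eqP: x0; apply: bc_eqP => i.
  by rewrite bc_zeroE; apply/eqP; have := h i; case: eqP.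
pose y := (x 0 i0)^-1 *: x.
have Py : P y by apply: PZ.
have yi0 : y 0 i0 = 1 by rewrite bc_scaleE mulVf.
have y0 : y != 0.
  by apply/eqP => y0; move: yi0; rewrite y0 bc_zeroE => /eqP; rewrite eq_sym oner_eq0.
pose z := bc_left sigma y - y.
have Pz : P z by apply: PB => //; apply: Ps.
have [z0|z0] := eqVneq z 0.
  have [l el] := bsig_fixed (subr0_eq z0); exists l; last by rewrite -el.
  by apply: contraNneq y0 => l0; rewrite el l0 tensor0r.
apply: IH z0 => //; apply: leq_trans xn; apply: proper_card.
apply/properP; split.
  apply/fintype.subsetP => i; rewrite !inE; apply: contraNneq => xi.
  by rewrite bc_addE bc_oppE bc_left_row bc_scaleE xi mulr0 rmorph0 subrr.
exists i0; rewrite !inE // negbK.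
by rewrite bc_addE bc_oppE bc_left_row yi0 rmorph1 subrr.
Qed.

Lemma tensor1M a b : T 1 (a * b) = T 1 a * T 1 b.
Proof. by rewrite tensorM mulr1. Qed.

Lemma tensor1_unit l : l != 0 -> T 1 l \is a GRing.unit.
Proof.
move=> l0; apply/unitrP; exists (T 1 l^-1).
by rewrite -!tensor1M mulVf // mulfV.
Qed.

(** [L_K] has no nontrivial [sigma]-stable ideal, and the annihilator of a
    solution of [sigma y = x y] is such an ideal. *)
Lemma twisted_fixed_unit (x y : LE) : x \is a GRing.unit ->
  bc_left sigma y = x * y -> y != 0 -> y \is a GRing.unit.
Proof.
move=> ux hy y0; apply: regular_unit => z zy; apply: contrapT => /eqP z0.
have [|||l l0] := @stable_subspace_rational (fun a => a * y = 0) z _ _ _ zy z0.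
- by move=> a b ha hb; rewrite mulrBl ha hb subrr.
- by move=> c a ha; rewrite -scalerAl ha scaler0.
- move=> a ha; apply: (mulrI ux); rewrite mulrCA -hy -bc_leftM // ha.
  by rewrite bc_left0 mulr0.
move=> ly; case/eqP: y0; apply: (mulrI (tensor1_unit l0)).
by rewrite ly mulr0.
Qed.

Definition bge (n : int) (x : LE) : Prop := forall i, val_ge ve n (x 0 i).

Lemma bge_le m n x : m <= n -> bge n x -> bge m x.
Proof. by move=> mn h i; apply: val_ge_le mn (h i). Qed.
Lemma bgeD n x y : bge n x -> bge n y -> bge n (x + y).
Proof. by move=> hx hy i; rewrite bc_addE; apply: val_geD. Qed.
Lemma bgeB n x y : bge n x -> bge n y -> bge n (x - y).
Proof. by move=> hx hy i; rewrite bc_addE bc_oppE; apply: val_geB. Qed.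
Lemma bge_exists x : exists n : nat, bge (- n%:Z) x.
Proof. exact: (row_ge_exists ve (x : 'rV[E]_d)). Qed.
Lemma bge_sum n I (r : seq I) (P : pred I) (f : I -> LE) :
  (forall i, P i -> bge n (f i)) -> bge n (\sum_(i <- r | P i) f i).
Proof.
move=> h; elim/big_ind: _ => //; last by move=> x y; apply: bgeD.
by move=> i; rewrite bc_zeroE; apply: val_ge0.
Qed.
Lemma bge_forall_eq0 x : (forall n : nat, bge n%:Z x) -> x = 0.
Proof. exact: row_ge_forall_eq0. Qed.

Lemma bge_tensor n l : row_ge v n (coords l) -> bge n (T 1 l).
Proof.
move=> h i; rewrite tensorE mul1r; apply: (ext_val_ge (uc_ext hE)).
by have := h i; rewrite mxE.
Qed.

Lemma bgeM_bound : exists C : nat, forall m n x y,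
  bge m x -> bge n y -> bge (m + n - C%:Z) (x * y).
Proof.
pose f (ij : 'I_d * 'I_d) := sval (cid (bge_exists (T 1 (e`_ij.1 * e`_ij.2)))).
exists (\sum_ij f ij)%N => m n x y hx hy.
rewrite (bc_basis x) (bc_basis y) big_distrlr /=.
apply: bge_sum => i _; apply: bge_sum => j _ k.
rewrite -scalerAl -scalerAr scalerA -tensor1M bc_scaleE.
apply: (@val_ge_le _ _ _ (m + n + - (f (i, j))%:Z)).
  by rewrite (bigD1 (i, j)) //=; lia.
by apply: val_geM => //; [apply: val_geM|rewrite /f; case: cid => ? /=].
Qed.

Section SmallElements.

Variable C : nat.
Hypothesis hC : forall m n x y, bge m x -> bge n y -> bge (m + n - C%:Z) (x * y).

(** An element killed by [y] equals its product with [1 - y], so it is divisible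
    by all powers of the uniformizer. *)
Lemma close1_unit (y : LE) : bge C.+1%:Z (y - 1) -> y \is a GRing.unit.
Proof.
move=> hy; apply: regular_unit => z zy.
have ez : z = - (z * (y - 1)) by rewrite mulrBr zy mulr1 sub0r opprK.
have [n hn] := bge_exists z.
suff h k : bge (k%:Z - n%:Z) z.
  by apply: bge_forall_eq0 => k; apply: bge_le (h (k + n)%N); lia.
elim: k => [|k IH]; first by apply: bge_le hn; lia.
rewrite ez -[X in bge _ X]sub0r; apply: bgeB; first by move=> i; rewrite bc_zeroE; apply: val_ge0.
by apply: bge_le (hC IH hy); lia.
Qed.

Lemma close1_exp (x : LE) n : bge C.+1%:Z (x - 1) -> bge C.+1%:Z (x ^+ n - 1).
Proof.
move=> hx; elim: n => [|n IH].
  by rewrite expr0 subrr => i; rewrite bc_zeroE; apply: val_ge0.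
rewrite exprS (_ : _ - 1 = (x - 1) * (x ^+ n - 1) + (x - 1) + (x ^+ n - 1)); last by ring.
by do 2! apply: bgeD => //; apply: bge_le (hC hx IH); lia.
Qed.

Lemma bsig_sub_surj n c k : (0 < n)%N -> bge k c -> exists2 z, bge k z & bsig n z - z = c.
Proof.
move=> n0 hc; have h i : exists z, val_ge ve k z /\ sig n z - z = c 0 i.
  by have [z hz ez] := frob_sub_surj hK hE hsigma n0 (hc i); exists z.
have [z hz] := choice h; exists (\row_i z i : LE).
  by move=> i; rewrite mxE; have [] := hz i.
apply: bc_eqP => i; rewrite bc_addE bc_oppE bc_left_row.
by rewrite ![(\row_i z i : LE) 0 i]mxE; have [] := hz i.
Qed.

Lemma bsig_bge n k x : bge k x -> bge k (bsig n x).
Proof. by move=> h i; rewrite bc_left_row; apply: sig_ge. Qed.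

(** Near [1] the equation is linearized: [y = 1 + delta_0 + delta_1 + ...] where
    [sig n delta_0 - delta_0 = eps] and
    [sig n delta_(i+1) - delta_(i+1) = eps delta_i]. *)
Lemma lang_close1 n (x : LE) : (0 < n)%N -> bge C.+1%:Z (x - 1) ->
  exists2 y, y \is a GRing.unit & bsig n y = x * y.
Proof.
move=> n0 hx; set eps := x - 1 in hx.
have step (kc : int * LE) : exists z, bge kc.1 kc.2 ->
    bge kc.1 z /\ bsig n z - z = kc.2.
  have [h|h] := pselect (bge kc.1 kc.2); last by exists 0.
  by have [z hz ez] := bsig_sub_surj n0 h; exists z.
have [S hS] := choice step.
pose b := C.+1%:Z.
pose ds := fix ds i := if i is j.+1 then S (b + i%:Z, eps * ds j) else S (b, eps).
have hds i : bge (b + i%:Z) (ds i).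
  elim: i => [|i IH]; first by rewrite addr0; have [] := hS (b, eps) hx.
  apply: (proj1 (hS (b + i.+1%:Z, eps * ds i) _)).
  by apply: bge_le (hC hx IH); rewrite /b /=; lia.
have eds0 : bsig n (ds 0%N) - ds 0%N = eps by have [] := hS (b, eps) hx.
have edsS i : bsig n (ds i.+1) - ds i.+1 = eps * ds i.
  apply: (proj2 (hS (b + i.+1%:Z, eps * ds i) _)).
  by apply: bge_le (hC hx (hds i)); rewrite /b /=; lia.
have lim i := series_cvg hve (uc_complete hE) (fun m => hds m i).
have lim' i : exists l, forall m : nat, val_ge ve (b + m%:Z) (l - (\sum_(j < m) ds j : LE) 0 i).
  by have [l _ hl] := lim i; exists l => m; rewrite summxE.
have [l hl] := choice lim'; pose dl : LE := \row_i l i.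
have hdl m : bge (b + m%:Z) (dl - \sum_(j < m) ds j).
  by move=> i; rewrite bc_addE bc_oppE mxE; apply: hl.
exists (1 + dl).
  apply: close1_unit; rewrite addrAC subrr add0r.
  by have := hdl 0%N; rewrite big_ord0 !subr0.
apply/eqP; rewrite -subr_eq0; apply/eqP; apply: bge_forall_eq0 => m.
have part : bsig n (\sum_(j < m.+1) ds j) - \sum_(j < m.+1) ds j = eps * (1 + \sum_(j < m) ds j).
  elim: m => [|m IH]; first by rewrite big_ord0 addr0 mulr1 big_ord_recr big_ord0 /= add0r.
  rewrite big_ord_recr /= bc_leftD opprD addrACA IH edsS.
  by rewrite [in RHS]big_ord_recr /= addrA [in RHS]mulrDr.
pose r := dl - \sum_(j < m.+1) ds j.
have edl : dl = \sum_(j < m.+1) ds j + r by rewrite /r addrC subrK.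
have -> : bsig n (1 + dl) - x * (1 + dl) =
    bsig n r - r - eps * (ds m + r).
  rewrite bc_leftD (bc_left1 _ (sigK n)) (_ : x = 1 + eps); last by rewrite /eps addrC subrK.
  rewrite mulrDl mul1r {1 2}edl bc_leftD.
  have -> : eps * (1 + dl) = eps * (1 + \sum_(j < m) ds j) + eps * (ds m + r).
    by rewrite -mulrDr edl big_ord_recr /=; congr (_ * _); ring.
  rewrite -part; ring.
have hr : bge (b + m%:Z) r by apply: bge_le (hdl m.+1); lia.
have hdr : bge (b + m%:Z) (ds m + r) by apply: bgeD.
apply: bgeB; last by apply: bge_le (hC hx hdr); rewrite /b; lia.
have hmb : m%:Z <= b + m%:Z by rewrite /b; lia.
by apply: bgeB; apply: bge_le hmb _ => //; apply: bsig_bge.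
Qed.

End SmallElements.

End LangBaseChange.

Lemma twisted_quotient (A : comUnitRingType) (f : A -> A) (x x0 y y0 : A) :
  monoid_morphism f -> x \is a GRing.unit -> x0 \is a GRing.unit -> y \is a GRing.unit ->
  f y = x^-1 * x0 * y -> f y0 = x0 * y0 -> f (y0 / y) = x * (y0 / y).
Proof.
move=> [f1 fM] ux ux0 uy hy hy0.
have fyV : f y * f y^-1 = 1 by rewrite -fM divrr.
have ufy : f y \is a GRing.unit by apply/unitrP; exists (f y^-1); rewrite mulrC.
apply: (mulIr ufy); rewrite fM -mulrA [f y^-1 * _]mulrC fyV mulr1 hy0 hy.
transitivity ((x / x) * (y^-1 * y) * (x0 * y0)); last by ring.
by rewrite divrr // mulVr // !mul1r.
Qed.

Lemma addr_eqr (V : zmodType) (a b : V) : a + b = b -> a = 0.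
Proof. by move/(congr1 (fun z => z - b)); rewrite addrK subrr. Qed.

Section LangTheorem.

Variables (K : fieldType) (v : K -> int) (q : nat).
Hypothesis hK : local_field v q.
Let hv := local_valuation hK.
Variables (E : fieldType) (iota : {rmorphism K -> E}) (ve : E -> int).
Hypothesis hE : unr_complete v iota ve.
Variable sigma : {rmorphism E -> E}.
Hypothesis hsigma : frobenius q iota ve sigma.
Let hve := uc_val hE.
Variable L : fieldExtType K.

Local Notation LE := (base_change iota L).
Local Notation e := (vbasis (fullv : {vspace L})).
Local Notation d := (\dim (fullv : {vspace L})).
Local Notation T c a := (tensor iota c a : LE).
Local Notation sig := (rm_iter sigma).
Local Notation bsig n := (bc_left (rm_iter sigma n) : LE -> LE).

Let sK := frob_iota hsigma.
Let sigK n := frob_iter_iota hsigma n.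
Let sig_ge m n x : val_ge ve n x -> val_ge ve n (sig m x).
Proof. exact: (frob_iter_val_ge hK hE hsigma). Qed.

Local Notation bge := (@bge K E iota ve L).

Let ve_norm_left (x : LE) : x \is a GRing.unit ->
  ve (alg_norm (bc_left sigma x)) = ve (alg_norm x).
Proof.
by move=> ux; rewrite alg_norm_left // (frob_val hK hE hsigma) // alg_norm_unit.
Qed.

Let bs1 (x : LE) : bsig 1 x = bc_left sigma x.
Proof. by apply: bc_eqP => i; rewrite !bc_left_row. Qed.

Let bsM n (x y : LE) : bsig n (x * y) = bsig n x * bsig n y.
Proof. exact: (bc_leftM (sigK n)). Qed.

(** The period of the element given by [exists_zeta] is a multiple of the period
    [N] of its residue. *)
Lemma exact_period N : (0 < N)%N -> exists z t,
  [/\ (0 < t)%N, sig (t * N) z = z & forall i, (0 < i < t * N)%N -> sig i z != z].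
Proof.
move=> N0; have [z [hz iz zN zi]] := exists_zeta hK hve (uc_ext hE) (uc_embed hE) N0.
have exr : exists r, (0 < r)%N && (sig r z == z).
  by have [r r0 er] := unramified_elt_period hsigma hz; exists r; rewrite r0 er eqxx.
have [r /andP[r0 /eqP er] rmin] := ex_minnP exr.
have pow := frob_iter_power hK hE hsigma.
have zaN a : val_ge ve 1 (z ^+ (q ^ (a * N)) - z).
  elim: a => [|a IH]; first by rewrite mul0n expn0 expr1 subrr; apply: val_ge0.
  rewrite mulSn expnD exprM; apply: (val_ge_trans hve _ IH).
  by apply: val_ge_subX => //; apply: val_geX.
have hr : val_ge ve 1 (z ^+ (q ^ (r %% N)) - z).
  apply: (@val_ge_trans _ _ hve _ _ (z ^+ (q ^ r))).
    rewrite {2}(divn_eq r N) expnD exprM -opprB; apply: val_geN => //.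
    by apply: val_ge_subX => //; apply: val_geX.
  by rewrite -opprB; apply: val_geN => //; have := pow r z iz; rewrite er.
have rN : (N %| r)%N.
  case: (posnP (r %% N)) => [/eqP //|r1].
  by case: (zi (r %% N)%N); rewrite ?r1 ?ltn_pmod.
exists z, (r %/ N)%N; rewrite divnK //; split=> //.
  by rewrite divn_gt0 //; apply: dvdn_leq.
move=> i /andP[i0 ir]; apply: contraL ir => ei; rewrite -leqNgt.
by apply: rmin; rewrite i0.
Qed.

Let tensor1B a b' : T 1 (a - b') = T 1 a - T 1 b'.
Proof.
by apply/eqP; rewrite eq_sym subr_eq -tensorDr subrK.
Qed.

(** Lang's theorem. Up to an element close to [1], the element [x] is fixed by
    some [sigma^n]; its norm for [sigma^n] lies in [L] and is a unit there, so
    that a power of it is close to [1]. Hilbert 90 for the cyclic group generated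
    by [sigma] then gives a nonzero solution. *)
Lemma lang_base_change (x : LE) : x \is a GRing.unit -> ve (alg_norm x) = 0 ->
  exists2 y, y \is a GRing.unit & bc_left sigma y = x * y.
Proof.
move=> ux vx; have [C hC] := bgeM_bound hE L.
have [b hb] := bge_exists ve (x^-1).
(* x0 has coordinates in the maximal unramified extension *)
have [x0 hx0 x0x] : exists2 x0 : LE, (forall i, unramified_elt v iota (x0 0 i))
    & bge (b + C + C.+1)%N%:Z (x0 - x).
  have h i := uc_dense hE (x 0 i) (b + C + C.+1)%N%:Z.
  have h' i : exists y, unramified_elt v iota y /\ val_ge ve (b + C + C.+1)%N%:Z (x 0 i - y).
    by have [y h1 h2] := h i; exists y.
  have [y hy] := choice h'; exists (\row_i y i : LE) => [i|i].
    by rewrite mxE; have [] := hy i.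
  rewrite bc_addE bc_oppE [(\row__ _ : LE) 0 i]mxE -opprB; apply: val_geN => //.
  by have [] := hy i.
pose w := x^-1 * x0.
have w1 : bge C.+1%:Z (w - 1).
  rewrite /w -(mulVr ux) -mulrBr; apply: bge_le (hC _ _ _ _ hb x0x); lia.
have uw : w \is a GRing.unit := close1_unit hE hC w1.
have ux0 : x0 \is a GRing.unit by rewrite -(mulVKr ux x0) unitrM ux.
have [y1 uy1 ey1] := lang_close1 hK hE hsigma hC (ltn0Sn 0) w1.
rewrite bs1 in ey1.
have vw : ve (alg_norm w) = 0.
  have := ve_norm_left uy1; rewrite ey1 alg_normM.
  by rewrite (valM_ hve (alg_norm_unit uw) (alg_norm_unit uy1)) => /addr_eqr.
have vx0 : ve (alg_norm x0) = 0.
  rewrite -(mulVKr ux x0); apply: etrans (congr1 ve (alg_normM x w)) _.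
  apply: etrans (valM_ hve (alg_norm_unit ux) (alg_norm_unit uw)) _.
  exact: (congr2 +%R vx vw).
have [n n0 en] : exists2 n, (0 < n)%N & bsig n x0 = x0.
  have h i : exists m, (0 < m)%N /\ sig m (x0 0 i) = x0 0 i.
    by have [m m0 em] := unramified_elt_period hsigma (hx0 i); exists m.
  have [m hm] := choice h; exists (\prod_i m i)%N.
    by rewrite prodn_gt0 // => i; have [] := hm i.
  apply: bc_eqP => i; rewrite bc_left_row (bigD1 i) //= mulnC.
  by apply: rm_iter_per; have [] := hm i.
(* the partial norms of x0; the one of length n is fixed by sigma *)
pose Pr k : LE := \prod_(i < k) bsig i x0.
have PrS k : x0 * bc_left sigma (Pr k) = Pr k.+1.
  rewrite /Pr big_ord_recl bc_left_prod // /= bsig0; congr (_ * _).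
  by apply: eq_bigr => i _; rewrite bsigS.
have PrR k : Pr k.+1 = Pr k * bsig k x0 by rewrite /Pr big_ord_recr.
have PrD a k : Pr (a + k)%N = Pr a * bsig a (Pr k).
  elim: k => [|k IH]; first by rewrite addn0 /Pr big_ord0 (bc_left1 _ (sigK a)) mulr1.
  by rewrite addnS !PrR IH bsM bsigD mulrA.
have bs_unit i (t : LE) : t \is a GRing.unit -> bsig i t \is a GRing.unit.
  exact: (bc_left_unit (sigK i)).
have uPr k : Pr k \is a GRing.unit.
  by rewrite /Pr; elim/big_ind: _ => [|s t us ut|i _]; [exact: unitr1|rewrite unitrM us|exact: bs_unit].
have su : bc_left sigma (Pr n) = Pr n.
  apply: (mulrI ux0); by rewrite PrS PrR en mulrC.
have [l el] := bsig_fixed hsigma su.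
have l0 : l != 0.
  apply/eqP => l0; have := uPr n; rewrite el l0 tensor0r unitr0; done.
have vl : v (alg_norm l) = 0.
  have nl0 : alg_norm l != 0 by apply: alg_norm_unit; rewrite unitfE.
  rewrite -(uc_ext hE) // -alg_norm_tensor -el /Pr alg_norm_prod.
  have [|_ ->] := val_prodE hve (index_enum _) (fun i : 'I_n => (_ : alg_norm (bsig i x0) != 0)).
    by move=> i; apply: alg_norm_unit; apply: bs_unit.
  rewrite big1 => [//|i _].
  elim: (nat_of_ord i) => [|j IH]; first by rewrite bsig0; exact: vx0.
  by rewrite bsigS; exact: etrans (ve_norm_left (bs_unit j _ ux0)) IH.
have [m m0 hm] := unit_power_close hK l0 vl C.+1.
have um1 : bge C.+1%:Z (Pr n ^+ m - 1).
  have -> : Pr n ^+ m - 1 = T 1 (l ^+ m - 1).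
    rewrite tensor1B el; congr (_ - _).
    by elim: m {hm m0} => // m IH; rewrite !exprS tensor1M IH.
  exact: (bge_tensor hE).
have bsu i : bsig i (Pr n) = Pr n by elim: i => [|i IH]; rewrite ?bsig0 // bsigS IH su.
have Prn j : Pr (j * n)%N = Pr n ^+ j.
  elim: j => [|j IH]; first by rewrite mul0n /Pr big_ord0.
  by rewrite mulSn PrD IH exprS; congr (_ * _); elim: j {IH} => [|j IH];
    rewrite ?(bc_left1 _ (sigK n)) // !exprS bsM IH bsu.
have mn0 : (0 < m * n)%N by rewrite muln_gt0 m0.
have [z [t [t0 ez zmin]]] := exact_period mn0.
set r := (t * (m * n))%N in ez zmin.
have r0 : (0 < r)%N by rewrite muln_gt0 t0.
have Prr1 : bge C.+1%:Z (Pr r - 1).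
  by rewrite /r mulnA Prn [(t * m)%N]mulnC exprM; apply: (close1_exp hE hC).
have [dl udl edl] := lang_close1 hK hE hsigma hC r0 Prr1.
(* Q and Y form the twisted trace of Hilbert 90: Y c solves the equation for c
   fixed by sig r, because Q r = Q 0 *)
pose Q i := bsig i dl / Pr i.
have Q0 : Q 0%N = dl by rewrite /Q bsig0 /Pr big_ord0 divr1.
have Qr : Q r = dl by rewrite /Q edl mulrC (mulKr (uPr r)).
have sQ i : bc_left sigma (Q i) = x0 * Q i.+1.
  have uPi := bc_left_unit sK (uPr i).
  rewrite /Q (bc_leftM sK) (bc_leftV sK (uPr i)) -bsigS -PrS (invrM ux0 uPi).
  by rewrite mulrCA; congr (_ * _); rewrite mulrCA (mulrV ux0) mulr1.
pose Y c := \sum_(i < r) sig i c *: Q i.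
have sY c : sig r c = c -> bc_left sigma (Y c) = x0 * Y c.
  move=> ec; rewrite /Y bc_left_sum mulr_sumr.
  under eq_bigr => i _ do rewrite bc_leftZ sQ scalerAr -rm_iterS.
  rewrite -(big_mkord xpredT (fun i => x0 * (sig i.+1 c *: Q i.+1))).
  rewrite -(big_mkord xpredT (fun i => x0 * (sig i c *: Q i))).
  apply/eqP; rewrite -subr_eq0 -sumrB telescope_sumr //.
  by rewrite ec Q0 Qr subrr.
(* interpolation at the conjugates of z isolates the term of index 0 of Y *)
pose h := \prod_(j < r | (0 < j)%N) ('X - (sig j z)%:P).
have hz j : (0 < j < r)%N -> h.[sig j z] = 0.
  case/andP=> j0 jr; rewrite /h horner_prod (bigD1 (Ordinal jr)) //=.
  by rewrite hornerXsubC subrr mul0r.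
have hz0 : h.[z] != 0.
  rewrite /h horner_prod; apply/prodf_neq0 => j j0.
  by rewrite hornerXsubC subr_eq0 eq_sym; apply: zmin; rewrite j0 ltn_ord.
have sumY : \sum_(k < size h) h`_k *: Y (z ^+ k) = h.[z] *: dl.
  rewrite /Y; under eq_bigr do rewrite scaler_sumr.
  rewrite exchange_big /= (bigD1 (Ordinal r0)) //= [X in _ + X]big1 => [|j j0].
    rewrite addr0 Q0 horner_coef scaler_suml; apply: eq_bigr => k _.
    by rewrite scalerA.
  have jr : (0 < j < r)%N by rewrite ltn_ord andbT lt0n; apply: contra j0 => /eqP j0; apply/eqP/val_inj.
  transitivity (h.[sig j z] *: Q j); last by rewrite hz // scale0r.
  rewrite horner_coef scaler_suml.
  by apply: eq_bigr => k _; rewrite scalerA rmorphXn.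
have dl0 : dl != 0 by apply: contraTneq udl => ->; rewrite unitr0.
have [k Yk] : exists k : nat, Y (z ^+ k) != 0.
  apply: contrapT => /forallNP hk; have : h.[z] *: dl = 0.
    rewrite -sumY big1 // => k _; have := hk k => /negP; rewrite negbK => /eqP ->.
    by rewrite scaler0.
  by move/eqP; rewrite scaler_eq0 (negPf hz0) (negPf dl0).
have eY : bc_left sigma (Y (z ^+ k)) = x0 * Y (z ^+ k) by apply: sY; rewrite rmorphXn /= ez.
have uY := twisted_fixed_unit hsigma ux0 eY Yk.
exists (Y (z ^+ k) / y1); first by rewrite unitrM uY unitrV uy1.
exact: (twisted_quotient (conj (bc_left1 _ sK) (bc_leftM sK)) ux ux0 uy1 ey1 eY).
Qed.

End LangTheorem.

(** * Dimension counts *)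

Lemma dim_bijection (K : fieldType) (U V : vectType K) (f : U -> V) :
  linear f -> bijective f -> \dim {:U} = \dim {:V}.
Proof.
move=> fl fb; pose F : {linear U -> V} := HB.pack f (GRing.isLinear.Build K U V _ f fl).
have FE x : linfun F x = f x by rewrite lfunE.
have ker0 : lker (linfun F) == 0%VS.
  by apply/lker0P => x y; rewrite !FE; apply: bij_inj.
have -> : fullv = (linfun F @: fullv)%VS.
  apply/eqP; rewrite eqEsubv subvf andbT; apply/subvP => y _.
  have [g fK gK] := fb; rewrite -(gK y) -FE; apply: memv_img; exact: memvf.
by rewrite limg_dim_eq // (eqP ker0) capv0.
Qed.

Lemma dim_ffun (K : fieldType) (I : finType) (V : vectType K) :
  \dim {:{ffun I -> V}} = (#|I| * \dim {:V})%N.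
Proof. by rewrite !dimvf. Qed.

(** * Representing a cyclic algebra by matrices over its maximal subfield *)

Section CyclicAlgebra.

Variables (K : fieldType) (M : fieldExtType K) (phi : {lrmorphism M -> M}).
Variables (C : falgType K) (i : {lrmorphism M -> C}) (u : C) (b : K).
Local Notation n := (\dim {:M}).
Hypothesis b0 : b != 0.
Hypothesis un : u ^+ n = b%:A.
Hypothesis ui : forall x, u * i x = i (phi x) * u.
Hypothesis basisC : forall c, exists! x : {ffun 'I_n -> M},
  c = \sum_(k < n) i (x k) * u ^+ k.

Let n_gt0 : (0 < n)%N. Proof. exact: adim_gt0. Qed.

Lemma cyclic_unit : u \is a GRing.unit.
Proof.
have bu : (b%:A : C) \is a GRing.unit.
  by apply/unitrP; exists (b^-1)%:A; rewrite -!in_algE -!rmorphM mulVf // mulfV // rmorph1.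
rewrite -(unitrX_pos u n_gt0) un //.
Qed.

Lemma cyclic_uX k x : u ^+ k * i x = i (iter k phi x) * u ^+ k.
Proof.
elim: k => [|k IH]; first by rewrite expr0 mul1r mulr1.
by rewrite exprS -mulrA IH mulrA ui iterS -!mulrA -exprS.
Qed.

Lemma cyclic_order x : iter n phi x = x.
Proof.
have := cyclic_uX n x; rewrite un mulr_algl mulr_algr => e.
have /(congr1 (fun z => b^-1 *: z)) := e; rewrite !scalerA mulVf // !scale1r.
by move=> /fmorph_inj.
Qed.

Let psi k (x : M) := iter (k * n.-1) phi x.

Let psiK k x : iter k phi (psi k x) = x.
Proof.
rewrite /psi -iterD -mulnS prednK //.
elim: k => // k IH; by rewrite mulSn iterD IH cyclic_order.
Qed.

Let psiK' k x : psi k (iter k phi x) = x.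
Proof.
rewrite /psi -iterD addnC -mulnS prednK //.
elim: k => // k IH; by rewrite mulSn iterD IH cyclic_order.
Qed.

Let i_u k x : i x * u ^+ k = u ^+ k * i (psi k x).
Proof. by rewrite cyclic_uX psiK. Qed.

Lemma right_basis_ex c : exists x : 'cV[M]_n, c = \sum_(k < n) u ^+ k * i (x k 0).
Proof.
have [x [-> _]] := basisC c; exists (\col_k psi k (x k)).
by apply: eq_bigr => k _; rewrite i_u mxE.
Qed.

Lemma right_basis_inj (x y : 'cV[M]_n) :
  \sum_(k < n) u ^+ k * i (x k 0) = \sum_(k < n) u ^+ k * i (y k 0) -> x = y.
Proof.
move=> e; pose l (z : 'cV[M]_n) := [ffun k : 'I_n => iter k phi (z k 0)].
have el (z : 'cV[M]_n) : \sum_(k < n) u ^+ k * i (z k 0) = \sum_(k < n) i (l z k) * u ^+ k.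
  by apply: eq_bigr => k _; rewrite cyclic_uX ffunE.
have [a [ea ua]] := basisC (\sum_(k < n) u ^+ k * i (x k 0)).
have exy : l x = l y.
  by rewrite -(ua (l x)) ?el // -(ua (l y)) // e el.
apply/colP => k; have := congr1 (fun g : {ffun _} => psi k (g k)) exy.
by rewrite !ffunE !psiK'.
Qed.

Let rc c : 'cV[M]_n := sval (cid (right_basis_ex c)).
Let rcE c : c = \sum_(k < n) u ^+ k * i (rc c k 0).
Proof. exact: (svalP (cid (right_basis_ex c))). Qed.

(** The matrix of left multiplication by [c] in the basis [u^k] of [C] as a
    right vector space over [M]. *)
Definition lmx (c : C) : 'M[M]_n := \matrix_(k, j) rc (c * u ^+ j) k 0.

Lemma lmxP c (j : 'I_n) : c * u ^+ j = \sum_(k < n) u ^+ k * i (lmx c k j).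
Proof. by rewrite {1}[c * _]rcE; apply: eq_bigr => k _; rewrite mxE. Qed.

Lemma lmx_eq c (A : 'M[M]_n) :
  (forall j : 'I_n, c * u ^+ j = \sum_(k < n) u ^+ k * i (A k j)) -> lmx c = A.
Proof.
move=> h; apply/matrixP => k j.
have : col j (lmx c) = col j A.
  apply: right_basis_inj; under eq_bigr do rewrite mxE.
  under [RHS]eq_bigr do rewrite mxE.
  by rewrite -lmxP -h.
by move/colP/(_ k); rewrite !mxE.
Qed.

Lemma lmxB : zmod_morphism lmx.
Proof.
move=> x y; apply: lmx_eq => j; rewrite mulrBl !lmxP -sumrB.
by apply: eq_bigr => k _; rewrite !mxE rmorphB mulrBr.
Qed.

Lemma lmxM x y : lmx (x * y) = lmx x *m lmx y.
Proof.
apply: lmx_eq => j; rewrite -mulrA lmxP mulr_sumr.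
transitivity (\sum_(k < n) \sum_(l < n) u ^+ l * i (lmx x l k * lmx y k j)).
  apply: eq_bigr => k _; rewrite mulrA lmxP mulr_suml.
  by apply: eq_bigr => l _; rewrite rmorphM mulrA.
rewrite exchange_big; apply: eq_bigr => l _ /=.
by rewrite mxE rmorph_sum mulr_sumr.
Qed.

Lemma lmx_scalar a : lmx a%:A = (a%:A)%:M.
Proof.
apply: lmx_eq => j; rewrite (bigD1 j) //= big1 ?addr0 => [|k kj].
  by rewrite mxE eqxx mulr1n rmorph_alg mulr_algl mulr_algr.
by rewrite mxE (negPf kj) mulr0n rmorph0 mulr0.
Qed.

(** Conjugation by [u] fixes the basis [u^k] and acts on coefficients through
    [phi]. *)
Lemma lmx_conj c : map_mx phi (lmx c) = lmx (u * c / u).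
Proof.
symmetry; apply: lmx_eq => j.
have uj : u ^+ j / u = u^-1 * u ^+ j.
  exact/commrV/commr_sym/commrX/commr_refl.
rewrite -mulrA -uj mulrA -(mulrA u c) lmxP mulr_sumr mulr_suml.
apply: eq_bigr => k _; rewrite [map_mx _ _ _ _]mxE.
have -> : u * (u ^+ k * i (lmx c k j)) / u = u ^+ k * (u * i (lmx c k j) / u).
  by rewrite !mulrA -exprS exprSr.
by rewrite ui mulrK // cyclic_unit.
Qed.

Lemma dim_cyclic : \dim {:C} = (n * n)%N.
Proof.
pose f (x : {ffun 'I_n -> M}) : C := \sum_(k < n) i (x k) * u ^+ k.
have fl : linear f.
  move=> a x y; rewrite /f scaler_sumr -big_split; apply: eq_bigr => k _ /=.
  by rewrite !ffunE linearP mulrDl scalerAl.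
rewrite -(dim_bijection (f := f) fl); first by rewrite dim_ffun card_ord.
pose g c := sval (cid (basisC c)).
exists g => [x|c].
  by rewrite /g; case: cid => y [/= ey uy]; apply: uy.
by rewrite /g; case: cid => y [/= ey uy].
Qed.

End CyclicAlgebra.

(** * Cutting a representation of a matrix algebra down by an idempotent *)

Section OrthogonalIdempotents.

Variables (R : fieldType) (N : nat).
Implicit Types e f : 'M[R]_N.

Lemma rank_orthogonal e f : e *m e = e -> f *m f = f -> e *m f = 0 -> f *m e = 0 ->
  \rank (e + f)%R = (\rank e + \rank f)%N.
Proof.
move=> ee ff ef fe; have cap0 : (e :&: f)%MS = 0.
  apply/eqP; rewrite -submx0; apply/rV_subP => v.
  rewrite sub_capmx => /andP[/submxP[a ->] /submxP[b eb]].
  by rewrite -ee mulmxA eb -mulmxA fe mulmx0 sub0mx.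
apply/eqP; rewrite eqn_leq mxrank_add /= -mxrank_disjoint_sum //.
apply: mxrankS; rewrite addsmx_sub; apply/andP; split.
  by rewrite -{1}[e]addr0 -{1}ee -ef -mulmxDr submxMl.
by rewrite -{1}[f]add0r -{1}ff -fe -mulmxDr submxMl.
Qed.

Lemma rank_sum_orthogonal l (e : nat -> 'M[R]_N) :
  (forall i, (i < l)%N -> e i *m e i = e i) ->
  (forall i j, (i < l)%N -> (j < l)%N -> i != j -> e i *m e j = 0) ->
  \rank (\sum_(i < l) e i)%R = (\sum_(i < l) \rank (e i))%N.
Proof.
move=> ee ef.
pose S k := (\sum_(i < k) e i)%R.
suff H k : (k <= l)%N -> \rank (S k) = (\sum_(i < k) \rank (e i))%N /\ S k *m S k = S k.
  by have [] := H l (leqnn l).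
rewrite /S; elim: k => [|k IH] kl; first by rewrite !big_ord0 mxrank0 mul0mx.
have [IH1 IH2] := IH (ltnW kl); rewrite !big_ord_recr /=.
have h1 : (\sum_(i < k) e i) *m e k = 0.
  rewrite mulmx_suml big1 // => i _; apply: ef => //; first exact: ltn_trans kl.
  by rewrite neq_ltn ltn_ord.
have h2 : e k *m (\sum_(i < k) e i) = 0.
  rewrite mulmx_sumr big1 // => i _; apply: ef => //; first exact: ltn_trans kl.
  by rewrite neq_ltn ltn_ord orbT.
split; first by rewrite rank_orthogonal ?IH1 // ee.
by rewrite mulmxDl !mulmxDr IH2 h1 h2 ee // addr0 add0r.
Qed.

Lemma idempotent_factor e : e *m e = e ->
  exists D (P : 'M[R]_(N, D)) (Q : 'M[R]_(D, N)),
    [/\ \rank e = D, P *m Q = e & Q *m P = 1%:M].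
Proof.
move=> ee; exists (\rank e), (col_base e), (row_base e).
split=> //; first exact: mulmx_base.
have := mulmx_base e; have := row_base_free e; have := col_base_full e.
move: (col_base e) (row_base e) => P Q Pfull Qfree PQ.
apply: (row_full_inj Pfull); apply: (row_free_inj Qfree).
by rewrite /= mulmx1 !mulmxA PQ -mulmxA PQ ee.
Qed.

End OrthogonalIdempotents.

Section Corner.

Variables (R : fieldType) (phi : {rmorphism R -> R}) (B : nzRingType) (m N n : nat).
Variables (rho : 'M[B]_m.+1 -> 'M[R]_N) (g : 'M[R]_N) (b : R).
Hypothesis rhoB : zmod_morphism rho.
Hypothesis rhoM : forall X Y, rho (X * Y) = rho X *m rho Y.
Hypothesis rho1 : rho 1 = 1%:M.
Hypothesis hg : forall X, map_mx phi (rho X) *m g = g *m rho X.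
Hypothesis phig : map_mx phi g = g.
Hypothesis gn : iter n (mulmx g) 1%:M = b%:M.
Hypothesis phin : forall x, iter n phi x = x.
Hypothesis b0 : b != 0.
Hypothesis n_gt0 : (0 < n)%N.

Let rho0 : rho 0 = 0.
Proof. by have := rhoB 0 0; rewrite !subrr. Qed.

Let rhoD X Y : rho (X + Y) = rho X + rho Y.
Proof.
have rhoN Z : rho (- Z) = - rho Z by have := rhoB 0 Z; rewrite !sub0r rho0 sub0r.
by rewrite -[Y in LHS]opprK rhoB rhoN opprK.
Qed.

Let Eij (i j : 'I_m.+1) (x : B) : 'M[B]_m.+1 := \matrix_(k, l) (x *+ ((k == i) && (l == j))).

Let EM i j k x y : Eij i j x * Eij j k y = Eij i k (x * y).
Proof.
apply/matrixP => a c; rewrite !mxE (bigD1 j) //= big1 => [|l lj].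
  rewrite !mxE eqxx andbT addr0 /=.
  by case: (a == i); case: (c == k); rewrite ?mulr1n ?mulr0n ?mul0r ?mulr0.
by rewrite !mxE (negPf lj) andbF mulr0n mul0r.
Qed.

Let EM0 i j j' k x y : j != j' -> Eij i j x * Eij j' k y = 0.
Proof.
move=> jj; apply/matrixP => a c; rewrite !mxE big1 // => l _; rewrite !mxE.
case: (eqVneq l j) => [->|_]; last by rewrite andbF mulr0n mul0r.
by rewrite (negPf jj) mulr0n mulr0.
Qed.

Let ep := rho (Eij 0 0 1).
Let epep : ep *m ep = ep.
Proof. by rewrite -rhoM EM mulr1. Qed.
Section Factor.

Variables (D : nat) (P : 'M[R]_(N, D)) (Q : 'M[R]_(D, N)).
Hypotheses (rkD : \rank ep = D) (PQ : P *m Q = ep) (QP : Q *m P = 1%:M).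

Let r x := Q *m rho (Eij 0 0 x) *m P.
Let h := map_mx phi Q *m g *m P.

Let epE x : ep *m rho (Eij 0 0 x) = rho (Eij 0 0 x).
Proof. by rewrite -rhoM EM mul1r. Qed.
Let Eep x : rho (Eij 0 0 x) *m ep = rho (Eij 0 0 x).
Proof. by rewrite -rhoM EM mulr1. Qed.
Let epP : ep *m P = P.
Proof. by rewrite -PQ -mulmxA QP mulmx1. Qed.
Let Qep : Q *m ep = Q.
Proof. by rewrite -PQ mulmxA QP mul1mx. Qed.

Let gep : g *m ep = map_mx phi ep *m g. Proof. by rewrite hg. Qed.

Let PQ' : map_mx phi P *m map_mx phi Q = map_mx phi ep.
Proof. by rewrite -map_mxM PQ. Qed.
Let Eep' x : map_mx phi (rho (Eij 0 0 x)) *m map_mx phi ep = map_mx phi (rho (Eij 0 0 x)).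
Proof. by rewrite -map_mxM Eep. Qed.

Let gunit : g \in unitmx.
Proof.
have : iter n (mulmx g) 1%:M \in unitmx.
  by rewrite gn unitmxE det_scalar unitfE expf_neq0.
case: n n_gt0 => // k _; rewrite iterS unitmx_mul => /andP[] //.
Qed.

Let hunit : h \in unitmx.
Proof.
have e : h *m (Q *m invmx g *m map_mx phi P) = 1%:M.
  rewrite /h !mulmxA -(mulmxA _ P) PQ -(mulmxA _ g) gep !mulmxA.
  by rewrite mulmxK // -map_mxM Qep -map_mxM QP map_mx1.
by have [] := mulmx1_unit e.
Qed.

Let hr x : map_mx phi (r x) *m h = h *m r x.
Proof.
rewrite /r /h !map_mxM !mulmxA.
rewrite -(mulmxA _ (map_mx phi P) (map_mx phi Q)) PQ'.
rewrite -(mulmxA _ (map_mx phi (rho _)) (map_mx phi ep)) Eep'.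
rewrite -(mulmxA _ (map_mx phi (rho _)) g) hg.
rewrite -(mulmxA (map_mx phi Q *m g) P Q) PQ.
by rewrite -(mulmxA (map_mx phi Q *m g) ep) epE !mulmxA.
Qed.

(** The [n]th iterate of the semilinear operator attached to [h] is the
    restriction of that of the operator attached to [g], which is scalar. *)
Let hnorm : \prod_(i < n) iter i phi (\det h) = b ^+ D.
Proof.
pose gj j := iter j (mulmx g) 1%:M.
have gjS j : gj j.+1 = gj j *m g.
  by elim: j => [|j IH]; rewrite /gj /= ?mulmx1 ?mul1mx //; rewrite -/(gj j) -mulmxA -IH.
have gj0 : gj 0%N = 1%:M by [].
have gjn : gj n = b%:M by [].
clearbody gj.
have phigj j : map_mx phi (gj j) = gj j.
  elim: j => [|j IH]; first by rewrite gj0 map_mx1.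
  by rewrite gjS map_mxM IH phig.
pose H j := map_mx (iter j phi) Q *m gj j *m P.
have HS j : H j.+1 = map_mx phi (H j) *m h.
  rewrite /H /h !map_mxM phigj -map_mx_comp !mulmxA -(mulmxA _ (map_mx phi P) (map_mx phi Q)) PQ'.
  by rewrite -(mulmxA _ (map_mx phi ep) g) -gep gjS !mulmxA -(mulmxA _ ep) epP.
have detH j : \det (H j) = \prod_(i < j) iter i phi (\det h).
  elim: j => [|j IH].
    rewrite big_ord0 /H gj0 mulmx1 (_ : map_mx _ Q = Q) ?QP ?det1 //.
    by apply/matrixP => a c; rewrite mxE.
  rewrite HS det_mulmx det_map_mx IH big_ord_recl mulrC rmorph_prod; congr (_ * _).
rewrite -detH /H gjn (_ : map_mx _ Q = Q); last first.
  by apply/matrixP => a c; rewrite mxE phin.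
by rewrite mul_mx_scalar -scalemxAl QP scalemx1 det_scalar.
Qed.

(* the diagonal matrix units are conjugate, hence all of rank D *)
Let rankE i : \rank (rho (Eij i i 1)) = D.
Proof.
have aux j k : (\rank (rho (Eij j j 1)) <= \rank (rho (Eij k k 1)))%N.
  have -> : rho (Eij j j 1) = rho (Eij j k 1) *m rho (Eij k k 1) *m rho (Eij k j 1).
    by rewrite -!rhoM !EM !mulr1.
  by apply: leq_trans (mxrankM_maxl _ _) (mxrankM_maxr _ _).
by rewrite -rkD; apply/eqP; rewrite eqn_leq !aux.
Qed.

Let dimD : (D * m.+1)%N = N.
Proof.
pose e (i : nat) := rho (Eij (inord i) (inord i) 1).
have s1 : \sum_(i < m.+1) e i = 1%:M.
  rewrite -rho1 -(big_morph _ rhoD rho0); congr rho.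
  apply/matrixP => a c; rewrite summxE !mxE (bigD1 a) //= big1 => [|i ia].
    by rewrite mxE inord_val eqxx addr0 /= eq_sym.
  by rewrite mxE inord_val eq_sym (negPf ia) mulr0n.
have := @rank_sum_orthogonal _ _ m.+1 e; rewrite s1 mxrank1 => ->.
- have -> : (\sum_(i < m.+1) \rank (e i) = \sum_(i < m.+1) D)%N.
    by apply: eq_bigr => i _; apply: rankE.
  by rewrite sum_nat_const card_ord mulnC.
- by move=> i _; rewrite /e -rhoM EM mulr1.
move=> i j im jm ij; rewrite /e -rhoM EM0 ?rho0 //.
by apply: contra ij => /eqP /(congr1 val) /=; rewrite !inordK // => ->.
Qed.

Lemma corner_of_factor : exists D' (r' : B -> 'M[R]_D') (h' : 'M[R]_D'),
  [/\ (D' * m.+1)%N = N, zmod_morphism r', (forall x y, r' (x * y) = r' x *m r' y)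
    & (forall x c, rho x%:M = c%:M -> r' x = c%:M)] /\
  [/\ h' \in unitmx, (forall x, map_mx phi (r' x) *m h' = h' *m r' x)
    & \prod_(i < n) iter i phi (\det h') = b ^+ D'].
Proof.
exists D, r, h; split; split=> //.
- move=> x y; rewrite /r -mulmxBl -mulmxBr -rhoB; congr (_ *m rho _ *m _).
  by apply/matrixP => i j; rewrite !mxE mulrnBl.
- move=> x y; rewrite /r !mulmxA -(mulmxA _ P) PQ -(mulmxA _ _ ep) Eep.
  by rewrite -(mulmxA Q (rho (Eij 0 0 x))) -rhoM EM.
move=> x c e; rewrite /r.
have -> : Eij 0 0 x = x%:M * Eij 0 0 1.
  apply/matrixP => i j; rewrite -[_%:M * _]/(_%:M *m _) mul_scalar_mx !mxE.
  by case: (_ && _); rewrite ?mulr1n ?mulr0n ?mulr1 ?mulr0.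
by rewrite rhoM e mul_scalar_mx -scalemxAr -scalemxAl Qep QP scalemx1.
Qed.

End Factor.

(** The representation of [B] on the image of the idempotent [E_00], together
    with the semilinear operator induced there. *)
Lemma corner : exists D (r : B -> 'M[R]_D) (h : 'M[R]_D),
  [/\ (D * m.+1)%N = N, zmod_morphism r, (forall x y, r (x * y) = r x *m r y)
    & (forall x c, rho x%:M = c%:M -> r x = c%:M)] /\
  [/\ h \in unitmx, (forall x, map_mx phi (r x) *m h = h *m r x)
    & \prod_(i < n) iter i phi (\det h) = b ^+ D].
Proof.
have [D [P [Q [rkD PQ QP]]]] := idempotent_factor epep.
exact: corner_of_factor rkD PQ QP.
Qed.

End Corner.

(** * The isocrystal of an algebra with known invariant *)

Section BlockRepresentation.

Variables (C : nzRingType) (R : fieldType) (n : nat) (l : C -> 'M[R]_n) (kap : nat).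
Hypothesis lB : zmod_morphism l.
Hypothesis lM : forall x y, l (x * y) = l x *m l y.
Hypothesis l1 : l 1 = 1%:M.

Let l0 : l 0 = 0. Proof. by have := lB 0 0; rewrite !subrr. Qed.

Definition block_rep (X : 'M[C]_kap) : 'M[R]_(\sum_(i < kap) n) :=
  \mxblock_(i < kap, j < kap) l (X i j).

Lemma block_repB : zmod_morphism block_rep.
Proof.
move=> X Y; rewrite /block_rep -mxblockB; apply: eq_mxblock => i j.
by rewrite -lB !mxE.
Qed.

Lemma block_repM X Y : block_rep (X *m Y) = block_rep X *m block_rep Y.
Proof.
have lD x y : l (x + y) = l x + l y.
  have lN z : l (- z) = - l z by have := lB 0 z; rewrite !sub0r l0 sub0r.
  by rewrite -[y in LHS]opprK lB lN opprK.
rewrite /block_rep mul_mxblock; apply: eq_mxblock => i j.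
by rewrite mxE (big_morph l lD l0); apply: eq_bigr => k _; rewrite lM.
Qed.

Lemma block_rep_scalar x c : l x = c%:M -> block_rep x%:M = c%:M.
Proof.
move=> e; rewrite -mxdiagZ /block_rep /mxdiag; apply: eq_mxblock => i j.
rewrite !mxE; case: eqP => [_|_]; last by rewrite mulr0n l0.
by rewrite mulr1n conform_mx_id.
Qed.

Lemma map_block_rep (phi : R -> R) (X : 'M[C]_kap) (Y : 'M[C]_kap) :
  (forall i j, map_mx phi (l (X i j)) = l (Y i j)) ->
  map_mx phi (block_rep X) = block_rep Y.
Proof.
by move=> h; apply/matrixP => s t; rewrite !mxE -h mxE.
Qed.

End BlockRepresentation.

Lemma dim_brauer (K : fieldType) (A B : falgType K) m k
    (f : {rmorphism 'M[A]_m.+1 -> 'M[B]_k.+1}) : bijective f ->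
  (forall c : K, f (c%:A%:M) = c%:A%:M) ->
  (m.+1 * m.+1 * \dim {:A} = k.+1 * k.+1 * \dim {:B})%N.
Proof.
move=> fb fK.
pose U := {ffun 'I_m.+1 * 'I_m.+1 -> A}; pose V := {ffun 'I_k.+1 * 'I_k.+1 -> B}.
pose tomx (x : U) : 'M[A]_m.+1 := \matrix_(i, j) x (i, j).
pose F (x : U) : V := [ffun ij => f (tomx x) ij.1 ij.2].
have Fl : linear F.
  move=> c x y; apply/ffunP => -[i j]; rewrite !ffunE /=.
  have -> : tomx (c *: x + y) = c%:A%:M * tomx x + tomx y.
    apply/matrixP => a d; rewrite -[_%:M * _]/(_%:M *m _) mul_scalar_mx !mxE !ffunE.
    by rewrite mulr_algl.
  rewrite rmorphD rmorphM fK -[_%:M * _]/(_%:M *m _) mul_scalar_mx !mxE.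
  by rewrite mulr_algl.
have dU : \dim {:U} = (m.+1 * m.+1 * \dim {:A})%N by rewrite dim_ffun card_prod !card_ord.
have dV : \dim {:V} = (k.+1 * k.+1 * \dim {:B})%N by rewrite dim_ffun card_prod !card_ord.
rewrite -dU -dV; apply: (dim_bijection Fl).
have [g fg gf] := fb.
exists (fun y : V => [ffun ij => g (\matrix_(i, j) y (i, j)) ij.1 ij.2]) => [x|y].
  apply/ffunP => -[i j]; rewrite ffunE /=.
  rewrite (_ : \matrix_(i, j) _ = f (tomx x)); first by rewrite fg mxE.
  by apply/matrixP => a d; rewrite mxE ffunE.
apply/ffunP => -[i j]; rewrite ffunE /=.
rewrite (_ : tomx _ = g (\matrix_(i, j) y (i, j))); first by rewrite gf mxE.
by apply/matrixP => a d; rewrite mxE ffunE.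
Qed.

Section Isocrystal.

Variables (K : fieldType) (v : K -> int) (q : nat).
Hypothesis hK : local_field v q.
Let hv := local_valuation hK.
Variables (E : fieldType) (iota : {rmorphism K -> E}) (ve : E -> int).
Hypothesis hE : unr_complete v iota ve.
Variable sigma : {rmorphism E -> E}.
Hypothesis hsigma : frobenius q iota ve sigma.
Let hve := uc_val hE.

Local Notation sig := (rm_iter sigma).

(** Both morphisms reduce to the [q]th power map. Since the residue field of [M]
    is finite, every integral element is a [Q]th power modulo the maximal ideal,
    for [Q] a power of [q]; this lifts the congruence to all higher orders. *)
Lemma frob_compat (M : fieldExtType K) (w : M -> int) (phi : {lrmorphism M -> M})
    (f : {rmorphism M -> E}) : unramified v w -> residue_power w q phi ->
  embedding_over iota f -> forall x, sigma (f x) = f (phi x).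
Proof.
move=> hM hphi hf; have [hw wv] := hM; have [p p0 vp] := val_unif hv.
have fv : normalized_valuation (fun x : M => ve (f x)).
  split=> [x y x0 y0|x y n hx hy|]; first by rewrite rmorphM (valM_ hve) ?fmorph_eq0.
    have tr z : val_ge (fun x : M => ve (f x)) n z <-> val_ge ve n (f z).
      have [->|z0] := eqVneq z 0; first by rewrite rmorph0; split; left.
      by rewrite !val_geE ?fmorph_eq0.
    by apply/tr; rewrite rmorphD; apply: val_geD => //; apply/tr.
  exists p%:A; first by rewrite -in_algE fmorph_eq0.
  by rewrite hf (uc_ext hE).
have fext : val_extends (fun x : K => x%:A : M) v (fun x : M => ve (f x)).
  by move=> x x0; rewrite hf (uc_ext hE).
have wf x : x != 0 -> w x = ve (f x) := ext_valuation_unique hK hM fv fext (x := x).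
have w_ge n x : val_ge w n x <-> val_ge ve n (f x).
  have [->|x0] := eqVneq x 0; first by rewrite rmorph0; split; left.
  by rewrite !val_geE ?fmorph_eq0 // wf.
have pA0 : p%:A != 0 :> M by rewrite -in_algE fmorph_eq0.
have wp : w p%:A = 1 by rewrite wv.
have [N N0 hN] : exists2 N, (0 < N)%N & forall x, sig N (f x) = f x.
  pose e := vbasis {:M}.
  have h (i : 'I_(\dim {:M})) : exists m, (0 < m)%N /\ sig m (f e`_i) = f e`_i.
    have hel : unramified_elt v iota (f e`_i) by exists M, w, f, e`_i.
    have [m m0 hm] := unramified_elt_period hsigma hel.
    by exists m.
  have [m hm] := choice h; exists (\prod_i m i)%N.
    by rewrite prodn_gt0 // => i; have [] := hm i.
  move=> x; rewrite (coord_vbasis (memvf x)) !rmorph_sum; apply: eq_bigr => i _.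
  rewrite -mulr_algl !rmorphM /= hf (frob_iter_iota hsigma); congr (_ * _).
  by rewrite (bigD1 i) //= mulnC; apply: rm_iter_per; have [] := hm i.
pose Q := (q ^ N)%N.
have hQ x : val_ge w 0 x -> val_ge w 1 (x - x ^+ Q).
  move=> /w_ge ix; apply/w_ge; rewrite rmorphB rmorphXn -{1}hN.
  exact: (frob_iter_power hK hE hsigma).
have vQ : val_ge ve 1 (Q%:R : E).
  rewrite /Q -(prednK N0) expnS natrM; apply: val_geMr => //; first exact: (ve_q hK hE).
  exact: val_ge_natr.
have iphi x : val_ge w 0 x -> val_ge w 0 (phi x).
  move=> ix; rewrite -(subrK (x ^+ q) (phi x)); apply: val_geD => //.
    by apply: val_ge_le (hphi _ ix).
  exact: val_geX.
have key k x : val_ge w 0 x -> val_ge ve k.+1%:Z (sigma (f x) - f (phi x)).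
  elim: k x => [|k IH] x ix; have ifx : val_ge ve 0 (f x) by apply/w_ge.
    apply: (@val_ge_trans _ _ hve _ _ (f x ^+ q)); first exact: (frob_residue hsigma).
    rewrite -rmorphXn -rmorphB -w_ge -opprB; apply: val_geN => //; exact: hphi.
  pose x1 := (p%:A)^-1 * (x - x ^+ Q).
  have ix1 : val_ge w 0 x1.
    have : val_ge w (0 + 1) (p%:A ^ 1 * x1).
      by rewrite expr1z /x1 mulrA divff // mul1r add0r; apply: hQ.
    by move/(val_geZ hw _ _ _ pA0 wp).
  have ex : x = x ^+ Q + p%:A * x1.
    by rewrite /x1 mulrA divff // mul1r addrC subrK.
  have -> : sigma (f x) - f (phi x) =
      (sigma (f x) ^+ Q - f (phi x) ^+ Q) + iota p * (sigma (f x1) - f (phi x1)).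
    have phip : phi p%:A = p%:A by rewrite rmorph_alg.
    rewrite [in LHS]ex !rmorphD !rmorphXn !rmorphM /= phip hf /= (frob_iota hsigma).
    by ring.
  have [ip0 vip] := unif_iota hE p0 vp.
  apply: val_geD => //.
    rewrite (_ : k.+2%:Z = k.+1%:Z + 1); last by rewrite -addn1 PoszD.
    apply: val_ge_subX_small => //.
    + exact: (frob_val_ge hK hE hsigma).
    + by apply/w_ge/iphi.
    + exact: IH.
  rewrite (_ : k.+2%:Z = 1 + k.+1%:Z); last by rewrite -add1n PoszD.
  by apply: val_geM => //; [right; rewrite vip|apply: IH].
move=> x; have [m hm] : exists m : nat, val_ge w 0 (p%:A ^+ m * x).
  exists `|w x|%N; have [->|x0] := eqVneq x 0; first by left; rewrite mulr0.
  by right; rewrite (valM_ hw) ?expf_neq0 // valX // wp; lia.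
have e : sigma (f (p%:A ^+ m * x)) = f (phi (p%:A ^+ m * x)).
  apply/eqP; rewrite -subr_eq0; apply/eqP; apply: (@val_ge_forall_eq0 _ ve) => k.
  by apply: val_ge_le (key k _ hm); lia.
have phip : phi p%:A = p%:A by rewrite rmorph_alg.
move: e; rewrite !rmorphM !rmorphXn /= phip hf /= (frob_iota hsigma) => /mulfI; apply.
by rewrite expf_neq0 // fmorph_eq0.
Qed.

End Isocrystal.

Section InvariantIsocrystal.

Variables (K : fieldType) (v : K -> int) (q : nat).
Hypothesis hK : local_field v q.
Let hv := local_valuation hK.
Variables (E : fieldType) (iota : {rmorphism K -> E}) (ve : E -> int).
Hypothesis hE : unr_complete v iota ve.
Variable sigma : {rmorphism E -> E}.
Hypothesis hsigma : frobenius q iota ve sigma.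
Let hve := uc_val hE.

(** The cyclic algebra acts on itself, as a right vector space over its maximal
    subfield [M], and right multiplication by [u^-1] is a semilinear operator which
    commutes with this action. Both are transported to matrix algebras, then to [B]
    by means of the Brauer equivalence and of a primitive idempotent. After
    extension of scalars from [M] to [E] the operator becomes [h^-1 sigma]; its
    slope is determined by [u^n = p^k]. *)
Lemma invariant_isocrystal (B : falgType K) (r0 : rat) (d : nat) :
  \dim {:B} = (d * d)%N -> has_invariant v q B r0 ->
  exists (r : B -> 'M[E]_d) (h : 'M[E]_d) (z : int),
  [/\ zmod_morphism r, (forall x y, r (x * y) = r x *m r y)
    & (forall c, r c%:A = (iota c)%:M)] /\
  [/\ h \in unitmx, (forall x, map_mx sigma (r x) *m h = h *m r x)
    & r0 * d%:R = (ve (\det h))%:~R + d%:R * z%:~R].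
Proof.
move=> dimB [M [w [phi [p [k [C [[hM hphi] [p0 vp] [i [u [un ui bas]]] [m [kap [F [Fb FK]]]] hr]]]]]]].
have b0 : p ^+ k != 0 by rewrite expf_neq0.
set b := p ^+ k in un b0; set n := \dim {:M} in un bas hr.
have n0 : (0 < n)%N by apply: adim_gt0.
have [f hf] := uc_embed hE hM.
have fphi := frob_compat hK hE hsigma hM hphi hf.
have uu : u \is a GRing.unit := cyclic_unit b0 un.
pose l : C -> 'M[M]_n := lmx b0 un ui bas.
have lB : zmod_morphism l := lmxB b0 un ui bas.
have lM x y : l (x * y) = l x *m l y := lmxM b0 un ui bas x y.
have lS a : l a%:A = (a%:A)%:M := lmx_scalar b0 un ui bas a.
have lC x : map_mx phi (l x) = l (u * x / u) := lmx_conj b0 un ui bas x.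
clearbody l.
have l1 : l 1 = 1%:M by rewrite -(scale1r 1) lS scale1r.
pose N := (\sum_(j < kap.+1) n)%N.
pose br : 'M[C]_kap.+1 -> 'M[M]_N := @block_rep C M n l kap.+1.
have brB : zmod_morphism br := block_repB lB.
have brM X Y : br (X *m Y) = br X *m br Y by apply: block_repM.
have brS x c : l x = c%:M -> br x%:M = c%:M by apply: block_rep_scalar.
pose rho (X : 'M[B]_m.+1) := br (F X).
pose g := br u%:M.
have rhoB : zmod_morphism rho by move=> X Y; rewrite /rho rmorphB brB.
have rhoM X Y : rho (X * Y) = rho X *m rho Y by rewrite /rho rmorphM -brM.
have rho1 : rho 1 = 1%:M by rewrite /rho rmorph1; apply: brS.
have conj X : map_mx phi (br X) = br (u%:M *m X *m (u^-1)%:M).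
  apply: map_block_rep => a c; rewrite lC mul_scalar_mx; congr l.
  rewrite mxE (bigD1 c) //= big1 => [|e ec]; last by rewrite !mxE (negPf ec) mulr0n mulr0.
  by rewrite !mxE eqxx mulr1n addr0.
have hg X : map_mx phi (rho X) *m g = g *m rho X.
  by rewrite /rho conj -!brM -mulmxA -scalar_mxM mulVr // mulmx1.
have phig : map_mx phi g = g.
  by rewrite conj -!scalar_mxM mulrK.
have gj j : iter j (mulmx g) 1%:M = br (u ^+ j)%:M.
  elim: j => [|j IH]; first by rewrite expr0 (brS _ _ l1).
  by rewrite iterS IH -brM -scalar_mxM exprS.
have gn : iter n (mulmx g) 1%:M = (b%:A)%:M by rewrite gj un; apply: brS.
have phin x : iter n phi x = x by apply: cyclic_order b0 un ui x.
have bA0 : b%:A != 0 :> M by rewrite -in_algE fmorph_eq0.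
have [D [r' [h' [[dimN r'B r'M r'S] [h'u h'r h'n]]]]] :=
  corner rhoB rhoM rho1 hg phig gn phin bA0 n0.
have Dd : D = d.
  have NE : N = (kap.+1 * n)%N by rewrite /N sum_nat_const card_ord.
  have := dim_brauer Fb FK; rewrite dimB (dim_cyclic bas) -/n => e.
  have : ((d * m.+1) ^ 2 = (D * m.+1) ^ 2)%N by rewrite dimN NE; nia.
  by move/eqP; rewrite eqn_sqr eqn_pmul2r // => /eqP ->.
subst D.
have [z hz] := intrP hr.
exists (fun x => map_mx f (r' x)), (map_mx f h'), z; split; split.
- by move=> x y; rewrite r'B map_mxB.
- by move=> x y; rewrite r'M map_mxM.
- move=> c; have -> : r' c%:A = (c%:A)%:M.
    by apply: r'S; rewrite /rho FK; apply: brS.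
  by rewrite map_scalar_mx /= hf.
- by rewrite map_unitmx.
- move=> x; have -> : map_mx sigma (map_mx f (r' x)) = map_mx f (map_mx phi (r' x)).
    by apply/matrixP => a c; rewrite !mxE fphi.
  by rewrite -!map_mxM h'r.
rewrite det_map_mx; set V := ve _.
have hV : V * n%:Z = k%:Z * d%:Z.
  have fdet0 : f (\det h') != 0 by rewrite fmorph_eq0 -unitfE -unitmxE.
  have fi j x : f (iter j phi x) = iter j sigma (f x).
    by elim: j => // j IH; rewrite !iterS -fphi IH.
  have s0 (j : 'I_n) : iter j sigma (f (\det h')) != 0.
    by elim: (nat_of_ord j) => // j' IH; rewrite iterS fmorph_eq0.
  have := congr1 f h'n; rewrite rmorph_prod rmorphXn /= hf.
  under eq_bigr do rewrite fi.
  move/(congr1 ve); have [_ ->] := val_prodE hve (index_enum _) s0.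
  rewrite (eq_bigr (fun _ => V)) => [|j _]; last first.
    by elim: (nat_of_ord j) => // j' IH; rewrite iterS (frob_val hK hE hsigma) //;
      elim: j' {IH} => // j' IH; rewrite iterS fmorph_eq0.
  rewrite sumr_const card_ord -rmorphXn (uc_ext hE) ?expf_neq0 // /b -exprM valX // vp.
  by move=> e; rewrite -mulrzz -pmulrn e mul1r PoszM.
have n0' : n%:R != 0 :> rat by rewrite pnatr_eq0 -lt0n.
have hV' : V%:~R = k%:R * d%:R / n%:R :> rat.
  apply: (canRL (mulfK n0')); rewrite -[n%:R]/(n%:Z%:~R) -[k%:R]/(k%:Z%:~R) -[d%:R]/(d%:Z%:~R).
  by rewrite -!intrM hV.
have -> : r0 = k%:R / n%:R + z%:~R by rewrite -hz addrC subrK.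
by rewrite hV'; field.
Qed.

End InvariantIsocrystal.

(** * Cyclic vectors for [L_K] *)

Section CyclicVector.

Variables (K : fieldType) (q : nat).
Variables (E : fieldType) (iota : {rmorphism K -> E}) (ve : E -> int).
Variable sigma : {rmorphism E -> E}.
Hypothesis hsigma : frobenius q iota ve sigma.
Variable L : fieldExtType K.

Local Notation LE := (base_change iota L).
Local Notation e := (vbasis (fullv : {vspace L})).
Local Notation d := (\dim (fullv : {vspace L})).
Local Notation T c a := (tensor iota c a : LE).

Let sK := frob_iota hsigma.

(** The nilradical is a [sigma]-stable ideal. *)
Lemma base_change_reduced (x : LE) n : x ^+ n = 0 -> x = 0.
Proof.
move=> xn; apply: contrapT => /eqP x0.
have [|||l l0 [k hk]] := @stable_subspace_rational _ _ _ iota ve _ hsigma L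
  (fun y => exists k, y ^+ k = 0) x _ _ _ (ex_intro _ n xn) x0.
- move=> a b [k hk] [l hl]; exists (k + l)%N; rewrite exprBn big1 // => j _.
  have big (y : LE) m m' : (m <= m')%N -> y ^+ m = 0 -> y ^+ m' = 0.
    by move=> mm ym; rewrite -(subnK mm) exprD ym mulr0.
  case: (leqP l j) => lj; first by rewrite (big b l) // mulr0 mul0rn.
  by rewrite (big a k) ?mulr0 ?mul0r ?mul0rn //; lia.
- by move=> c a [k hk]; exists k; rewrite exprZn hk scaler0.
- move=> a [k hk]; exists k; have -> : bc_left sigma a ^+ k = bc_left sigma (a ^+ k).
    elim: k {hk} => [|k IH]; first by rewrite !expr0 bc_left1.
    by rewrite !exprS bc_leftM // IH.
  by rewrite hk bc_left0.
have := unitrX k (tensor1_unit iota l0); rewrite hk unitr0; done.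
Qed.

(** Multiplication by [a] is injective on its own image, since [a^2 z = 0] forces
    [(a z)^2 = 0]; hence [a] and [a^2] generate the same ideal. *)
Lemma von_neumann_regular (a : LE) : exists b, a = a * a * b.
Proof.
pose A := \matrix_(i < d, j < d) ((T 1 e`_i) * a) 0 j.
have AE (c : 'rV[E]_d) : c *m A = ((c : LE) * a : LE).
  apply/rowP => j; rewrite mxE [c in RHS]bc_basis mulr_suml summxE.
  by apply: eq_bigr => i _; rewrite -scalerAl bc_scaleE mxE.
have cap0 : (A :&: kermx A)%MS = 0.
  apply/eqP; rewrite -submx0; apply/rV_subP => y.
  rewrite sub_capmx => /andP[/submxP[z ->] /sub_kermxP].
  rewrite !AE => h.
  have : ((z : LE) * a) ^+ 2 = 0.
    have e0 : (z : LE) * a * a = 0 by exact: h.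
    rewrite (_ : _ ^+ 2 = (z : LE) * ((z : LE) * a * a)); last by ring.
    by rewrite e0 mulr0.
  by move/base_change_reduced => ->; exact: sub0mx.
have rk : \rank (A *m A) = \rank A.
  by have := mxrank_mul_ker A A; rewrite cap0 mxrank0 addn0.
have sub : (A <= A *m A)%MS.
  by rewrite -(mxrank_leqif_sup (submxMl A A)).2 rk.
have /submxP [b hb] : (((1 : LE) : 'rV[E]_d) *m A <= A *m A)%MS.
  by apply: submx_trans sub; apply: submxMl.
exists (b : LE); have {1}-> : a = (b : LE) * a * a; last by ring.
by move: hb; rewrite mulmxA !AE mul1r.
Qed.

Variables (ri : L -> 'M[E]_d) (h : 'M[E]_d).
Hypothesis riB : zmod_morphism ri.
Hypothesis riM : forall x y, ri (x * y) = ri x *m ri y.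
Hypothesis riS : forall c, ri c%:A = (iota c)%:M.
Hypothesis hu : h \in unitmx.
Hypothesis hri : forall x, map_mx sigma (ri x) *m h = h *m ri x.

Let ri0 : ri 0 = 0. Proof. by have := riB 0 0; rewrite !subrr. Qed.
Let riD x y : ri (x + y) = ri x + ri y.
Proof.
have riN z : ri (- z) = - ri z by have := riB 0 z; rewrite !sub0r ri0 sub0r.
by rewrite -[y in LHS]opprK riB riN opprK.
Qed.
Let ri1 : ri 1 = 1%:M. Proof. by rewrite -(scale1r 1) riS rmorph1. Qed.
Let riZ c x : ri (c *: x) = iota c *: ri x.
Proof. by rewrite -mulr_algl riM riS mul_scalar_mx. Qed.

(** The action of [L_K] extending that of [L]. *)
Definition bc_act (x : LE) : 'M[E]_d := \sum_(i < d) x 0 i *: ri e`_i.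
Local Notation R := bc_act.

Lemma bc_actT c a : R (T c a) = c *: ri a.
Proof.
rewrite {2}(coord_vbasis (memvf a)) (big_morph ri riD ri0) scaler_sumr.
by apply: eq_bigr => i _; rewrite tensorE riZ scalerA.
Qed.

Lemma bc_actD x y : R (x + y) = R x + R y.
Proof.
by rewrite /R -big_split; apply: eq_bigr => i _; rewrite bc_addE scalerDl.
Qed.

Lemma bc_act0 : R 0 = 0.
Proof. by rewrite /R big1 // => i _; rewrite bc_zeroE scale0r. Qed.

Lemma bc_actZ c x : R (c *: x) = c *: R x.
Proof.
by rewrite /R scaler_sumr; apply: eq_bigr => i _; rewrite bc_scaleE scalerA.
Qed.

Lemma bc_actB x y : R (x - y) = R x - R y.
Proof. by rewrite -scaleN1r bc_actD bc_actZ scaleN1r. Qed.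

Lemma bc_actM x y : R (x * y) = R x *m R y.
Proof.
elim/(@bc_ind _ _ iota L): x => [|x x' hx hx'|c a].
- by rewrite mul0r bc_act0 mul0mx.
- by rewrite mulrDl !bc_actD mulmxDl hx hx'.
elim/(@bc_ind _ _ iota L): y => [|y y' hy hy'|c' b].
- by rewrite mulr0 bc_act0 mulmx0.
- by rewrite mulrDr !bc_actD mulmxDr hy hy'.
by rewrite tensorM !bc_actT riM -scalemxAl -scalemxAr scalerA.
Qed.

Lemma bc_act_frob x : map_mx sigma (R x) *m h = h *m R (bc_left sigma x).
Proof.
elim/(@bc_ind _ _ iota L): x => [|x x' hx hx'|c a].
- by rewrite bc_left0 bc_act0 map_mx0 mul0mx mulmx0.
- by rewrite bc_leftD !bc_actD map_mxD mulmxDl mulmxDr hx hx'.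
by rewrite bc_left_tensor // !bc_actT map_mxZ -scalemxAl hri scalemxAr.
Qed.

Lemma bc_act_inj x : R x = 0 -> x = 0.
Proof.
move=> Rx; apply: contrapT => /eqP x0.
have [|||l l0] := @stable_subspace_rational _ _ _ iota ve _ hsigma L
  (fun y => R y = 0) x _ _ _ Rx x0.
- by move=> a b ha hb; rewrite bc_actB ha hb subrr.
- by move=> c a ha; rewrite bc_actZ ha scaler0.
- move=> a ha; have := bc_act_frob a; rewrite ha map_mx0 mul0mx => /esym e0.
  by rewrite -(mulKmx hu (R _)) e0 mulmx0.
rewrite bc_actT scale1r => rl.
have : ri (l * l^-1) = 0 by rewrite riM rl mul0mx.
rewrite mulfV // ri1 => /matrixP.
have d0 : (0 < d)%N by apply: adim_gt0.
by move/(_ (Ordinal d0) (Ordinal d0))/eqP; rewrite !mxE eqxx oner_eq0.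
Qed.

Definition orbit_mx (y : 'cV[E]_d) : 'M[E]_d := \matrix_(i, j) (ri e`_i *m y) j 0.

Lemma orbit_mxE y (c : 'rV[E]_d) : (c *m orbit_mx y)^T = R c *m y.
Proof.
apply/colP => j; rewrite [LHS]mxE [LHS]mxE /R mulmx_suml summxE.
by apply: eq_bigr => i _; rewrite -scalemxAl mxE [in RHS]mxE.
Qed.

Lemma orbit_ker y (c : 'rV[E]_d) : (c <= kermx (orbit_mx y))%MS <-> R c *m y = 0.
Proof.
rewrite -orbit_mxE; split=> [/sub_kermxP -> |]; first by rewrite trmx0.
by move=> /(congr1 trmx); rewrite trmxK trmx0 => /sub_kermxP.
Qed.

(** A vector with a nonzero annihilator can be modified so as to have a smaller
    one: the annihilator contains an idempotent, and one adds a vector on which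
    this idempotent acts nontrivially. *)
Lemma cyclic_vector : exists y, orbit_mx y \in unitmx.
Proof.
suff [y hy] : exists y, kermx (orbit_mx y) == 0.
  by exists y; rewrite -row_free_unit -kermx_eq0.
pose k0 := \rank (kermx (orbit_mx 0)).
have : exists2 y, (\rank (kermx (orbit_mx y)) <= k0)%N & True by exists 0.
elim: k0 => [|k IH] [y hy _].
  by exists y; rewrite -mxrank_eq0 -leqn0.
have [y0|] := eqVneq (kermx (orbit_mx y)) 0; first by exists y; rewrite y0.
move/rowV0Pn => [a /orbit_ker Ra a0]; have [b hb] := von_neumann_regular a.
pose ep : LE := (a : LE) * b.
have aep : (a : LE) * ep = a by rewrite /ep mulrA -hb.
have epep : ep * ep = ep by rewrite {1}/ep mulrAC aep.
have ep0 : ep != 0.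
  by apply: contraNneq a0 => e0; rewrite -[a]/(a : LE) -aep e0 mulr0.
have Rep : R ep *m y = 0 by rewrite /ep mulrC bc_actM -mulmxA Ra mulmx0.
have [z hz] : exists z : 'cV[E]_d, R ep *m z != 0.
  apply: contrapT => /forallNP hz; case/eqP: ep0; apply: bc_act_inj.
  apply/matrixP => i j; have /negP := hz (delta_mx j 0); rewrite negbK => /eqP.
  by rewrite -colE => /colP/(_ i); rewrite !mxE.
apply: IH; exists (y + R ep *m z) => //.
rewrite -ltnS; apply: leq_trans hy; apply: rank_ltmx.
rewrite ltmxE; apply/andP; split.
  apply/rV_subP => c /orbit_ker; rewrite mulmxDr mulmxA -bc_actM => hc.
  apply/orbit_ker; have : R ep *m (R c *m y + R ((c : LE) * ep) *m z) = 0 by rewrite hc mulmx0.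
  rewrite mulmxDr !mulmxA -!bc_actM.
  have -> : ep * (c : LE) = (c : LE) * ep by rewrite mulrC.
  have -> : ep * ((c : LE) * ep) = (c : LE) * ep by rewrite mulrCA epep.
  rewrite {1}bc_actM -mulmxA Rep mulmx0 add0r => hz0.
  by move: hc; rewrite hz0 addr0.
apply: contra hz => /rV_subP /(_ (ep : 'rV[E]_d)).
have -> : ((ep : 'rV[E]_d) <= kermx (orbit_mx y))%MS by apply/orbit_ker.
move=> /(_ isT) /orbit_ker; rewrite mulmxDr Rep add0r mulmxA -bc_actM epep.
by move=> ->.
Qed.

End CyclicVector.

(** * From the isocrystal to the cocycle *)

Lemma alg_norm_neq0_unit (F E : fieldType) (iota : {rmorphism F -> E})
  (L : fieldExtType F) (x : base_change iota L) : alg_norm x != 0 -> x \is a GRing.unit.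
Proof.
move=> nx; apply: regular_unit => z zx.
pose A := \matrix_(i < \dim {:L}, j < \dim {:L}) (tensor iota 1 (vbasis {:L})`_i * x) 0 j.
have Au : A \in unitmx by rewrite unitmxE unitfE -alg_norm_basis.
have zA : (z : 'rV_(\dim {:L})) *m A = 0.
  apply/rowP => j; have := congr1 (fun y : base_change iota L => y 0 j) zx.
  rewrite [in X in X -> _]/= {1}(bc_basis z) mulr_suml bc_zeroE summxE => <-.
  rewrite mxE.
  by apply: eq_bigr => i _; rewrite -scalerAl bc_scaleE mxE.
by rewrite -[z](mulmxK Au) zA mul0mx.
Qed.

Section IsocrystalCocycle.

Variables (K : fieldType) (q : nat).
Variables (E : fieldType) (iota : {rmorphism K -> E}) (ve : E -> int).
Hypothesis hve : normalized_valuation ve.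
Variable sigma : {rmorphism E -> E}.
Hypothesis hsigma : frobenius q iota ve sigma.
Hypothesis sigma_val : forall x, x != 0 -> ve (sigma x) = ve x.
Variable L : splittingFieldType K.

Local Notation LE := (base_change iota L).
Local Notation e := (vbasis (fullv : {vspace L})).
Local Notation d := (\dim (fullv : {vspace L})).
Local Notation T c a := (tensor iota c a : LE).
Local Notation G := (gal_of {:L}).

Variables (a : G -> G -> L) (B : falgType K) (i : {lrmorphism L -> B}) (u : G -> B).
Hypothesis aneq0 : forall s t, a s t != 0.
Hypothesis anorm : normalized_cochain2 a.
Hypothesis uM : forall s t : G, u s * u t = i (a s t) * u (gcomp s t).
Hypothesis ui : forall (s : G) (x : L), u s * i x = i (s x) * u s.
Hypothesis basisB : forall b, exists! x : {ffun G -> L}, b = \sum_(s : G) i (x s) * u s.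

Lemma crossed_u1 : u 1%g = 1.
Proof.
have [x [ex _]] := basisB 1.
rewrite -[LHS]mulr1 [in LHS]ex mulr_sumr [RHS]ex; apply: eq_bigr => s _.
by rewrite mulrA ui gal_id -mulrA uM (anorm s).1 rmorph1 mul1r /gcomp mulg1.
Qed.

Lemma dim_crossed : \dim {:B} = (#|{: G}| * d)%N.
Proof.
pose f (x : {ffun G -> L}) : B := \sum_(s : G) i (x s) * u s.
have fl : linear f.
  move=> c x y; rewrite /f scaler_sumr -big_split; apply: eq_bigr => s _ /=.
  by rewrite !ffunE linearP mulrDl scalerAl.
rewrite -(dim_bijection (f := f) fl); first by rewrite dim_ffun.
pose g c := sval (cid (basisB c)).
exists g => [x|c].
  by rewrite /g; case: cid => y [/= ey uy]; apply: uy.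
by rewrite /g; case: cid => y [/= ey uy].
Qed.

Variables (r : B -> 'M[E]_d) (h : 'M[E]_d).
Hypothesis rB : zmod_morphism r.
Hypothesis rM : forall x y, r (x * y) = r x *m r y.
Hypothesis rS : forall c, r c%:A = (iota c)%:M.
Hypothesis hu : h \in unitmx.
Hypothesis hr : forall x, map_mx sigma (r x) *m h = h *m r x.

(** If [y] generates [E^d] over [L_K], the action of the [u s] and of the
    semilinear operator on [y] is given by elements [beta s] and [gamma] of
    [L_K]; the commutation rules become the cocycle relations. *)
Lemma isocrystal_cocycle : exists (gamma : LE) (beta : G -> LE),
  [/\ gamma \is a GRing.unit, forall s, beta s \is a GRing.unit,
      forall s t, T 1 (a s t) * beta (gcomp s t) = bc_right s (beta t) * beta s,
      forall s, bc_left sigma (beta s) * gamma = bc_right s gamma * beta s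
    & ve (alg_norm gamma) = - ve (\det h)].
Proof.
have sK := frob_iota hsigma.
pose ri x := r (i x).
have riB : zmod_morphism ri by move=> x y; rewrite /ri rmorphB rB.
have riM x y : ri (x * y) = ri x *m ri y by rewrite /ri rmorphM rM.
have riS c : ri c%:A = (iota c)%:M by rewrite /ri rmorph_alg rS.
have hri x : map_mx sigma (ri x) *m h = h *m ri x by apply: hr.
pose R (x : LE) := bc_act ri x.
have RM x y : R (x * y) = R x *m R y := bc_actM riB riM riS x y.
have RT c x : R (T c x) = c *: ri x := bc_actT riB riM riS c x.
have RD x y : R (x + y) = R x + R y := bc_actD ri x y.
have R0 : R 0 = 0 by exact: bc_act0.
have RF x : map_mx sigma (R x) *m h = h *m R (bc_left sigma x).
  exact: (bc_act_frob hsigma).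
have [y Yu] := cyclic_vector hsigma riB riM riS hu hri.
set Y := orbit_mx ri y in Yu.
have YE (c : LE) : ((c : 'rV[E]_d) *m Y)^T = R c *m y by exact: orbit_mxE.
have gen (w : 'cV[E]_d) : exists c : LE, R c *m y = w.
  by exists (w^T *m invmx Y); rewrite -YE mulmxKV // trmxK.
have inj (c c' : LE) : R c *m y = R c' *m y -> c = c'.
  rewrite -!YE => /trmx_inj /(congr1 (fun z => z *m invmx Y)).
  by rewrite !mulmxK.
have [gamma hgamma] := gen (invmx h *m map_mx sigma y).
have [beta hbeta] := choice (fun s => gen (r (u s) *m y)).
have uR s x : r (u s) *m R x = R (bc_right s x) *m r (u s).
  elim/(@bc_ind _ _ iota L): x => [|x x' hx hx'|c x].
  - by rewrite bc_right0 R0 mulmx0 mul0mx.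
  - by rewrite bc_rightD !RD mulmxDl mulmxDr hx hx'.
  by rewrite bc_right_tensor !RT -scalemxAr -scalemxAl /ri -!rM ui.
have ihS A : map_mx sigma A *m h = h *m A -> invmx h *m map_mx sigma A = A *m invmx h.
  by move=> e; rewrite -[map_mx sigma A](mulmxK hu) e mulmxA mulKmx.
have bcoc s t : T 1 (a s t) * beta (gcomp s t) = bc_right s (beta t) * beta s.
  apply: inj; rewrite !RM -!mulmxA !hbeta RT scale1r mulmxA -rM -uM rM.
  by rewrite mulmxA -uR -!mulmxA hbeta.
have b1 : beta 1%g = 1.
  apply: inj; rewrite hbeta crossed_u1 -tensor11 RT scale1r /ri rmorph1 //.
have bunit s : beta s \is a GRing.unit.
  have := bcoc s s^-1%g; rewrite /gcomp mulVg b1 mulr1 => eb.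
  have := tensor1_unit iota (aneq0 s s^-1%g); rewrite eb unitrM => /andP[] //.
have bgam s : bc_left sigma (beta s) * gamma = bc_right s gamma * beta s.
  apply: inj; rewrite !RM -!mulmxA hgamma hbeta.
  have e1 : R (bc_left sigma (beta s)) *m invmx h = invmx h *m map_mx sigma (R (beta s)).
    by rewrite -[map_mx sigma _](mulmxK hu) RF mulmxA mulKmx.
  rewrite mulmxA e1 -mulmxA -map_mxM hbeta map_mxM mulmxA ihS //.
  by rewrite -mulmxA -hgamma mulmxA uR -mulmxA.
pose Gm := \matrix_(k < d, j < d) ((T 1 e`_k) * gamma) 0 j.
have YG : map_mx sigma Y *m (invmx h)^T = Gm *m Y.
  apply/row_matrixP => k; rewrite !row_mul.
  have -> : row k Gm = ((T 1 e`_k * gamma : LE) : 'rV[E]_d).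
    by apply/rowP => j; rewrite !mxE.
  apply: trmx_inj; rewrite YE RM -mulmxA hgamma RT scale1r.
  have -> : row k (map_mx sigma Y) = (map_mx sigma (ri e`_k *m y))^T.
    by apply/rowP => j; rewrite mxE [LHS]mxE [RHS]mxE [RHS]mxE [in LHS]mxE.
  by rewrite -trmx_mul trmxK map_mxM !mulmxA ihS.
have dY0 : \det Y != 0 by rewrite -unitfE -unitmxE.
have dh0 : \det h != 0 by rewrite -unitfE -unitmxE.
have eN : sigma (\det Y) / \det h = alg_norm gamma * \det Y.
  have := congr1 determinant YG; rewrite !det_mulmx det_tr det_map_mx det_inv => ->.
  by rewrite alg_norm_basis.
have N0 : alg_norm gamma != 0.
  apply: contra_eq_neq eN => ->; rewrite mul0r mulf_neq0 ?invr_eq0 // fmorph_eq0 //.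
exists gamma, beta; split=> //; first exact: alg_norm_neq0_unit.
have := congr1 ve eN; rewrite !(valM_ hve) ?invr_eq0 ?fmorph_eq0 // valV // sigma_val //.
by move=> e1; lia.
Qed.

End IsocrystalCocycle.

(** * The norm as a product of conjugates *)

Section GaloisNorm.

Variables (K : fieldType) (E : fieldType) (iota : {rmorphism K -> E}).
Variable L : splittingFieldType K.
Hypothesis hL : galois 1%AS {:L}%AS.

Local Notation LE := (base_change iota L).
Local Notation e := (vbasis (fullv : {vspace L})).
Local Notation d := (\dim (fullv : {vspace L})).
Local Notation T c a := (tensor iota c a : LE).
Local Notation G := (gal_of {:L}).

Lemma card_gal : #|{: G}| = d.
Proof.
have := galois_dim hL; rewrite dimv1 divn1 => ->.
rewrite -cardsT; apply: eq_card => s; rewrite !inE gal_kHom ?sub1v //.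
by rewrite k1HomE ahomWin.
Qed.

Let tensor1_zmod : zmod_morphism (fun a : L => T 1 a).
Proof. by move=> a b; apply/eqP; rewrite eq_sym subr_eq -tensorDr subrK. Qed.
Let tensor1_monoid : monoid_morphism (fun a : L => T 1 a).
Proof. by split=> // a b; rewrite tensorM mulr1. Qed.

Let tens1 (a : L) : LE := T 1 a.
HB.instance Definition _ := GRing.isZmodMorphism.Build L LE tens1 tensor1_zmod.
HB.instance Definition _ := GRing.isMonoidMorphism.Build L LE tens1 tensor1_monoid.

(** The matrix of the conjugates of a basis, invertible by the independence of
    characters, diagonalizes multiplication by [x]. *)
Lemma bc_norm_prod (x : LE) : T (alg_norm x) 1 = \prod_(t : G) bc_right t x.
Proof.
pose g := #|{: G}|; pose t_ (j : 'I_g) : G := enum_val j.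
pose A : 'M[L]_(d, g) := \matrix_(i, j) t_ j e`_i.
have gd : g = d := card_gal.
have Afull : \rank A = g.
  rewrite -mxrank_tr; apply/eqP; rewrite -[_ == _]/(row_free A^T) -kermx_eq0.
  apply/rowV0P => c /sub_kermxP cA; apply/rowP => j; rewrite [RHS]mxE.
  pose c_ (t : G) := c 0 (enum_rank t).
  have indep : forall y : L, y \in {:L}%AS -> \sum_(t : G | predT t) c_ t * t y = 0.
    move=> y _; rewrite (coord_vbasis (memvf y)).
    under eq_bigr => t _ do rewrite linear_sum mulr_sumr.
    rewrite exchange_big big1 // => i _ /=.
    under eq_bigr => t _ do rewrite linearZ -scalerAr.
    rewrite -scaler_sumr; have := congr1 (fun M : 'rV_d => M 0 i) cA.
    rewrite mxE [RHS]mxE (reindex (@enum_val _ {: G})) /=; last first.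
      by exists enum_rank => t _; [exact: enum_valK|exact: enum_rankK].
    under eq_bigr => k _ do rewrite !mxE.
    move=> e0; rewrite (eq_bigr (fun k => c 0 k * t_ k e`_i)) ?e0 ?scaler0 // => k _.
    by rewrite /c_ enum_valK.
  by have := gal_independent indep (x := t_ j) isT; rewrite /c_ enum_valK.
have Arf : row_free A by rewrite -row_leq_rank Afull gd.
have Arful : row_full A by rewrite /row_full Afull.
pose P := map_mx tens1 A; pose Q := map_mx tens1 (pinvmx A).
have PQ : P *m Q = 1%:M by rewrite -map_mxM mulmxVp // map_mx1.
have QP : Q *m P = 1%:M by rewrite -map_mxM mulVpmx // map_mx1.
pose M : 'M[E]_d := \matrix_(i, j) (T 1 e`_i * x) 0 j.
pose D : 'M[LE]_g := diag_mx (\row_j bc_right (t_ j) x).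
have MP : map_mx (GRing.in_alg LE) M *m P = P *m D.
  apply/matrixP => i j; rewrite mul_mx_diag !mxE.
  have := congr1 (bc_right (t_ j)) (bc_basis (T 1 e`_i * x)).
  rewrite bc_rightM bc_right_tensor => ->.
  rewrite (big_morph (bc_right (t_ j)) (bc_rightD (t_ j)) (bc_right0 iota (t_ j))).
  apply: eq_bigr => k _; rewrite bc_rightZ bc_right_tensor !mxE.
  by rewrite mulr_algl.
have e0 := det_similar PQ QP MP; rewrite det_map_mx det_diag /= in e0.
rewrite tensor_scalar alg_norm_basis -/M e0.
rewrite [RHS](reindex (@enum_val _ {: G})) /=; last first.
  by exists enum_rank => t _; [exact: enum_valK|exact: enum_rankK].
by apply: eq_bigr => j _; rewrite mxE.
Qed.

End GaloisNorm.

(** * Comparison with the fundamental class *)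

(** The element [dl] transports the solution [bet] of [f x / x = g gam / gam] to a
    solution of [f x / x = g alpha / alpha], and two solutions of the latter differ
    by a fixed element. *)
Lemma twisted_solutions (A : comUnitRingType) (f g : A -> A) (alpha gam bet dl beta : A) :
  monoid_morphism f -> monoid_morphism g -> (forall x, f (g x) = g (f x)) ->
  alpha \is a GRing.unit -> gam \is a GRing.unit -> bet \is a GRing.unit ->
  dl \is a GRing.unit -> beta \is a GRing.unit ->
  f bet * gam = g gam * bet -> f dl = alpha / gam * dl ->
  f beta / beta = g alpha / alpha ->
  exists2 c, f c = c & beta = bet * (g dl / dl) * c.
Proof.
move=> [f1 fM] [g1 gM] fg au gu bu du betau hbet hdl hbeta.
have unitM (h : A -> A) : monoid_morphism h -> forall x, x \is a GRing.unit ->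
    h x \is a GRing.unit /\ h x^-1 = (h x)^-1.
  case=> h1 hM x ux; have e : h x * h x^-1 = 1 by rewrite -hM divrr.
  have hu : h x \is a GRing.unit by apply/unitrP; exists (h x^-1); rewrite mulrC.
  by split=> //; apply: (mulrI hu); rewrite e divrr.
have [gau _] := unitM g (conj g1 gM) _ au; have [ggu gV] := unitM g (conj g1 gM) _ gu.
have [gdu _] := unitM g (conj g1 gM) _ du.
pose b1 := bet * (g dl / dl).
have b1u : b1 \is a GRing.unit by rewrite !unitrM bu gdu unitrV.
have [_ fV1] := unitM f (conj f1 fM) _ b1u; have [_ fVd] := unitM f (conj f1 fM) _ du.
have hb1 : f b1 = g alpha / alpha * b1.
  have fgd : f (g dl) = g alpha / g gam * g dl by rewrite fg hdl !gM gV.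
  have fb : f bet = g gam * bet / gam by rewrite -hbet mulrK.
  rewrite /b1 !fM fVd fgd hdl fb !invrM ?unitrM ?unitrV ?au ?gu // invrK.
  transitivity ((gam / gam) * (g gam / g gam) * (g alpha / alpha * (bet * (g dl / dl)))).
    by ring.
  by rewrite divrr // divrr // !mul1r.
exists (beta / b1); last by rewrite mulrC divrK.
have -> : f (beta / b1) = f beta / f b1 by rewrite fM fV1.
have -> : f beta = g alpha / alpha * beta by rewrite -hbeta divrK.
have cu : g alpha / alpha \is a GRing.unit by rewrite unitrM gau unitrV.
rewrite hb1; move: (g alpha / alpha) cu => c cu; rewrite invrM //.
transitivity ((c / c) * (beta / b1)); first by ring.
by rewrite divrr // mul1r.
Qed.

Lemma twisted_norm (A : comUnitRingType) (F : fieldType) (N : A -> F) (g : A -> A)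
    (gam bet dl x : A) :
  (forall a b, N (a * b) = N a * N b) -> (forall a, N (g a) = N a) -> N 1 = 1 ->
  gam \is a GRing.unit -> dl \is a GRing.unit ->
  (x * gam = g gam * bet -> N x = N bet) /\ N (bet * (g dl / dl) * x) = N bet * N x.
Proof.
move=> NM Ng N1 gu du.
have N0 a : a \is a GRing.unit -> N a != 0.
  by move=> au; apply: contra_eq_neq N1 => a0; rewrite -(mulrV au) NM a0 mul0r eq_sym oner_neq0.
split=> [e|]; first by apply: (mulIf (N0 _ gu)); rewrite -NM e NM Ng mulrC.
have e : N (g dl / dl) = 1.
  by apply: (mulIf (N0 _ du)); rewrite -NM divrK // Ng mul1r.
by rewrite !NM -[N (g dl) * _]NM e mulr1.
Qed.

Section Final.

Variables (K E : fieldType) (iota : {rmorphism K -> E}).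
Variable L : splittingFieldType K.
Hypothesis hL : galois 1%AS {:L}%AS.

Local Notation LE := (base_change iota L).
Local Notation T c a := (tensor iota c a : LE).
Local Notation G := (gal_of {:L}).

Lemma tensor1_inj (a b : L) : T 1 a = T 1 b -> a = b.
Proof.
move=> e; rewrite (coord_vbasis (memvf a)) [RHS](coord_vbasis (memvf b)).
apply: eq_bigr => i _; congr (_ *: _).
have := congr1 (fun x : LE => x 0 i) e; rewrite /= !tensorE !mul1r.
exact: fmorph_inj.
Qed.

Lemma tensor_scalar_inj (c c' : E) : T c 1 = T c' 1 -> c = c'.
Proof.
rewrite !tensor_scalar => /eqP; rewrite -subr_eq0 -scalerBl scaler_eq0 oner_eq0 orbF.
by rewrite subr_eq0 => /eqP.
Qed.

Lemma bc_right_comp (s t : G) (x : LE) : bc_right t (bc_right s x) = bc_right (gcomp t s) x.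
Proof.
elim/(@bc_ind _ _ iota L): x => [|x x' hx hx'|c a]; first by rewrite !bc_right0.
  by rewrite !bc_rightD hx hx'.
by rewrite !bc_right_tensor; congr (tensor _ _ _); rewrite [RHS]gcompE.
Qed.

Lemma gcomp_inj (s : G) : injective (fun t : G => gcomp t s).
Proof. by move=> t t' /mulgI. Qed.

Lemma bc_norm_right (s : G) (x : LE) : alg_norm (bc_right s x) = alg_norm x.
Proof.
apply: tensor_scalar_inj; transitivity (\prod_(t : G) bc_right t (bc_right s x)).
  exact: bc_norm_prod.
transitivity (\prod_(t : G) bc_right t x); last by symmetry; exact: bc_norm_prod.
rewrite [RHS](reindex_inj (@gcomp_inj s)) /=; apply: eq_bigr => t _.
exact: bc_right_comp.
Qed.

Lemma tensor1_prod I (r : seq I) (f : I -> L) :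
  T 1 (\prod_(i <- r) f i) = \prod_(i <- r) T 1 (f i).
Proof.
by elim: r => [|i r IH]; rewrite ?big_nil // !big_cons -IH tensorM mulr1.
Qed.

(** After reindexing the product over [t], the factors [beta t] and [beta (t s)]
    cancel. *)
Lemma prod_coboundary (a : G -> G -> L) (beta : G -> LE) s :
  (forall s, beta s \is a GRing.unit) ->
  (forall s t, T 1 (a s t) * beta (gcomp s t) = bc_right s (beta t) * beta s) ->
  T (alg_norm (beta s)) 1 = T 1 (\prod_(t : G) a t s).
Proof.
move=> bu hb; have pu : \prod_(t : G) beta t \is a GRing.unit.
  by elim/big_ind: _ => [|x y ux uy|t _]; [exact: unitr1|rewrite unitrM ux|exact: bu].
apply: (mulIr pu); rewrite bc_norm_prod // tensor1_prod.
rewrite [X in _ = _ * X](reindex_inj (@gcomp_inj s)) /= -!big_split /=.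
by apply: eq_bigr => t _; rewrite hb.
Qed.

End Final.

Section GaloisCochains.

Variables (K : fieldType) (L : splittingFieldType K).
Hypothesis hL : galois 1%AS {:L}%AS.
Local Notation G := (gal_of {:L}).

Lemma gal_norm_prod (x : L) : (alg_norm x)%:A = \prod_(t : G) t x.
Proof.
apply: (@tensor1_inj _ _ idfun); rewrite tensor_iota -tensor_scalar -alg_norm_tensor bc_norm_prod //.
by rewrite tensor1_prod; apply: eq_bigr => t _; rewrite bc_right_tensor.
Qed.

(** In the product over [t] the factors [c t] and [c (t s)] cancel, and what is left
    is the norm of [c s]. *)
Lemma prod_cohomologous (a a' : G -> G -> L) s : cohomologous2 a a' ->
  exists2 l : L, l != 0 & \prod_(t : G) a t s = (\prod_(t : G) a' t s) * (alg_norm l)%:A.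
Proof.
case=> c [c0 hc]; exists (c s) => //.
under eq_bigr do rewrite hc.
rewrite big_split prodf_div big_split /= gal_norm_prod; congr (_ * _).
rewrite [X in _ / X](_ : _ = \prod_(t : G) c t); last first.
  by rewrite [RHS](reindex_inj (@gcomp_inj _ _ s)).
by rewrite mulrAC divff ?mul1r //; apply/prodf_neq0.
Qed.

End GaloisCochains.

Theorem theorem1p5p1
  (K : fieldType) (v : K -> int) (q : nat) (hK : local_field v q)
  (Knr : fieldType) (iota : {rmorphism K -> Knr}) (vnr : Knr -> int)
  (hKnr : completed_max_unramified v iota vnr)
  (sigma : {rmorphism Knr -> Knr}) (hsigma : frobenius q iota vnr sigma)
  (L : splittingFieldType K) (hL : galois 1%AS {:L}%AS)
  (a : gal_of {:L} -> gal_of {:L} -> L) (ha : fundamental_cocycle v q a)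
  (alpha : base_change iota L) (halpha : alpha \is a GRing.unit)
  (hw : w_ext vnr alpha = - (\dim {:L})%:R^-1)
  (s : gal_of {:L})
  (beta : base_change iota L) (hbeta : beta \is a GRing.unit)
  (hs : bc_left sigma beta / beta = bc_right s alpha / alpha) :
  exists2 y : K, iota y = alg_norm beta & eta_class a s = norm_class L y.
Proof.
have hE := unr_completeP hKnr; have hve := uc_val hE; have hv := local_valuation hK.
have sK := frob_iota hsigma; have sval := frob_val hK hE hsigma.
have [_ [a' [B [[[a'0 _] a'n] coh [i [u [uM ui bas]]] inv]]]] := ha.
set d := \dim {:L} in hw inv.
have d0 : (0 < d)%N by apply: adim_gt0.
have d0' : d%:R != 0 :> rat by rewrite pnatr_eq0 -lt0n.
have dimB : \dim {:B} = (d * d)%N by rewrite (dim_crossed bas) card_gal.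
have [r [h [z [[rB rM rS] [hu hr ez]]]]] := invariant_isocrystal hK hE hsigma dimB inv.
have [gam [bet [gu bu hb hg vg]]] :=
  isocrystal_cocycle hve hsigma sval a'0 a'n uM ui bas rB rM rS hu hr.
have vh : vnr (\det h) = 1 - d%:Z * z.
  apply/eqP; rewrite -(eqr_int rat) rmorphB rmorphM /= -[d%:~R]/(d%:R).
  by move: ez; rewrite mulVf // => e; rewrite rmorph1 [X in X - _]e addrK.
clear hu hr rB rM rS.
have slope (x y : int) : 1 * (- x) * y + - (1 - y * x) = -1 by ring.
have [p p0 vp] := val_unif hv.
(* a power of the uniformizer of K corrects the slope without changing s(gam)/gam *)
pose k := p ^ (- z); have k0 : k != 0 by rewrite expfz_neq0.
pose gam1 := tensor iota 1 k%:A * gam.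
have ku : tensor iota 1 (k%:A : L) \is a GRing.unit.
  by apply: tensor1_unit; rewrite -in_algE fmorph_eq0.
have g1u : gam1 \is a GRing.unit by rewrite unitrM ku gu.
have vg1 : vnr (alg_norm gam1) = -1.
  have -> : alg_norm gam1 = iota (k ^+ d) * alg_norm gam.
    by rewrite [LHS]alg_normM alg_norm_tensor alg_norm_scalar.
  have kd0 : k ^+ d != 0 by apply: expf_neq0.
  have ikd0 : iota (k ^+ d) != 0 by rewrite fmorph_eq0.
  rewrite (valM_ hve ikd0 (alg_norm_unit gu)) vg vh (uc_ext hE kd0).
  by rewrite (valX hv _ k0) (valXz hv _ p0) vp slope.
have hg1 t : bc_left sigma (bet t) * gam1 = bc_right t gam1 * bet t.
  rewrite /gam1 bc_rightM bc_right_tensor linearZ rmorph1 /=.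
  by rewrite mulrCA hg mulrA.
clearbody gam1.
have valpha : vnr (alg_norm alpha) = -1.
  apply/eqP; rewrite -(eqr_int rat) -[_%:~R](divfK d0') -/(w_ext vnr alpha).
  by move: hw; rewrite /w_ext -/d => ->; rewrite mulNr mulVf.
have [dl dlu hdl] : exists2 y, y \is a GRing.unit & bc_left sigma y = alpha / gam1 * y.
  have g1u' : gam1^-1 \is a GRing.unit by rewrite unitrV g1u.
  apply: (lang_base_change hK hE hsigma); first by rewrite unitrM halpha g1u'.
  have ng1 : (alg_norm gam1)^-1 != 0 by rewrite invr_eq0 (alg_norm_unit g1u).
  rewrite (etrans (alg_normM _ _) (congr1 _ (alg_normV g1u))).
  rewrite (valM_ hve (alg_norm_unit halpha) ng1).
  have vng1 := etrans (valV hve (alg_norm_unit g1u)) (congr1 -%R vg1).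
  exact: (congr2 +%R valpha vng1).
have [w hw0 ebeta0] := twisted_solutions (conj (bc_left1 _ sK) (bc_leftM sK))
  (conj (bc_right1 _ s) (bc_rightM s)) (fun x => bc_left_right s x sK)
  halpha g1u (bu s) dlu hbeta (hg1 s) hdl hs.
have [l el] := bsig_fixed hsigma hw0.
have ebeta : beta = bet s * (bc_right s dl / dl) * tensor iota 1 l by rewrite -el.
have l0 : l != 0.
  by apply: contraTneq hbeta => l0; rewrite ebeta l0 tensor0r mulr0 unitr0.
have [Nbet _] := twisted_norm (bet s) (bc_left sigma (bet s))
  (@alg_normM _ _) (bc_norm_right hL s) (@alg_norm1 _ _) g1u dlu.
have [_ Nbeta] := twisted_norm (bet s) (tensor iota 1 l)
  (@alg_normM _ _) (bc_norm_right hL s) (@alg_norm1 _ _) g1u dlu.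
have [ys eys] : exists ys, alg_norm (bet s) = iota ys.
  by apply/(frob_fixed hsigma); rewrite -(alg_norm_left sK) (Nbet (hg1 s)).
have prods : \prod_(t : gal_of {:L}) a' t s = ys%:A.
  apply: (@tensor1_inj _ _ iota); rewrite -(prod_coboundary hL s bu hb) eys.
  by rewrite tensor_iota -tensor_scalar.
have Nl (x : L) : x != 0 -> alg_norm x != 0.
  by move=> x0; apply: alg_norm_unit; rewrite unitfE.
exists (ys * alg_norm l).
  by rewrite rmorphM -eys -alg_norm_tensor ebeta Nbeta.
have [c cneq0 hc] := prod_cohomologous hL s coh.
apply/seteqP; split=> y; rewrite /eta_class /norm_class /=.
  case=> m m0; rewrite hc prods -!in_algE -!rmorphM => /fmorph_inj ->.
  exists (c * m / l); first by rewrite !mulf_neq0 ?invr_eq0.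
  rewrite !alg_normM alg_normV ?unitfE //; field; exact: Nl.
case=> m m0 ->; exists (l * m / c); first by rewrite !mulf_neq0 ?invr_eq0.
rewrite hc prods -!in_algE -!rmorphM; congr (in_alg L _).
by rewrite !alg_normM alg_normV ?unitfE //; field; exact: Nl.
Qed.
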